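(* Let $c = dd'e$ for some $d, d', e \in \mathbb{Z}_+$ with $d' \mid d$ and $(d,e)=1$, and let $f \le \sqrt{cd}$ be the largest integer with $f^2 \mid cd$. Let $\mathcal{I}, \mathcal{J} \subset \mathbb{Z}$ be intervals of lengths $|\mathcal{I}| = M$, $|\mathcal{J}| = N$, with $1 \le N \le M \le c$. Then for any complex sequences $(\alpha_m)_{m\in\mathcal{I}}$, $(\beta_n)_{n\in\mathcal{J}}$ and any $a \in (\mathbb{Z}/c\mathbb{Z})^\times$, one has $$\sum_{\substack{m\in\mathcal{I},\ n\in\mathcal{J}\\(m,n,c)=1}} \alpha_m\beta_n S(am,n;c) \ll \|\alpha\|\,\|\beta\|\,c^{1+o(1)}\left(\frac{dM^3N}{c^3}+\frac{fM^2}{c^2}+\frac{f}{d^2}\right)^{\frac16} = \|\alpha\|\,\|\beta\|\,c^{o(1)}\sqrt{MNc}\left(\frac{d}{N^2}+\frac{fc}{MN^3}+\frac{fc^3}{d^2M^3N^3}\right)^{\frac16}.$$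
   Context: $\mathbb{Z}_+$ is the set of positive integers; $e(t) := \exp(2\pi i t)$ when $e(\cdot)$ is applied to a real argument. The Kloosterman sum is $S(m,n;c) := \sum_{x \in (\mathbb{Z}/c\mathbb{Z})^\times} e\left(\frac{mx+n\bar{x}}{c}\right)$, where $x\bar{x}\equiv1\pmod c$; it depends only on the residues of $m,n$ modulo $c$. $(\cdot,\cdot)$ and $(\cdot,\cdot,\cdot)$ denote greatest common divisors. An interval in $\mathbb{Z}$ is a finite set of consecutive integers, and its length $|\mathcal{I}|$ is its cardinality. $\|\alpha\| := (\sum_m|\alpha_m|^2)^{1/2}$ and similarly for $\beta$. A bound $X \ll c^{o(1)}Y$ means: for every $\varepsilon>0$ there is a constant $K_\varepsilon$ depending only on $\varepsilon$ with $|X|\le K_\varepsilon c^{\varepsilon}Y$. *)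

(* Defs.v *)
From mathcomp Require Import all_boot all_order all_algebra.
From mathcomp Require Export complex.
From mathcomp Require Import reals exp trigo.
Set Implicit Arguments.
Unset Strict Implicit.
Unset Printing Implicit Defensive.
Import Order.TTheory GRing.Theory Num.Theory.
Local Open Scope ring_scope.
Local Open Scope complex_scope.

Definition expi2pi (R : realType) (t : R) : R[i] :=
  (cos (2 * pi * t)) +i* (sin (2 * pi * t)).

(* The modulus as an element of R; `|z| would be an element of R[i]. *)
Definition cabs (R : realType) (z : R[i]) : R := ComplexField.Normc.normc z.

(* A natural number whose class inverts that of x modulo c when x and c are
   coprime. For c = 1 every value is an inverse, so x = 0 is harmless. *)
Definition invmod (c x : nat) : nat := (egcdn x c).1.

Lemma invmodP (c x : nat) : coprime x c -> (x * invmod c x = 1 %[mod c])%N.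
Proof.
rewrite /invmod; case: x => [|x] cop.
  by move: cop; rewrite /coprime gcd0n => /eqP ->; rewrite !modn1.
case: egcdnP => //= km kn def_g _.
by rewrite mulnC def_g (eqP cop) modnMDl.
Qed.

(* 'I_c rather than 'Z_c, since 'Z_1 is the ring of integers mod 2. *)
Definition kloosterman (R : realType) (m n : int) (c : nat) : R[i] :=
  \sum_(x < c | coprime x c)
    expi2pi ((m * x%:Z + n * (invmod c x)%:Z)%:~R / c%:R : R).

Definition int_interval (m0 : int) (M : nat) : seq int :=
  [seq m0 + k%:Z | k <- iota 0 M].

Definition l2norm (R : realType) (I : seq int) (alpha : int -> R[i]) : R :=
  Num.sqrt (\sum_(m <- I) cabs (alpha m) ^+ 2).

Definition bilinear_kloosterman (R : realType) (c : nat) (a : int)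
    (I J : seq int) (alpha beta : int -> R[i]) : R[i] :=
  \sum_(m <- I) \sum_(n <- J | gcdz (gcdz m n) c%:Z == 1)
    alpha m * beta n * kloosterman R (a * m) n c.

Definition largest_square_root_divisor (f k : nat) : Prop :=
  (f ^ 2 <= k)%N /\ (f ^ 2 %| k)%N /\
  forall g : nat, (g ^ 2 <= k)%N -> (g ^ 2 %| k)%N -> (g <= f)%N.

(* Main.v *)
Require Import Defs.
From mathcomp Require Import all_boot all_order all_algebra.
From mathcomp Require Import reals exp trigo.
From mathcomp Require Import cyclic ring lra zify.
Set Implicit Arguments.
Unset Strict Implicit.
Unset Printing Implicit Defensive.
Import Order.TTheory GRing.Theory Num.Theory.
Local Open Scope ring_scope.

(* With b = c/d, put f_m(x) = e(a m x_1/x_2 / c) and g_n(x) = e(n x_2/x_1 / c) on pairs x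
   of residues whose relevant entry is a unit. Over matrices (x, u) in SL_2(Z/c), the
   correlation of f_m with translates of g_n by multiples of b u recovers S(am, n; c) up to
   an explicit factor as soon as (m, n, d) = 1, so the bilinear form is an average over
   units xi of scalar products of T^(-xi b) F and T^(xi b) G, where
   T^xi F(x, u) = sum_t e(xi t / c) F(x + b t u) and F, G superpose the f_m and the g_n.
   The twists T^xi are mutually orthogonal and T^(xi b) F is invariant under the right action
   of a large Borel subgroup, which bounds the norms. As m and n lie in intervals, F and G
   are nearly fixed by averages P, Q over H ~ c/M upper and K ~ c/N lower unipotents;
   inserting P and Q and applying Cauchy-Schwarz three times bounds the sixth power by the
   number of words of alternating short unipotents having a fixed vector modulo the Borel
   subgroup. Such a word is a congruence M_1 = lam M_2 modulo some g with d | g | c, and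
   there are c^o(1) (K^2 + H K^3/g + H^3 K^3/g^3) of them. *)

(** * Determinants and translations of plane vectors *)

Section PlaneVectors.
Variable A : comUnitRingType.
Implicit Types (x u v : A * A) (a : A).

(** The obstacle is that [a m] and [n] need not be units of Z/c, whereas averaging translates
    reproduces f_m or g_n up to a scalar only where its parameter acts as a unit. Since (m, n, d) =
    1, an idempotent of Z/c splits the ring so that, up to what the factor b kills, the parameter of
    f_m is a unit on one component and that of g_n on the other; the translation is put on f_m in
    the first and on g_n in the second. The scalar contains the square of a real Ramanujan sum, so
    all translations contribute nonnegatively and the trivial ones alone give a sufficient lower
    bound. The twists carry opposite signs so that the phases depend only on the difference of the
    two translations. The parameter f enters through the count of fixed vectors: they are zeros of a
    quadratic form of content g, and their number may exceed the generic one by the largest t with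
    t^2 | c/g; as d | g, (d t)^2 divides c d, so d t <= f. *)

Definition cross x u : A := x.1 * u.2 - x.2 * u.1.
Definition axpy a x u : A * A := (x.1 + a * u.1, x.2 + a * u.2).

Lemma cross_axpyl a x u : cross (axpy a x u) u = cross x u.
Proof. rewrite /cross /axpy /=; ring. Qed.

Lemma axpyA a b x u : axpy a (axpy b x u) u = axpy (a + b) x u.
Proof. rewrite /axpy /=; congr pair; ring. Qed.

Lemma axpy0 x u : axpy 0 x u = x.
Proof. by case: x => x1 x2; rewrite /axpy /= !mul0r !addr0. Qed.

Lemma axpyK a u : cancel (fun x => axpy a x u) (fun x => axpy (- a) x u).
Proof. by move=> x; rewrite axpyA addNr axpy0. Qed.

End PlaneVectors.

(** * Averages of characters over translates, and the pairing that yields Kloosterman sums *)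

Section CharacterSums.
Variables (A : finComUnitRingType) (C : numFieldType) (psi : A -> C).
Hypothesis psiD : forall x y, psi (x + y) = psi x * psi y.
Hypothesis psi_prim : forall q, q != 0 -> \sum_k psi (q * k) = 0.

Local Notation unit := (GRing.unit : {pred A}).

Definition fchar (mu : A) (x : A * A) : C :=
  if x.2 \is a GRing.unit then psi (mu * x.1 / x.2) else 0.
Definition gchar (l : A) (x : A * A) : C := fchar l (x.2, x.1).
(** Over Z/c this is the Ramanujan sum. *)
Definition unit_sum (z : A) : C := \sum_(n in unit) psi (n * z).
Definition unit_count (z : A) : nat := #|[pred k : A | 1 - z * k \in unit]|.

Lemma reindex_unit (g : A -> C) t : t \is a GRing.unit ->
  \sum_(n in unit) g n = \sum_(n in unit) g (n * t).
Proof.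
move=> ut; rewrite (reindex_onto (fun n => n * t) (fun n => n / t)) /=; last first.
  by move=> n _; rewrite divrK.
by apply: eq_bigl => n; rewrite mulrK // eqxx andbT unitrMl.
Qed.

Lemma unit_sumM z t : t \is a GRing.unit -> unit_sum (z * t) = unit_sum z.
Proof.
move=> ut; rewrite [RHS](reindex_unit _ ut); apply: eq_bigr => n _.
by rewrite mulrAC mulrA.
Qed.

Lemma unit_countM z t : t \is a GRing.unit -> unit_count (z * t) = unit_count z.
Proof.
move=> ut; rewrite /unit_count -!sum1_card.
rewrite [RHS](reindex_onto (fun n => t * n) (fun n => n / t)) /=; last first.
  by move=> n _; rewrite mulrC divrK.
apply: eq_bigl => n; rewrite !inE mulrA.
have -> : t * n / t = n by rewrite mulrC mulKr.
by rewrite eqxx andbT.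
Qed.

(** The second coordinate of u is free and determines the first. Writing it as k * x2 makes the
    second coordinate of a translate x + y u equal to x2 (1 + y k). *)
Lemma sum_cross_unit (e x1 x2 : A) (g : A * A -> C) : x2 \is a GRing.unit ->
  \sum_(u | cross (x1, x2) u == e) g u =
  \sum_k g ((x1 * (k * x2) - e) / x2, k * x2).
Proof.
move=> ux; rewrite (reindex_onto (fun k => ((x1 * (k * x2) - e) / x2, k * x2))
   (fun u : A * A => u.2 / x2)) /=; last first.
  case=> u1 u2 /= /eqP <-; rewrite /cross /= divrK //; congr pair.
  rewrite opprB addrC subrK mulrC; exact: mulKr.
apply: eq_bigl => k; rewrite mulrK // eqxx andbT /cross /=.
by rewrite mulrC [x2 * _]mulrC divrK // opprB addrC mulrC subrK eqxx.
Qed.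

(** For x.2 a unit, translation changes x.1 / x.2 by a multiple of n / (1 + z n k), and a change of
    variable in n removes the denominator. For x.2 a non-unit both sides vanish. The amplitude of
    the change involves mu only through z * mu = z * mu', and invertibility of mu' then evaluates
    the sum over n. *)
Lemma fchar_average (e mu mu' z : A) (x : A * A) :
  e \is a GRing.unit -> mu' \is a GRing.unit -> z * mu = z * mu' ->
  \sum_(n in unit) \sum_(u | cross x u == e) fchar mu (axpy (z * n) x u)
  = (unit_count z)%:R * unit_sum z * fchar mu x.
Proof.
move=> ue umu' zmu; case: x => x1 x2.
have [ux|nux] := boolP (x2 \is a GRing.unit).
- have -> : fchar mu (x1, x2) = psi (mu * x1 / x2) by rewrite /fchar /= ux.
  under eq_bigr => n _ do rewrite sum_cross_unit //.
  have fE n k : fchar mu (axpy (z * n) (x1, x2) ((x1 * (k * x2) - e) / x2, k * x2)) =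
    if 1 + z * n * k \is a GRing.unit then
     psi (mu * x1 / x2) * psi (- (mu * z * e / x2 / x2) * (n / (1 + z * n * k))) else 0.
    rewrite /fchar /axpy /=.
    have -> : x2 + z * n * (k * x2) = x2 * (1 + z * n * k) by ring.
    rewrite unitrM ux /=; case: ifP => // uw; rewrite -psiD; congr psi.
    rewrite invrM // mulrBl.
    have -> : x1 * (k * x2) / x2 = x1 * k by rewrite mulrA mulrK.
    set w := (1 + z * n * k)^-1; set i := x2^-1.
    have ww : (1 + z * n * k) * w = 1 by rewrite divrr.
    transitivity (mu * x1 * i * ((1 + z * n * k) * w) - mu * z * e * i * i * (n * w)).
      by ring.
    by rewrite ww mulr1 mulNr.
  under eq_bigr => n _ do (under eq_bigr => k _ do rewrite fE).
  rewrite exchange_big /=.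
  under eq_bigr => k _ do (rewrite -big_mkcondr /= -mulr_sumr).
  rewrite -mulr_sumr mulrC; congr (_ * _).
  set q := - _.
  (* The substitution n -> n / (1 + z n k), with inverse n -> n / (1 - z n k), makes the phase
     linear in n. *)
  have step k : \sum_(n in unit | 1 + z * n * k \is a GRing.unit) psi (q * (n / (1 + z * n * k)))
     = \sum_(n in unit | 1 - z * n * k \is a GRing.unit) psi (q * n).
    rewrite [RHS](reindex_onto (fun n => n / (1 + z * n * k)) (fun n => n / (1 - z * n * k))) /=.
      apply: eq_big => [n|n /andP[]//].
      have [un|] := boolP (n \in unit); last first.
        move=> nun; case: (boolP (1 + z * n * k \is a GRing.unit)) => uw /=.
          by rewrite unitrMl ?unitrV // (negPf nun).
        by rewrite invr_out // unitrM (negPf nun).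
      case: (boolP (1 + z * n * k \is a GRing.unit)) => uw /=.
        rewrite unitrMl ?unitrV // un /=.
        have E : 1 - z * (n / (1 + z * n * k)) * k = (1 + z * n * k)^-1.
          apply: (mulIr uw); rewrite mulVr // mulrBl mul1r.
          have -> : z * (n / (1 + z * n * k)) * k * (1 + z * n * k) =
            z * n * k * ((1 + z * n * k)^-1 * (1 + z * n * k)) by ring.
          by rewrite mulVr // mulr1 addrK.
        by rewrite E unitrV uw invrK divrK // eqxx.
      by rewrite unitrM unitrV un (negPf uw).
    move=> n /andP[un uw].
    have E : 1 + z * (n / (1 - z * n * k)) * k = (1 - z * n * k)^-1.
      apply: (mulIr uw); rewrite mulVr // mulrDl mul1r.
      have -> : z * (n / (1 - z * n * k)) * k * (1 - z * n * k) =
        z * n * k * ((1 - z * n * k)^-1 * (1 - z * n * k)) by ring.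
      by rewrite mulVr // mulr1 subrK.
    by rewrite E invrK divrK.
  under eq_bigr => k _ do rewrite step.
  under eq_bigr => k _ do rewrite big_mkcondr /=.
  rewrite exchange_big /=.
  have cnt n : n \in unit ->
    \sum_k (if 1 - z * n * k \is a GRing.unit then psi (q * n) else 0) =
    (unit_count z)%:R * psi (q * n).
    move=> un; rewrite -big_mkcond /= sumr_const -(unit_countM z un) mulr_natl.
    by [].
  rewrite (eq_bigr _ cnt) -mulr_sumr; congr (_ * _).
  have -> : q = z * mu' * (- (e / x2 / x2)).
    rewrite /q -zmu; ring.
  rewrite -[RHS](unit_sumM z umu') -(unit_sumM (z * mu') (t := - (e / x2 / x2))).
    by apply: eq_bigr => n _; rewrite mulrC.
  by rewrite unitrN !unitrM !unitrV ux ue.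
have -> : fchar mu (x1, x2) = 0 by rewrite /fchar /= (negPf nux).
rewrite mulr0; apply: big1 => n un.
(* A non-unit of a finite ring is a zero divisor: otherwise multiplication by x2 would be injective,
   hence onto. *)
have [k k0 kx2] : exists2 k, k != 0 & k * x2 = 0.
  have : ~~ [forall k, (k * x2 == 0) ==> (k == 0)].
    apply: contra nux => /forallP inj.
    have injx : injective (fun k => k * x2).
      move=> a b ab; apply/eqP; rewrite -subr_eq0.
      by have := inj (a - b); rewrite mulrBl ab subrr eqxx.
    have [g gK Kg] := injF_bij injx.
    apply/unitrP; exists (g 1); split; first exact: Kg.
    by rewrite mulrC; exact: Kg.
  rewrite negb_forall => /existsP[k]; rewrite negb_imply => /andP[/eqP ? ?].
  by exists k.
set S := \sum_(u | _) _.
(* Replacing u by u + k j x preserves the determinant and, as k x2 = 0, the denominators; each term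
   only gains a phase linear in j. *)
have inv (j : A) : S = \sum_(u | cross (x1, x2) u == e)
    fchar mu (axpy (z * n) (x1, x2) u) *
    psi (mu * (z * n * k * x1) / (x2 + z * n * u.2) * j).
  rewrite /S (reindex_onto (fun u => axpy (k * j) u (x1, x2))
     (fun u => axpy (- (k * j)) u (x1, x2))) /=; last first.
    by move=> u _; rewrite axpyA addrN axpy0.
  apply: eq_big => [u|u _].
    rewrite axpyK eqxx andbT; congr (_ == _).
    rewrite /cross /axpy /=; ring.
  rewrite /fchar /axpy /=.
  have -> : x2 + z * n * (u.2 + k * j * x2) = x2 + z * n * u.2 + z * n * j * (k * x2) by ring.
  rewrite kx2 mulr0 addr0; case: ifP => uy; last by rewrite mul0r.
  by rewrite -psiD; congr psi; ring.
have : #|A|%:R * S = 0.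
  have -> : #|A|%:R * S = \sum_(j : A) S by rewrite sumr_const mulr_natl.
  rewrite (eq_bigr _ (fun j _ => inv j)) exchange_big /=; apply: big1 => u /eqP xu.
  rewrite -mulr_sumr; rewrite {1}/fchar /axpy /=; case: ifP => uy; last by rewrite mul0r.
  (* The coefficient of j is nonzero: otherwise z k x1 = 0, so z k e = 0 by expanding the
     determinant, so z k = 0 and k would kill the unit x2 + z n u.2. *)
  rewrite psi_prim ?mulr0 //; apply: contraNneq k0 => H.
  have {H} : (mu * z * n * k * x1) / (x2 + z * n * u.2) = 0 by rewrite -[RHS]H; ring.
  move/(congr1 (fun t => t * (x2 + z * n * u.2))); rewrite divrK // mul0r => H.
  have H2 : mu' * n * (z * k * x1) = 0 by rewrite -[RHS]H [mu * z]mulrC zmu; ring.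
  have zkx1 : z * k * x1 = 0.
    have unn : mu' * n \is a GRing.unit by rewrite unitrM umu'.
    by apply: (mulrI unn); rewrite mulr0.
  have zke : z * k * e = 0.
    rewrite -xu /cross /=.
    have -> : z * k * (x1 * u.2 - x2 * u.1) = z * k * x1 * u.2 - z * (k * x2) * u.1 by ring.
    by rewrite zkx1 kx2; ring.
  have zk : z * k = 0 by apply: (mulIr ue); rewrite zke mul0r.
  have : k * (x2 + z * n * u.2) = 0.
    have -> : k * (x2 + z * n * u.2) = k * x2 + z * k * n * u.2 by ring.
    by rewrite kx2 zk; ring.
  by move=> H3; apply/eqP; apply: (mulIr uy); rewrite mul0r.
move/eqP; rewrite mulf_eq0 pnatr_eq0 => /orP[|/eqP//].
by rewrite -leqn0 leqNgt; case/negP; apply/card_gt0P; exists 0.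
Qed.

(** Swapping the coordinates reverses the sign of the determinant, which is why [fchar_average] is
    stated for any unit value e of it. *)
Lemma gchar_average (l l' z : A) (x : A * A) :
  l' \is a GRing.unit -> z * l = z * l' ->
  \sum_(n in unit) \sum_(u | cross x u == 1) gchar l (axpy (z * n) x u)
  = (unit_count z)%:R * unit_sum z * gchar l x.
Proof.
move=> ul zl; rewrite /gchar -(@fchar_average (-1) l l') ?unitrN ?unitr1 //.
apply: eq_bigr => n _.
rewrite [RHS](reindex_onto (fun u : A * A => (u.2, u.1)) (fun u : A * A => (u.2, u.1))) /=;
  last by case.
apply: eq_bigl => -[u1 u2] /=; rewrite eqxx andbT /cross /=.
by rewrite -[in RHS]opprB eqr_opp.
Qed.

(* Along an idempotent, [(a, b) |-> (mix a b, mix b a)] is an involution of pairs;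
   this is how sums factor over the two components of the ring. *)
Lemma sum_mix (T : finType) (mix : T -> T -> T) (P : pred T) (g : T -> C) :
  (forall a b, mix (mix a b) (mix b a) = a) ->
  (forall a b, P a -> P b -> P (mix a b)) ->
  \sum_(a | P a) \sum_(b | P b) g (mix a b) = #|P|%:R * \sum_(a | P a) g a.
Proof.
move=> mixK Pmix; rewrite pair_big /=.
pose inv (p : T * T) := (mix p.1 p.2, mix p.2 p.1).
have invK : involutive inv by case=> a b; rewrite /inv /= !mixK.
rewrite (reindex_inj (inv_inj invK)) /=.
under eq_bigr => p _ do rewrite mixK.
rewrite (eq_bigl (fun p : T * T => P p.1 && P p.2)); last first.
  move=> [a b] /=; apply/idP/idP => /andP[Pa Pb]; last by rewrite !Pmix.
  have := Pmix _ _ Pa Pb; have := Pmix _ _ Pb Pa.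
  by rewrite !mixK => -> ->.
rewrite -(pair_big P P (fun a _ => g a)) /= mulr_sumr.
by apply: eq_bigr => a _; rewrite sumr_const mulr_natl.
Qed.

Section Mixing.
Variable eps : A.
Hypothesis epsI : eps * eps = eps.

(** The element with the component of a in eps A and that of b in (1 - eps) A. *)
Let mix (a b : A) : A := eps * a + (1 - eps) * b.
Let mix2 (u v : A * A) := (mix u.1 v.1, mix u.2 v.2).

Let eps0 : eps * (1 - eps) = 0. Proof. by rewrite mulrBr mulr1 epsI subrr. Qed.

Let epsmix (a b : A) : eps * mix a b = eps * a.
Proof.
have -> : eps * mix a b = eps * eps * a + eps * (1 - eps) * b by rewrite /mix; ring.
by rewrite epsI eps0 mul0r addr0.
Qed.

Let epsCmix (a b : A) : (1 - eps) * mix a b = (1 - eps) * b.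
Proof.
have -> : (1 - eps) * mix a b = eps * (1 - eps) * a + (1 - eps) * b - eps * (1 - eps) * b.
  by rewrite /mix; ring.
by rewrite eps0 !mul0r subr0 add0r.
Qed.

Let mixK (a b : A) : mix (mix a b) (mix b a) = a.
Proof.
by rewrite {1}/mix epsmix epsCmix -mulrDl addrC subrK mul1r.
Qed.

Let mix2K a b : mix2 (mix2 a b) (mix2 b a) = a.
Proof. by case: a => a1 a2; rewrite /mix2 /= !mixK. Qed.

Let mix_unit (a b : A) : a \in unit -> b \in unit -> mix a b \in unit.
Proof.
move=> ua ub; apply/unitrP; exists (mix a^-1 b^-1).
suff H c d c' d' : c * c' = 1 -> d * d' = 1 -> mix c d * mix c' d' = 1.
  by split; apply: H; rewrite ?mulVr ?divrr.
move=> cc dd.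
have -> : mix c d * mix c' d' = eps * eps * (c * c') + (1 - eps) * (d * d')
  + (eps * (1 - eps)) * (c * d' + d * c' - d * d') by rewrite /mix; ring.
by rewrite epsI eps0 cc dd; ring.
Qed.

(** Multiplicativity of Ramanujan sums across the two components, phrased without leaving A. *)
Lemma unit_sum_mix (z : A) :
  unit_sum (z * eps) * unit_sum (z * (1 - eps)) = #|unit|%:R * unit_sum z.
Proof.
rewrite -(sum_mix _ mixK mix_unit) big_distrl /=; apply: eq_bigr => a _.
rewrite big_distrr /=; apply: eq_bigr => b _; rewrite -psiD; congr psi.
by rewrite /mix; ring.
Qed.

Lemma unit_count_mix (z : A) :
  (unit_count (z * eps)%R * unit_count (z * (1 - eps))%R = #|A| * unit_count z)%N.
Proof.
apply/eqP; rewrite -(eqr_nat C) !natrM.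
have cnt y : (unit_count y)%:R = \sum_(k : A) (1 - y * k \in unit)%:R :> C.
  by rewrite /unit_count -sum1_card natr_sum big_mkcond; apply: eq_bigr => k _;
    rewrite inE; case: ifP.
rewrite !cnt -(@sum_mix _ mix xpredT _ mixK) // big_distrl /=; apply/eqP.
apply: eq_bigr => a _; rewrite big_distrr /=; apply: eq_bigr => b _.
rewrite -natrM mulnb -unitrM; congr (_ \in unit)%:R.
have -> : (1 - z * eps * a) * (1 - z * (1 - eps) * b) =
  1 - z * mix a b + (eps * (1 - eps)) * (z * a * z * b) by rewrite /mix; ring.
by rewrite eps0 mul0r addr0.
Qed.

Variables (mu mu' l l' z : A).
Hypotheses (umu : mu' \is a GRing.unit) (ul : l' \is a GRing.unit).
Hypotheses (zmu : z * eps * mu = z * eps * mu').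
Hypotheses (zl : z * (1 - eps) * l = z * (1 - eps) * l').

Definition shifted_pairing (y : A) : C :=
  \sum_(x : A * A) \sum_(u | cross x u == 1) fchar mu x * gchar l (axpy y x u).

(** A completion u can be chosen independently on the two components, and each factor sees only one
    of them. *)
Let pairing_split (n1 n2 : A) (x : A * A) : #|[pred u | cross x u == 1]|%:R *
    (\sum_(u | cross x u == 1) fchar mu (axpy (- (z * eps * n1)) x u) *
       gchar l (axpy (z * (1 - eps) * n2) x u)) =
   (\sum_(u | cross x u == 1) fchar mu (axpy (- (z * eps) * n1) x u)) *
   (\sum_(u | cross x u == 1) gchar l (axpy (z * (1 - eps) * n2) x u)).
Proof.
rewrite -(@sum_mix _ mix2) //; last first.
  move=> a b /eqP xa /eqP xb; apply/eqP.
  transitivity (eps * cross x a + (1 - eps) * cross x b).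
    by rewrite /cross /mix2 /mix /=; ring.
  by rewrite xa xb !mulr1 addrC subrK.
rewrite big_distrl /=; apply: eq_bigr => a _.
rewrite big_distrr /=; apply: eq_bigr => b _; congr (fchar _ _ * gchar _ _).
- rewrite /axpy /mix2 /=; congr (_ + _, _ + _).
  + have -> c : - (z * eps * n1) * c = - (z * n1 * (eps * c)) by ring.
    by rewrite epsmix; ring.
  + have -> c : - (z * eps * n1) * c = - (z * n1 * (eps * c)) by ring.
    by rewrite epsmix; ring.
- rewrite /axpy /mix2 /=; congr (_ + _, _ + _).
  + have -> c : z * (1 - eps) * n2 * c = z * n2 * ((1 - eps) * c) by ring.
    by rewrite epsCmix; ring.
  + have -> c : z * (1 - eps) * n2 * c = z * n2 * ((1 - eps) * c) by ring.
    by rewrite epsCmix; ring.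
Qed.

Let cross_count (x : A * A) : x.2 \is a GRing.unit -> #|[pred u | cross x u == 1]| = #|A|.
Proof.
case: x => x1 x2 /= ux; apply/eqP; rewrite -(eqr_nat C) -!sum1_card !natr_sum.
by rewrite (sum_cross_unit _ _ (fun => 1%:R)).
Qed.

Let cardA0 : #|A|%:R != 0 :> C.
Proof. by rewrite pnatr_eq0 -lt0n; apply/card_gt0P; exists 0. Qed.

Let cardU0 : #|unit|%:R != 0 :> C.
Proof. by rewrite pnatr_eq0 -lt0n; apply/card_gt0P; exists 1; apply: unitr1. Qed.

(** Moving x along u transfers the eps component of the translation from [gchar] to [fchar]. Each of
    the two averages is then evaluated on the component where its parameter may be replaced by a
    unit. *)
Lemma shifted_pairing_average :
  \sum_(n in unit) shifted_pairing (z * n) =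
  (unit_count z)%:R * unit_sum z * \sum_(x : A * A) fchar mu x * gchar l x.
Proof.
apply: (mulfI cardU0).
(* A second unit makes the translation parameters on the two components independent. *)
rewrite -(@sum_mix _ mix) //.
have shift n1 n2 : shifted_pairing (z * mix n1 n2) =
    \sum_(x : A * A) \sum_(u | cross x u == 1) fchar mu (axpy (- (z * eps * n1)) x u) *
       gchar l (axpy (z * (1 - eps) * n2) x u).
  rewrite /shifted_pairing (exchange_big_dep xpredT) //= [RHS](exchange_big_dep xpredT) //=.
  apply: eq_bigr => u _.
  rewrite (reindex_onto (fun x => axpy (- (z * eps * n1)) x u)
    (fun x => axpy (z * eps * n1) x u)) /=; last first.
    by move=> x _; rewrite axpyA addNr axpy0.
  apply: eq_big => [x|x _].
    by rewrite cross_axpyl axpyA addrN axpy0 eqxx andbT.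
  rewrite axpyA; congr (_ * gchar _ (axpy _ _ _)).
  by rewrite /mix; ring.
under eq_bigr => n1 _ do under eq_bigr => n2 _ do rewrite shift.
apply: (mulfI cardA0).
under eq_bigr => n1 _ do rewrite exchange_big /=.
rewrite exchange_big /= mulr_sumr.
have -> : #|A|%:R * (#|unit|%:R * ((unit_count z)%:R * unit_sum z *
    \sum_x fchar mu x * gchar l x)) =
  \sum_x ((unit_count (z * eps))%:R * unit_sum (z * eps) * fchar mu x) *
   ((unit_count (z * (1 - eps)))%:R * unit_sum (z * (1 - eps)) * gchar l x).
  transitivity ((#|A| * unit_count z)%N%:R * (#|unit|%:R * unit_sum z) *
    \sum_x fchar mu x * gchar l x); first by rewrite natrM; ring.
  rewrite -unit_count_mix -unit_sum_mix natrM mulr_sumr.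
  by apply: eq_bigr => x _; ring.
apply: eq_bigr => x _.
have key : #|[pred u | cross x u == 1]|%:R * (\sum_(n1 in unit) \sum_(n2 in unit)
    \sum_(u | cross x u == 1) fchar mu (axpy (- (z * eps * n1)) x u) *
       gchar l (axpy (z * (1 - eps) * n2) x u)) =
   ((unit_count (z * eps))%:R * unit_sum (z * eps) * fchar mu x) *
   ((unit_count (z * (1 - eps)))%:R * unit_sum (z * (1 - eps)) * gchar l x).
  rewrite -(gchar_average x ul zl).
  have -> : (unit_count (z * eps))%:R * unit_sum (z * eps) =
     (unit_count (- (z * eps)))%:R * unit_sum (- (z * eps)).
    rewrite -(mulrN1 (z * eps)) (@unit_countM (z * eps)) ?unitrN ?unitr1 //.
    by rewrite (@unit_sumM (z * eps)) ?unitrN ?unitr1.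
  rewrite -(@fchar_average 1 mu mu') ?unitr1 //; last by rewrite !mulNr zmu.
  rewrite mulr_sumr big_distrl /=; apply: eq_bigr => n1 _.
  rewrite big_distrr mulr_sumr /=; apply: eq_bigr => n2 _.
  exact: pairing_split.
(* The number of completions is known only for x.2 a unit; otherwise [key] says that this number
   times the sum is 0, and the sum is zero or empty. *)
have [ux|nux] := boolP (x.2 \is a GRing.unit).
  by rewrite -key cross_count.
have f0 : fchar mu x = 0 by rewrite /fchar (negPf nux).
rewrite f0 mulr0 mul0r; move: key; rewrite f0 mulr0 mul0r => /eqP.
rewrite mulf_eq0 pnatr_eq0 => /orP[/eqP N0|/eqP->]; last by rewrite mulr0.
rewrite big1 ?mulr0 // => n1 _; apply: big1 => n2 _; apply: big_pred0 => u.
by have := card0_eq N0 u; rewrite inE.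
Qed.

End Mixing.

(** By pigeonhole m^i = m^j for some i < j, so the powers are periodic from m^i on; a positive
    multiple of the period that is at least i works. *)
Lemma idempotent_power (m : A) : exists2 N, (0 < N)%N & m ^+ N * m ^+ N = m ^+ N.
Proof.
have /injectivePn[i [j ij mij]] : ~~ injectiveb (fun i : 'I_#|A|.+1 => m ^+ i).
  by apply/negP => /injectiveP/leq_card; rewrite card_ord ltnn.
wlog lt_ij : i j ij mij / (i < j)%N.
  move=> H; have [ltij|ltji|eqij] := ltngtP i j; first exact: (H i j).
    by apply: (H j i) => //; rewrite eq_sym.
  by move/eqP: ij => []; apply: val_inj.
have per k : m ^+ (i + k) = m ^+ (i + k + (j - i)).
  by rewrite addnAC subnKC 1?ltnW // !exprD mij.
have per2 q k : m ^+ (i + k) = m ^+ (i + k + q * (j - i)).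
  elim: q => [|q IH]; first by rewrite addn0.
  by rewrite IH -[in LHS]addnA per mulSn; congr (m ^+ _); lia.
have le : (i <= i.+1 * (j - i))%N.
  by rewrite (leq_trans (leqnSn i)) // leq_pmulr // subn_gt0.
exists (i.+1 * (j - i))%N; first by rewrite muln_gt0 subn_gt0.
rewrite -exprD -[X in m ^+ (X + _)](subnKC le) -per2 subnKC //.
Qed.

(** For idempotent powers e of mu and h of l, mu is invertible on e A and l on h A. The element b (1
    - e)(1 - h) is killed by mu^N, l^M and d, and mu, l, d generate the unit ideal, so it is zero:
    after multiplication by b, 1 - e lies in the component where l is invertible. *)
Lemma idempotent_split (b d mu l p q r : A) :
  b * d = 0 -> mu * p + l * q + d * r = 1 ->
  exists eps mu' l', [/\ eps * eps = eps, mu' \is a GRing.unit, l' \is a GRing.unit,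
    eps * mu = eps * mu' & b * (1 - eps) * l = b * (1 - eps) * l'].
Proof.
have fit (m e : A) N : (0 < N)%N -> e = m ^+ N -> e * e = e -> m * e + (1 - e) \is a GRing.unit.
  move=> N0 eN ee; apply/unitrP; exists (m ^+ N.-1 * e + (1 - e)).
  suff H : (m ^+ N.-1 * e + (1 - e)) * (m * e + (1 - e)) = 1 by split; rewrite // mulrC.
  have -> : (m ^+ N.-1 * e + (1 - e)) * (m * e + (1 - e)) =
     m ^+ N.-1 * m * (e * e) + (m ^+ N.-1 + m - 1) * (e - e * e) + (1 - e) by ring.
  by rewrite -exprSr prednK // -eN ee subrr mulr0 addr0 ee addrC subrK.
move=> bd bez.
have [N N0 mN] := idempotent_power mu; have [M M0 lM] := idempotent_power l.
move eE: (mu ^+ N) mN => e mN; move hE: (l ^+ M) lM => h lM.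
exists e, (mu * e + (1 - e)), (l * h + (1 - h)); split=> //.
- exact: (fit _ _ N).
- exact: (fit _ _ M).
- transitivity ((e * e) * mu + (e - e * e)); last by ring.
  by rewrite mN subrr addr0.
have y0 : b * (1 - e) * (1 - h) = 0.
  set y := _ * _.
  have ymu : y * mu ^+ N = 0.
    have -> : y * mu ^+ N = b * (1 - h) * (e - e * e) by rewrite /y eE; ring.
    by rewrite mN subrr mulr0.
  have yl : y * l ^+ M = 0.
    have -> : y * l ^+ M = b * (1 - e) * (h - h * h) by rewrite /y hE; ring.
    by rewrite lM subrr mulr0.
  have yS : y = y * (mu * p + l * q).
    rewrite -[LHS]mulr1 -bez.
    have -> : y * (mu * p + l * q + d * r) = y * (mu * p + l * q) +
      (b * d) * (1 - e) * (1 - h) * r by rewrite /y; ring.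
    by rewrite bd !mul0r addr0.
  have yP k : y = y * (mu * p + l * q) ^+ k.
    by elim: k => [|k IH]; [rewrite mulr1 | rewrite exprSr mulrA -IH].
  (* Each term of the binomial expansion has mu to a power at least N or l to a power at least M. *)
  rewrite (yP (N + M)%N) exprDn mulr_sumr big1 // => i _.
  rewrite mulrnAr !exprMn; have [le|lt] := leqP M i.
    rewrite -(subnK le) exprD.
    transitivity (y * l ^+ M * (((mu ^+ (N + M - (i - M + M)) * p ^+ (N + M - (i - M + M))) *
     (l ^+ (i - M) * q ^+ (i - M + M)))) *+ 'C(N + M, i - M + M)); first by congr (_ *+ _); ring.
    by rewrite yl mul0r mul0rn.
  have -> : (N + M - i = N + (M - i))%N by rewrite addnBA // ltnW.
  rewrite [mu ^+ _]exprD.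
  transitivity (y * mu ^+ N * (mu ^+ (M - i) * p ^+ (N + (M - i)) *
     (l ^+ i * q ^+ i)) *+ 'C(N + M, i)); first by congr (_ *+ _); ring.
  by rewrite ymu mul0r mul0rn.
apply/eqP; rewrite -subr_eq0; apply/eqP.
transitivity (b * (1 - e) * (1 - h) * (l - 1)); first by ring.
by rewrite y0 mul0r.
Qed.

Definition twist (b xi : A) (F : A * A -> C) (x u : A * A) : C :=
  \sum_k psi (xi * k) * F (axpy (b * k) x u).

Lemma sum_cross_shift (a : A) (h : A * A -> A * A -> C) :
  \sum_x \sum_(u | cross x u == 1) h x u =
  \sum_x \sum_(u | cross x u == 1) h (axpy a x u) u.
Proof.
rewrite (exchange_big_dep xpredT) //= [RHS](exchange_big_dep xpredT) //=.
apply: eq_bigr => u _; rewrite (reindex_inj (can_inj (axpyK a u))) /=.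
by apply: eq_bigl => x; rewrite cross_axpyl.
Qed.

(** After x is translated by - b j u, phase and pairing depend only on the difference of the two
    summation variables, and the sum over j contributes #|A|. One factor [unit_sum] comes from the
    phases, the other from [shifted_pairing_average], hence the square. *)
Lemma twist_pairing (b d mu l p q r : A) :
  b * d = 0 -> mu * p + l * q + d * r = 1 ->
  #|unit|%:R * (\sum_(n in unit) \sum_x \sum_(u | cross x u == 1)
    twist b (- (n * b)) (fchar mu) x u * twist b (n * b) (gchar l) x u) =
  #|A|%:R * (\sum_k (unit_count (b * k))%:R * unit_sum (b * k) ^+ 2) *
  \sum_x fchar mu x * gchar l x.
Proof.
move=> bd bez; have [eps [mu' [l' [ee umu ul emu el]]]] := idempotent_split bd bez.
have inner (n : A) : \sum_x \sum_(u | cross x u == 1)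
    twist b (- (n * b)) (fchar mu) x u * twist b (n * b) (gchar l) x u =
  \sum_(j : A) \sum_k psi (n * (b * k)) * shifted_pairing mu l (b * k).
  under eq_bigr => x _ do under eq_bigr => u _ do rewrite /twist big_distrl /=.
  under eq_bigr => x _ do rewrite exchange_big /=.
  rewrite exchange_big /=; apply: eq_bigr => j _.
  under eq_bigr => x _ do under eq_bigr => u _ do rewrite big_distrr /=.
  under eq_bigr => x _ do rewrite exchange_big /=.
  rewrite exchange_big /= (reindex_inj (addrI j)) /=; apply: eq_bigr => k _.
  rewrite /shifted_pairing (sum_cross_shift (- (b * j))) mulr_sumr.
  apply: eq_bigr => x _; rewrite mulr_sumr; apply: eq_bigr => u _.
  rewrite !axpyA subrr axpy0; have -> : b * (j + k) - b * j = b * k by ring.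
  rewrite mulrACA -psiD; congr (psi _ * _); ring.
under eq_bigr => n _ do rewrite inner sumr_const.
under eq_bigr => n _ do rewrite -mulr_natl.
rewrite -mulr_sumr mulrCA -!mulrA; congr (_ * _).
rewrite exchange_big /=.
(* Replacing k by k n with n a unit does not change the unit sum; averaging over n brings in the sum
   evaluated by [shifted_pairing_average]. *)
have -> : #|unit|%:R * (\sum_k \sum_(n in unit) psi (n * (b * k)) * shifted_pairing mu l (b * k)) =
  \sum_(n in unit) \sum_k unit_sum (b * k) * shifted_pairing mu l (b * k * n).
  rewrite mulr_natl -sumr_const; apply: eq_bigr => n un.
  rewrite (reindex_inj (mulIr un)) /=; apply: eq_bigr => k _.
  rewrite -big_distrl /= -/(unit_sum _) mulrA unit_sumM //.
rewrite exchange_big /= big_distrl /=; apply: eq_bigr => k _.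
rewrite -mulr_sumr (@shifted_pairing_average eps ee mu mu' l l') //; first by ring.
  by rewrite -!mulrA emu.
have H c : b * k * (1 - eps) * c = k * (b * (1 - eps) * c) by ring.
by rewrite !H el.
Qed.

End CharacterSums.

(** * The real-valued complex modulus and Cauchy-Schwarz *)

Section ComplexModulus.
Variable R : realType.
Implicit Types z : R[i].
Local Notation conj := (@conjc R).

Lemma cabs_ge0 z : 0 <= cabs z.
Proof. by case: z => a b; apply: sqrtr_ge0. Qed.

Lemma cabsM z1 z2 : cabs (z1 * z2) = cabs z1 * cabs z2.
Proof. exact: ComplexField.Normc.normcM. Qed.

Lemma cabs0 : cabs (0 : R[i]) = 0.
Proof. exact: ComplexField.Normc.normc0. Qed.

Lemma cabs_sum (I : Type) (r : seq I) (P : pred I) (F : I -> R[i]) :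
  cabs (\sum_(i <- r | P i) F i) <= \sum_(i <- r | P i) cabs (F i).
Proof.
elim/big_rec2: _ => [|i x y _ le]; first by rewrite cabs0.
exact: le_trans (le_normcD _ _) (lerD _ le).
Qed.

Lemma cabs_conj z : cabs (conj z) = cabs z.
Proof. by case: z => a b; rewrite /cabs /= sqrrN. Qed.

Lemma mul_conjc z : conj z * z = (cabs z ^+ 2)%:C%C.
Proof.
case: z => a b; rewrite /cabs /= sqr_sqrtr ?addr_ge0 ?sqr_ge0 //.
by apply/eqP; rewrite eq_complex /=; apply/andP; split; apply/eqP; ring.
Qed.

Lemma cabs_real (x : R) : cabs x%:C%C = `|x|.
Proof. by rewrite /cabs /= expr0n addr0 sqrtr_sqr. Qed.

Lemma cabs_nat n : cabs (n%:R : R[i]) = n%:R.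
Proof. by rewrite -(rmorph_nat (real_complex R)) cabs_real normr_nat. Qed.

Lemma cabs_Re z : complex.Re z <= cabs z.
Proof.
case: z => a b; rewrite /cabs /=; apply: le_trans (ler_norm a) _.
by rewrite -sqrtr_sqr ler_wsqrtr // lerDl sqr_ge0.
Qed.

(** Lagrange's identity: the difference of the two sides is half a double sum of squares. *)
Lemma cauchy_schwarz_sum (I : finType) (P : pred I) (F G : I -> R) :
  (\sum_(i | P i) F i * G i) ^+ 2 <=
  (\sum_(i | P i) F i ^+ 2) * (\sum_(i | P i) G i ^+ 2).
Proof.
rewrite -subr_ge0.
have -> : (\sum_(i | P i) F i ^+ 2) * (\sum_(i | P i) G i ^+ 2) -
    (\sum_(i | P i) F i * G i) ^+ 2 =
    2^-1 * \sum_(i | P i) \sum_(j | P j) (F i * G j - F j * G i) ^+ 2.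
  have expand : \sum_(i | P i) \sum_(j | P j) (F i * G j - F j * G i) ^+ 2 =
      \sum_(i | P i) \sum_(j | P j) F i ^+ 2 * G j ^+ 2 +
      \sum_(i | P i) \sum_(j | P j) F j ^+ 2 * G i ^+ 2
      - 2 * \sum_(i | P i) \sum_(j | P j) (F i * G i) * (F j * G j).
    rewrite mulr_sumr -big_split -sumrB /=; apply: eq_bigr => i _.
    by rewrite mulr_sumr -big_split -sumrB /=; apply: eq_bigr => j _; ring.
  have prod (f g : I -> R) : \sum_(i | P i) \sum_(j | P j) f i * g j =
      (\sum_(i | P i) f i) * (\sum_(i | P i) g i).
    by rewrite big_distrl /=; apply: eq_bigr => i _; rewrite big_distrr.
  rewrite expand [X in _ + X - _]exchange_big /= !(prod _ (fun j => G j ^+ 2)) prod.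
  by field.
rewrite mulr_ge0 ?invr_ge0 //; do 2 (apply: sumr_ge0 => ? _).
exact: sqr_ge0.
Qed.

End ComplexModulus.

(** * Finite-dimensional Hilbert space: Bessel's inequality and sixth powers *)

Section FiniteHilbert.
Variables (R : realType) (Z : finType) (P : pred Z).
Local Notation conj := (@conjc R).
Implicit Types f g v : Z -> R[i].

Definition sqnorm f : R := \sum_(z | P z) cabs (f z) ^+ 2.
Definition dotp f g : R[i] := \sum_(z | P z) conj (f z) * g z.

Lemma sqnorm_ge0 f : 0 <= sqnorm f.
Proof. by apply: sumr_ge0 => z _; apply: sqr_ge0. Qed.

Lemma dotpp f : dotp f f = (sqnorm f)%:C%C.
Proof. by rewrite /dotp /sqnorm rmorph_sum /=; apply: eq_bigr => z _; rewrite mul_conjc. Qed.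

Lemma cabs_pairing_le f g :
  cabs (\sum_(z | P z) f z * g z) ^+ 2 <= sqnorm f * sqnorm g.
Proof.
apply: le_trans (cauchy_schwarz_sum P (fun z => cabs (f z)) (fun z => cabs (g z))).
rewrite ler_sqr ?nnegrE ?cabs_ge0 //; last by apply: sumr_ge0 => z _; rewrite mulr_ge0 ?cabs_ge0.
apply: le_trans (cabs_sum _ _ _) _.
by under eq_bigr do rewrite cabsM.
Qed.

Lemma sqnorm_conj f : sqnorm (fun z => conj (f z)) = sqnorm f.
Proof. by apply: eq_bigr => z _; rewrite cabs_conj. Qed.

Lemma cabs_dotp_le f g : cabs (dotp f g) ^+ 2 <= sqnorm f * sqnorm g.
Proof. by rewrite -[sqnorm f]sqnorm_conj; apply: cabs_pairing_le. Qed.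

Lemma dotp_sumr (I : finType) f (c : I -> R[i]) (g : I -> Z -> R[i]) :
  dotp f (fun z => \sum_i c i * g i z) = \sum_i c i * dotp f (g i).
Proof.
rewrite /dotp; under eq_bigr do rewrite mulr_sumr.
rewrite exchange_big /=; apply: eq_bigr => i _; rewrite mulr_sumr.
by apply: eq_bigr => z _; rewrite mulrCA.
Qed.

Lemma dotp_suml (I : finType) f (c : I -> R[i]) (g : I -> Z -> R[i]) :
  dotp (fun z => \sum_i c i * g i z) f = \sum_i conj (c i) * dotp (g i) f.
Proof.
rewrite /dotp; under eq_bigr do rewrite rmorph_sum mulr_suml.
rewrite exchange_big /=; apply: eq_bigr => i _; rewrite mulr_sumr.
by apply: eq_bigr => z _; rewrite rmorphM mulrA.
Qed.

(** The family is not normalised because members may vanish. With s the left-hand side and y the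
    combination of the [phi i] with coefficients their products with w, orthogonality gives <y, w> =
    s and |y|^2 <= rho s, and Cauchy-Schwarz then gives s^2 <= rho s |w|^2. *)
Lemma bessel (X : finType) (phi : X -> Z -> R[i]) (rho : R) v :
  0 <= rho -> (forall i j, i != j -> dotp (phi i) (phi j) = 0) ->
  (forall i, sqnorm (phi i) <= rho) ->
  \sum_i cabs (\sum_(z | P z) phi i z * v z) ^+ 2 <= rho * sqnorm v.
Proof.
move=> rho0 orth le_rho.
pose w z := conj (v z).
have eqc i : cabs (\sum_(z | P z) phi i z * v z) = cabs (dotp (phi i) w).
  rewrite -cabs_conj rmorph_sum /=; congr cabs; apply: eq_bigr => z _.
  by rewrite rmorphM.
under eq_bigr do rewrite eqc.
rewrite -[sqnorm v]sqnorm_conj -/w.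
pose y z := \sum_i dotp (phi i) w * phi i z.
set s := \sum_i _.
have s0 : 0 <= s by apply: sumr_ge0 => i _; apply: sqr_ge0.
have yw : dotp y w = s%:C%C.
  rewrite /y dotp_suml /s rmorph_sum /=; apply: eq_bigr => i _.
  by rewrite mul_conjc.
have yy : sqnorm y <= rho * s.
  rewrite -lecR -dotpp {2}/y dotp_sumr.
  have -> : \sum_i dotp (phi i) w * dotp y (phi i) =
    (\sum_i cabs (dotp (phi i) w) ^+ 2 * sqnorm (phi i))%:C%C.
    rewrite rmorph_sum /=; apply: eq_bigr => i _; rewrite /y dotp_suml (bigD1 i) //=.
    rewrite big1 ?addr0 => [|j ji]; last by rewrite orth ?mulr0.
    by rewrite dotpp rmorphM /= -mul_conjc; ring.
  rewrite lecR mulr_sumr; apply: ler_sum => i _.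
  by rewrite mulrC ler_wpM2r // sqr_ge0.
have := cabs_dotp_le y w; rewrite yw cabs_real ger0_norm //.
have [->|sn0] := eqVneq s 0; first by rewrite mulr_ge0 ?sqnorm_ge0.
move=> le2; rewrite -(ler_pM2l (x := s)) ?lt_def ?sn0 ?s0 // -expr2.
apply: le_trans le2 _; rewrite mulrA [s * rho]mulrC ler_wpM2r ?sqnorm_ge0 //.
Qed.

(* Writing [a_j] for the squared norms of [phi], [A phi], [A* A phi], [A A* A phi],
   Cauchy-Schwarz gives [a_1 ^ 2 <= a_0 a_2] and [a_2 ^ 2 <= a_1 a_3]. *)
Lemma schatten6 (A As : (Z -> R[i]) -> Z -> R[i]) f g :
  (forall u v, dotp (A u) v = dotp u (As v)) ->
  cabs (\sum_(z | P z) A f z * g z) ^+ 6 <=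
  sqnorm g ^+ 3 * sqnorm f ^+ 2 * sqnorm (A (As (A f))).
Proof.
move=> adj.
set x := cabs _; set a0 := sqnorm f; set a3 := sqnorm (A (As (A f))).
have le1 : sqnorm (A f) ^+ 2 <= a0 * sqnorm (As (A f)).
  by have := cabs_dotp_le f (As (A f)); rewrite -adj dotpp cabs_real ger0_norm ?sqnorm_ge0.
have le2 : sqnorm (As (A f)) ^+ 2 <= a3 * sqnorm (A f).
  by have := cabs_dotp_le (A (As (A f))) (A f);
    rewrite adj dotpp cabs_real ger0_norm ?sqnorm_ge0.
have lex : x ^+ 2 <= sqnorm (A f) * sqnorm g by apply: cabs_pairing_le.
set a1 := sqnorm (A f) in le1 le2 lex *; set a2 := sqnorm (As (A f)) in le1 le2.
have [p0 p1 p2 p3 pg] : [/\ 0 <= a0, 0 <= a1, 0 <= a2, 0 <= a3 & 0 <= sqnorm g].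
  by split; apply: sqnorm_ge0.
have le3 : a1 ^+ 3 <= a0 ^+ 2 * a3.
  have [->|a10] := eqVneq a1 0; first by rewrite expr0n /= mulr_ge0 ?sqr_ge0.
  rewrite -(ler_pM2l (x := a1)) ?lt_def ?a10 ?p1 // -exprS.
  rewrite (_ : a1 ^+ 4 = (a1 ^+ 2) ^+ 2); last by rewrite -exprM.
  apply: (le_trans (y := (a0 * a2) ^+ 2)).
    by rewrite ler_sqr ?nnegrE ?sqr_ge0 ?mulr_ge0.
  rewrite exprMn [leRHS](_ : _ = a0 ^+ 2 * (a3 * a1)); last by ring.
  by rewrite ler_wpM2l ?sqr_ge0.
rewrite (_ : x ^+ 6 = (x ^+ 2) ^+ 3); last by rewrite -exprM.
apply: (le_trans (y := (a1 * sqnorm g) ^+ 3)).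
  by rewrite lerXn2r ?nnegrE ?sqr_ge0 ?mulr_ge0.
by rewrite exprMn mulrC -mulrA ler_wpM2l ?exprn_ge0.
Qed.

End FiniteHilbert.

(** Jensen through the tangent at the mean t: x^6 - 6 t^5 x + 5 t^6 is (x - t)^2 times a polynomial
    with nonnegative coefficients. *)
Lemma power_mean6 (R : realType) (I : finType) (P : pred I) (F : I -> R) :
  (forall i, P i -> 0 <= F i) ->
  (\sum_(i | P i) F i) ^+ 6 <= #|P|%:R ^+ 5 * \sum_(i | P i) F i ^+ 6.
Proof.
move=> F0; have [n0|n0] := posnP #|P|.
  by rewrite !big_pred0 ?expr0n ?mulr0 //= => i; have := card0_eq n0 i; rewrite inE.
set n : R := #|P|%:R; have np : 0 < n by rewrite ltr0n.
set t := (\sum_(i | P i) F i) / n.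
have t0 : 0 <= t by rewrite divr_ge0 ?sumr_ge0 // ltW.
have St : \sum_(i | P i) F i = n * t by rewrite mulrC divfK // gt_eqF.
clearbody t.
have tangent x : 0 <= x -> 6 * t ^+ 5 * x - 5 * t ^+ 6 <= x ^+ 6.
  move=> x0; rewrite -subr_ge0.
  rewrite (_ : _ - _ = (x - t) ^+ 2 *
     (x ^+ 4 + 2 * x ^+ 3 * t + 3 * x ^+ 2 * t ^+ 2 + 4 * x * t ^+ 3 + 5 * t ^+ 4)); last by ring.
  apply: mulr_ge0; first exact: sqr_ge0.
  by do !apply: addr_ge0; rewrite ?exprn_ge0 //; do !apply: mulr_ge0; rewrite ?exprn_ge0.
have : \sum_(i | P i) (6 * t ^+ 5 * F i - 5 * t ^+ 6) <= \sum_(i | P i) F i ^+ 6.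
  by apply: ler_sum => i Pi; apply: tangent; apply: F0.
rewrite sumrB -mulr_sumr St sumr_const -mulr_natl -/n => le.
have -> : (n * t) ^+ 6 = n ^+ 5 * (n * t ^+ 6) by ring.
rewrite ler_wpM2l ?exprn_ge0 ?(ltW np) //; apply: le_trans le.
by rewrite le_eqVlt; apply/orP; left; apply/eqP; ring.
Qed.

(** * Weighted sums of permutation operators *)

Section ShiftOperators.
Variables (R : realType) (Z : finType) (P : pred Z).
Local Notation conj := (@conjc R).

Definition shift_op (I : finType) (p : I -> R[i]) (w : I -> Z -> Z) (f : Z -> R[i]) z :=
  \sum_i p i * f (w i z).

Lemma eq_shift_op (I : finType) (p : I -> R[i]) (w : I -> Z -> Z) f g :
  f =1 g -> shift_op p w f =1 shift_op p w g.
Proof. by move=> fg z; apply: eq_bigr => i _; rewrite fg. Qed.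

Lemma shift_op_comp (I J : finType) (p : I -> R[i]) (w : I -> Z -> Z)
    (q : J -> R[i]) (v : J -> Z -> Z) f :
  shift_op p w (shift_op q v f) =1
  shift_op (fun k => p k.1 * q k.2) (fun k z => v k.2 (w k.1 z)) f.
Proof.
move=> z; rewrite /shift_op.
rewrite -(pair_big xpredT xpredT (fun i j => p i * q j * f (v j (w i z)))) /=.
by apply: eq_bigr => i _; rewrite mulr_sumr; apply: eq_bigr => j _; rewrite mulrA.
Qed.

(** A bilinear transpose is kept beside the Hermitian adjoint: the Kloosterman pairing carries no
    conjugation, the norms do. *)
Lemma shift_op_transpose (I : finType) (p : I -> R[i]) (w v : I -> Z -> Z) f g :
  (forall i, cancel (v i) (w i)) -> (forall i, cancel (w i) (v i)) ->
  (forall i z, P (v i z) = P z) ->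
  \sum_(z | P z) shift_op p w f z * g z = \sum_(z | P z) f z * shift_op p v g z.
Proof.
move=> vK wK Pv; under eq_bigr do rewrite mulr_suml.
under [RHS]eq_bigr do rewrite mulr_sumr.
rewrite exchange_big [RHS]exchange_big /=; apply: eq_bigr => i _.
rewrite (reindex_inj (can_inj (vK i))) /=.
by apply: eq_big => z; [rewrite Pv | move=> _; rewrite vK mulrCA mulrA].
Qed.

Lemma shift_op_adjoint (I : finType) (p : I -> R[i]) (w v : I -> Z -> Z) f g :
  (forall i, cancel (v i) (w i)) -> (forall i, cancel (w i) (v i)) ->
  (forall i z, P (v i z) = P z) ->
  dotp P (shift_op p w f) g = dotp P f (shift_op (fun i => conj (p i)) v g).
Proof.
move=> vK wK Pv; rewrite /dotp -(@shift_op_transpose _ _ w) //.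
apply: eq_bigr => z _; rewrite /shift_op rmorph_sum; congr (_ * _).
by apply: eq_bigr => i _; rewrite rmorphM.
Qed.

End ShiftOperators.

(** * Unipotents and a congruence Borel subgroup acting on SL_2 *)

Section SL2Action.
Variables (R : realType) (A : finComUnitRingType) (b : A).
Local Notation conj := (@conjc R).
Local Notation G := ((A * A) * (A * A))%type.

Definition sl2 : pred G := fun z => cross z.1 z.2 == 1.
Definition upper_vec (h : A) (x : A * A) : A * A := (x.1 + h * x.2, x.2).
Definition lower_vec (k : A) (x : A * A) : A * A := (x.1, x.2 + k * x.1).
Definition upper h (z : G) : G := (upper_vec h z.1, upper_vec h z.2).
Definition lower k (z : G) : G := (lower_vec k z.1, lower_vec k z.2).

(* [(t, s)] stands for right multiplication by the matrix [[t, s], [0, 1/t]]. *)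
Definition borel_act (g : A * A) (z : G) : G :=
  ((g.1 * z.1.1, g.1 * z.1.2),
   (g.2 * z.1.1 + g.1^-1 * z.2.1, g.2 * z.1.2 + g.1^-1 * z.2.2)).
(** Over Z/c with b = c/d: the upper triangular matrices congruent to the identity modulo d. *)
Definition borel : pred (A * A) :=
  fun g => [&& g.1 \is a GRing.unit, b * g.1 == b & b * g.2 == 0].
Definition borel_count (y y' : G) : nat :=
  #|[pred g | borel g && (borel_act g y == y')]|.

Lemma upperD h h' z : upper h (upper h' z) = upper (h + h') z.
Proof. by rewrite /upper /upper_vec /=; congr (_, _, (_, _)); ring. Qed.

Lemma lowerD k k' z : lower k (lower k' z) = lower (k + k') z.
Proof. by rewrite /lower /lower_vec /=; congr (_, _, (_, _)); ring. Qed.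

Lemma upper0 z : upper 0 z = z.
Proof.
by case: z => [[x1 x2] [u1 u2]]; rewrite /upper /upper_vec /= !mul0r !addr0.
Qed.

Lemma lower0 z : lower 0 z = z.
Proof.
by case: z => [[x1 x2] [u1 u2]]; rewrite /lower /lower_vec /= !mul0r !addr0.
Qed.

Lemma upperK h : cancel (upper h) (upper (- h)).
Proof. by move=> z; rewrite upperD addNr upper0. Qed.

Lemma upperNK h : cancel (upper (- h)) (upper h).
Proof. by move=> z; rewrite upperD addrN upper0. Qed.

Lemma lowerK k : cancel (lower k) (lower (- k)).
Proof. by move=> z; rewrite lowerD addNr lower0. Qed.

Lemma lowerNK k : cancel (lower (- k)) (lower k).
Proof. by move=> z; rewrite lowerD addrN lower0. Qed.

Lemma sl2_upper h z : sl2 (upper h z) = sl2 z.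
Proof. by rewrite /sl2 /cross /=; congr (_ == _); ring. Qed.

Lemma sl2_lower k z : sl2 (lower k z) = sl2 z.
Proof. by rewrite /sl2 /cross /=; congr (_ == _); ring. Qed.

Lemma sl2_borel g z : g.1 \is a GRing.unit -> sl2 (borel_act g z) = sl2 z.
Proof.
move=> ug; rewrite /sl2 /cross /=; congr (_ == _).
transitivity ((g.1 * g.1^-1) * (z.1.1 * z.2.2 - z.1.2 * z.2.1)); first by ring.
by rewrite divrr // mul1r.
Qed.

Lemma borel_upper g h z : borel_act g (upper h z) = upper h (borel_act g z).
Proof. by rewrite /borel_act /upper /upper_vec /=; congr (_, _, (_, _)); ring. Qed.

Lemma borel_count_upper h y y' : borel_count (upper h y) (upper h y') = borel_count y y'.
Proof.
apply: eq_card => g; rewrite !inE borel_upper.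
by rewrite (inj_eq (can_inj (upperK h))).
Qed.

(** The matrix product g g', in the coordinates of [borel_act]. *)
Definition borel_mul (g g' : A * A) : A * A := (g.1 * g'.1, g'.2 * g.1 + g'.1^-1 * g.2).

Lemma borel_actM g g' z : g.1 \is a GRing.unit -> g'.1 \is a GRing.unit ->
  borel_act g' (borel_act g z) = borel_act (borel_mul g g') z.
Proof.
move=> ug ug'; rewrite /borel_act /borel_mul /= invrM //.
by congr (_, _, (_, _)); ring.
Qed.

Definition borel_inv (g : A * A) : A * A := (g.1^-1, - g.2).

Lemma borel_mulP g g' : borel g -> borel g' -> borel (borel_mul g g').
Proof.
move=> /and3P[ug /eqP bg /eqP sg] /and3P[ug' /eqP bg' /eqP sg'].
apply/and3P; split; rewrite /= ?unitrM ?ug ?ug' //; first by rewrite mulrA bg bg'.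
by rewrite mulrDr mulrA sg' mul0r add0r mulrCA sg mulr0.
Qed.

Lemma borel_invP g : borel g -> borel (borel_inv g).
Proof.
move=> /and3P[ug /eqP bg /eqP sg]; apply/and3P; split; rewrite /= ?unitrV //.
  by rewrite -{1}bg mulrK.
by rewrite mulrN sg oppr0.
Qed.

Lemma borel_mulK g g' : borel g' ->
  borel_mul (borel_mul g g') (borel_inv g') = g.
Proof.
move=> /and3P[ug _ _]; case: g => t s; rewrite /borel_mul /borel_inv /= mulrK // invrK.
congr pair; transitivity (- g'.2 * (t * g'.1) + g'.2 * (t * g'.1) + (g'.1 * g'.1^-1) * s);
  first by ring.
by rewrite mulNr addNr add0r divrr // mul1r.
Qed.

Lemma borel_mulVK g g' : borel g' ->
  borel_mul (borel_mul g (borel_inv g')) g' = g.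
Proof.
move=> bg'; have := borel_mulK g (borel_invP bg').
have -> : borel_inv (borel_inv g') = g'; last by [].
by case: g' {bg'} => t s; rewrite /borel_inv /= invrK opprK.
Qed.

Lemma borel_id z : borel_act (1, 0) z = z.
Proof.
by case: z => [[x1 x2] [u1 u2]]; rewrite /borel_act /= invr1 !mul1r !mul0r !add0r.
Qed.

Lemma borel_mulV g : borel g -> borel_mul g (borel_inv g) = (1, 0).
Proof.
move=> /and3P[ug _ _]; rewrite /borel_mul /borel_inv /= divrr // invrK.
by congr pair; ring.
Qed.

Lemma borel_countE y y' : (borel_count y y')%:R = \sum_(g | borel g) (borel_act g y == y')%:R :> R.
Proof.
rewrite /borel_count -sum1_card natr_sum big_mkcondr /=.
by apply: eq_bigr => g _; case: ifP.
Qed.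

(** One has y g = z = y' g' for some z exactly when y g g'^-1 = y', and each element of the subgroup
    is of the form g g'^-1 in #|borel| ways. *)
Lemma borel_count_conv y y' :
  \sum_z (borel_count y z)%:R * (borel_count y' z)%:R =
  #|borel|%:R * (borel_count y y')%:R :> R.
Proof.
under eq_bigr do rewrite !borel_countE big_distrl /=.
rewrite exchange_big /=.
have E g : \sum_z (borel_act g y == z)%:R * \sum_(i | borel i) (borel_act i y' == z)%:R
   = \sum_(i | borel i) (borel_act i y' == borel_act g y)%:R :> R.
  rewrite (bigD1 (borel_act g y)) //= eqxx mul1r [X in _ + X]big1 ?addr0 // => z zn.
  by rewrite eq_sym (negPf zn) mul0r.
under eq_bigr do rewrite E.
rewrite exchange_big /= -sumr_const mulr_suml; apply: eq_big => // i bi.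
rewrite mul1r borel_countE.
rewrite [RHS](reindex_onto (fun g => borel_mul g (borel_inv i)) (fun g => borel_mul g i)) /=;
  last by move=> g _; rewrite borel_mulK.
apply: eq_big => g.
  rewrite borel_mulVK // eqxx andbT; apply/idP/idP => bg.
    by rewrite borel_mulP // borel_invP.
  by rewrite -(borel_mulVK g bi) borel_mulP.
move=> bg; have ug : g.1 \is a GRing.unit by case/and3P: bg.
have ui : i.1 \is a GRing.unit by case/and3P: bi.
rewrite -borel_actM //=; last by rewrite unitrV.
congr (nat_of_bool _)%:R; rewrite eq_sym; apply/eqP/eqP => [->|<-].
  by rewrite borel_actM ?borel_mulV ?borel_id //= unitrV.
rewrite [borel_act (borel_inv i) _]borel_actM //= ?unitrV // borel_actM ?borel_mulVK //=.
by rewrite unitrM ug unitrV.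
Qed.

Lemma borel_count_invariant (f : G -> R[i]) y :
  (forall g z, borel g -> f (borel_act g z) = f z) ->
  \sum_z (borel_count y z)%:R%:C%C * f z = #|borel|%:R * f y.
Proof.
move=> finv; under eq_bigr do rewrite borel_countE rmorph_sum mulr_suml.
rewrite exchange_big /= mulr_natl -sumr_const; apply: eq_bigr => g bg.
rewrite (bigD1 (borel_act g y)) //= eqxx mul1r finv // big1 ?addr0 // => z zn.
by rewrite eq_sym (negPf zn) mul0r.
Qed.

Lemma borel_count_sl2 y z : sl2 y -> (borel_count y z != 0)%N -> sl2 z.
Proof.
move=> sy; rewrite -lt0n => /card_gt0P[g]; rewrite inE => /andP[/and3P[ug _ _] /eqP <-].
by rewrite sl2_borel.
Qed.

(** Averaging over the subgroup turns the value of [shift_op p w (phi x)] at z into a pairing of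
    [phi x] with a combination v of orbit measures independent of x. Bessel, applied for each z,
    bounds the sum over x by rho |v|^2, and |v|^2 counts coincidences of w i z and w j z modulo the
    subgroup. *)
Lemma invariant_family_bound (X I : finType) (phi : X -> G -> R[i]) (rho : R)
    (p : I -> R[i]) (w : I -> G -> G) :
  0 <= rho -> (forall i j, i != j -> dotp sl2 (phi i) (phi j) = 0) ->
  (forall i, sqnorm sl2 (phi i) <= rho) ->
  (forall i g z, borel g -> phi i (borel_act g z) = phi i z) ->
  (forall i, cabs (p i) <= 1) -> (forall i z, sl2 (w i z) = sl2 z) ->
  #|borel|%:R * \sum_x sqnorm sl2 (shift_op p w (phi x)) <=
  rho * \sum_i \sum_j \sum_(z | sl2 z) (borel_count (w i z) (w j z))%:R.
Proof.
move=> rho0 orth le_rho inv p1 slw.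
have g0 : 0 < #|borel|%:R :> R.
  rewrite ltr0n; apply/card_gt0P; exists (1, 0).
  by apply/and3P; split; rewrite /= ?unitr1 ?mulr1 ?mulr0.
rewrite /sqnorm exchange_big /=.
have -> : \sum_i \sum_j \sum_(z | sl2 z) (borel_count (w i z) (w j z))%:R =
  \sum_(z | sl2 z) \sum_i \sum_j (borel_count (w i z) (w j z))%:R :> R.
  rewrite [RHS]exchange_big /=; apply: eq_bigr => i _.
  by rewrite [RHS]exchange_big.
rewrite !mulr_sumr; apply: ler_sum => z sz.
pose v z' : R[i] := \sum_i p i * (borel_count (w i z) z')%:R%:C%C.
have vE x : #|borel|%:R * shift_op p w (phi x) z = \sum_(z' | sl2 z') phi x z' * v z'.
  rewrite /shift_op mulr_sumr.
  under eq_bigr => i _ do rewrite mulrCA -(borel_count_invariant (w i z) (inv x)) mulr_sumr.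
  rewrite exchange_big /= [RHS]big_mkcond /=; apply: eq_bigr => z' _.
  case: ifP => sz'; last first.
    apply: big1 => i _; have [->|n0] := eqVneq (borel_count (w i z) z') 0%N.
      by rewrite rmorph0 mul0r mulr0.
    by rewrite (borel_count_sl2 _ n0) ?slw // in sz'.
  by rewrite /v mulr_sumr; apply: eq_bigr => i _; ring.
have sqv : sqnorm sl2 v <= #|borel|%:R * \sum_i \sum_j (borel_count (w i z) (w j z))%:R.
  apply: (le_trans (y := \sum_z' (\sum_i (borel_count (w i z) z')%:R) ^+ 2)).
    rewrite [leRHS](bigID sl2) /= -[leLHS]addr0 lerD //; last first.
      by apply: sumr_ge0 => ? _; apply: sqr_ge0.
    apply: ler_sum => z' _.
    rewrite ler_sqr ?nnegrE ?cabs_ge0 //; last by apply: sumr_ge0.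
    apply: le_trans (cabs_sum _ _ _) _; apply: ler_sum => i _.
    by rewrite cabsM cabs_real normr_nat ler_piMl.
  under eq_bigr do rewrite expr2 big_distrl /=.
  rewrite exchange_big mulr_sumr /=; apply: ler_sum => i _.
  under eq_bigr do rewrite mulr_sumr.
  rewrite exchange_big mulr_sumr /=; apply: ler_sum => j _.
  by rewrite borel_count_conv.
rewrite -(ler_pM2l g0).
apply: (le_trans (y := rho * sqnorm sl2 v)); last first.
  by rewrite mulrCA; apply: ler_wpM2l.
apply: le_trans (bessel _ rho0 orth le_rho).
rewrite !mulr_sumr; apply: ler_sum => x _.
by rewrite -vE cabsM cabs_nat exprMn [leLHS]mulrA -expr2.
Qed.

Definition word_left h1 k1 h2 (x : A * A) := upper_vec h1 (lower_vec k1 (upper_vec h2 x)).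
Definition word_right k2 h3 k3 (x : A * A) := lower_vec k2 (upper_vec h3 (lower_vec k3 x)).

Definition word_count (h1 k1 h2 k2 h3 k3 : A) : nat :=
  \sum_(z | sl2 z) borel_count (upper h1 (lower k1 (upper h2 z)))
    (lower k2 (upper h3 (lower k3 z))).

Definition primitive (x : A * A) : bool := [exists u, cross x u == 1].

(** A matrix y of determinant 1 is invertible, so y g = y' determines g. *)
Lemma borel_count_le1 y y' : sl2 y -> (borel_count y y' <= 1)%N.
Proof.
case: y => [[x1 x2] [u1 u2]]; rewrite /sl2 /cross /= => /eqP sy.
apply/card_le1_eqP => -[t s] [t' s']; rewrite !inE /=.
move=> /andP[_ /eqP <-] /andP[_ /eqP]; rewrite /borel_act /= => -[e1 e2 e3 e4].
have H (c : A) : c = (c * x1) * u2 - (c * x2) * u1.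
  by rewrite -[LHS]mulr1 -sy; ring.
have tt : t' = t by rewrite (H t') (H t) e1 e2.
rewrite tt in e3 e4; have {}e3 := addIr _ e3; have {}e4 := addIr _ e4.
by rewrite tt (H s') (H s) e3 e4.
Qed.

(** If a completion u0 exists, (x, u0) is a basis, and any completion u is determined by its
    determinant with u0. *)
Lemma card_cross_le (x : A * A) : (#|[pred u | cross x u == 1%R]| <= #|A|)%N.
Proof.
have [u0 /eqP xu0|none] := pickP [pred u | cross x u == 1]; last first.
  by rewrite eq_card0 // => u; apply: none.
have inj : {in [pred u | cross x u == 1] &, injective (fun u => cross u u0)}.
  move=> u v; rewrite !inE => /eqP xu /eqP xv uv.
  have E (w : A * A) : w = (cross w u0 * x.1 + cross x w * u0.1,
      cross w u0 * x.2 + cross x w * u0.2).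
    have H : w = (cross x u0 * w.1, cross x u0 * w.2).
      by rewrite xu0 !mul1r; case: w.
    by rewrite [LHS]H /cross /=; congr pair; ring.
  by rewrite (E u) (E v) xu xv uv.
by rewrite -(card_in_image inj) max_card.
Qed.

(** Over Z/c with b = c/d, multiplication by b detects residues modulo d; the matrices are compared
    on the two basis vectors. *)
Definition congr_mod_b (M1 M2 : A * A -> A * A) : bool :=
  [&& b * (M1 (1, 0)).1 == b * (M2 (1, 0)).1, b * (M1 (1, 0)).2 == b * (M2 (1, 0)).2,
      b * (M1 (0, 1)).1 == b * (M2 (0, 1)).1 & b * (M1 (0, 1)).2 == b * (M2 (0, 1)).2].

(** A coincidence modulo the subgroup gives M2 x = t M1 x for the first column x of z, so the
    determinant of the two images vanishes. As b t = b and b s = 0, it also makes b M1 and b M2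
    agree on both columns of z, hence everywhere. For each x at most #|A| completions remain. *)
Lemma word_count_le h1 k1 h2 k2 h3 k3 :
  (word_count h1 k1 h2 k2 h3 k3 <=
   congr_mod_b (word_left h1 k1 h2) (word_right k2 h3 k3) *
   (#|A| * #|[pred x | primitive x &&
      (cross (word_right k2 h3 k3 x) (word_left h1 k1 h2 x) == 0%R)]|))%N.
Proof.
set M1 := word_left h1 k1 h2; set M2 := word_right k2 h3 k3.
set B := congr_mod_b M1 M2.
set Q := [pred x | primitive x && _].
have key (z : G) : sl2 z ->
    (borel_count (upper h1 (lower k1 (upper h2 z))) (lower k2 (upper h3 (lower k3 z))) <=
     B * (z.1 \in Q))%N.
  move=> sz; set y := upper h1 _; set y' := lower k2 _.
  have sy : sl2 y by rewrite /y sl2_upper sl2_lower sl2_upper.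
  have [->//|] := eqVneq (borel_count y y') 0%N.
  rewrite -lt0n => H; have/card_gt0P[[t s]] := H.
  rewrite inE /= => /andP[/and3P[/= ut /eqP bt /eqP bs] /eqP act].
  pose X := M1 z.1; pose U := M1 z.2.
  have btV : b * t^-1 = b by rewrite -{1}bt mulrK.
  have X2 : M2 z.1 = (t * X.1, t * X.2) by exact: (esym (congr1 fst act)).
  have U2 : M2 z.2 = (s * X.1 + t^-1 * U.1, s * X.2 + t^-1 * U.2) by exact: (esym (congr1 snd act)).
  have -> : z.1 \in Q.
    rewrite inE; apply/andP; split; first by apply/existsP; exists z.2.
    by rewrite X2 -/X /cross /=; apply/eqP; ring.
  rewrite muln1; suff -> : B by apply: borel_count_le1.
  have bX c : b * (t * c) = b * c by rewrite mulrA bt.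
  have bU c c' : b * (s * c + t^-1 * c') = b * c'.
    by rewrite mulrDr !mulrA bs mul0r add0r btV.
  have bx1 : b * X.1 = b * (M2 z.1).1 by rewrite X2; exact/esym/bX.
  have bx2 : b * X.2 = b * (M2 z.1).2 by rewrite X2; exact/esym/bX.
  have bu1 : b * U.1 = b * (M2 z.2).1 by rewrite U2; exact/esym/bU.
  have bu2 : b * U.2 = b * (M2 z.2).2 by rewrite U2; exact/esym/bU.
  (* By linearity the agreement on the columns of z passes to the standard basis, whose vectors are
     combinations of these columns since det z = 1. *)
  have lin (M : A * A -> A * A) : M = M1 \/ M = M2 -> forall c x d u,
    M (c * x.1 + d * u.1, c * x.2 + d * u.2) =
    (c * (M x).1 + d * (M u).1, c * (M x).2 + d * (M u).2).
    move=> HM c x d u; case: HM => ->.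
    by rewrite /M1 /word_left /upper_vec /lower_vec /=; congr pair; ring.
    by rewrite /M2 /word_right /upper_vec /lower_vec /=; congr pair; ring.
  have sz1 : cross z.1 z.2 = 1 by apply/eqP.
  have e1 : (1, 0) = (z.2.2 * z.1.1 + (- z.1.2) * z.2.1,
      z.2.2 * z.1.2 + (- z.1.2) * z.2.2) :> A * A.
    by rewrite -sz1 /cross; congr pair; ring.
  have e2 : (0, 1) = ((- z.2.1) * z.1.1 + z.1.1 * z.2.1,
      (- z.2.1) * z.1.2 + z.1.1 * z.2.2) :> A * A.
    by rewrite -sz1 /cross; congr pair; ring.
  have fin c d f f' g g' : b * f = b * f' -> b * g = b * g' ->
    b * (c * f + d * g) = b * (c * f' + d * g').
    have HH v v' : b * (c * v + d * v') = c * (b * v) + d * (b * v') by ring.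
    by move=> ff gg; rewrite !HH ff gg.
  by rewrite /B /congr_mod_b e1 e2 !(lin M1 (or_introl erefl)) !(lin M2 (or_intror erefl)) /=
    !(fin _ _ _ _ _ _ bx1 bu1) !(fin _ _ _ _ _ _ bx2 bu2) !eqxx.
rewrite /word_count; apply: (@leq_trans (\sum_(z | sl2 z) B * (z.1 \in Q))).
  exact: leq_sum.
rewrite -big_distrr /= leq_mul2l; apply/orP; right.
rewrite -(pair_big_dep xpredT (fun x u => cross x u == 1) (fun x _ => (x \in Q : nat))) /=.
have E (x : A * A) : (\sum_(u | cross x u == 1%R) (x \in Q) =
   #|[pred u | cross x u == 1%R]| * (x \in Q))%N by rewrite sum_nat_const.
under eq_bigr => x _ do rewrite E.
rewrite -[#|Q|]sum1_card big_distrr /= [leqRHS]big_mkcond /=; apply: leq_sum => x _.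
by case: ifP => _; rewrite ?muln0 // !muln1 card_cross_le.
Qed.

(** * The sixth moment as a count of words in unipotents *)

Section Sixfold.
Variables (I J : finType) (p : I -> R[i]) (q : J -> R[i]) (a : I -> A) (e : J -> A).
Hypotheses (p1 : forall i, cabs (p i) <= 1) (q1 : forall j, cabs (q j) <= 1).

Let opP := shift_op p (fun i => upper (a i)).
Let opPs := shift_op (fun i => conj (p i)) (fun i => upper (- a i)).
Let opQ := shift_op q (fun j => lower (e j)).
Let opQt := shift_op q (fun j => lower (- e j)).
Let opQs := shift_op (fun j => conj (q j)) (fun j => lower (e j)).

(** Components run from the outermost average [opQt] to the innermost [opP]. In [word], adjacent
    unipotents of the same type are merged, which leaves four letters. *)
Let index := (J * (I * (I * (J * (J * I)))))%type.
Let coef (k : index) := q k.1 * (p k.2.1 * (conj (p k.2.2.1) *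
  (conj (q k.2.2.2.1) * (q k.2.2.2.2.1 * p k.2.2.2.2.2)))).
Let word (k : index) z := upper (a k.2.2.2.2.2) (lower (e k.2.2.2.1 - e k.2.2.2.2.1)
  (upper (a k.2.1 - a k.2.2.1) (lower (- e k.1) z))).

Let sixfoldE f : opQt (opP (opPs (opQs (opQt (opP f))))) =1 shift_op coef word f.
Proof.
move=> z.
have e1 := shift_op_comp q (fun j => lower (- e j)) p (fun i => upper (a i)) f.
have e2 := fun z => etrans (eq_shift_op _ _ e1 z)
  (shift_op_comp (fun j => conj (q j)) (fun j => lower (e j)) _ _ f z).
have e3 := fun z => etrans (eq_shift_op _ _ e2 z)
  (shift_op_comp (fun j => conj (p j)) (fun j => upper (- a j)) _ _ f z).
have e4 := fun z => etrans (eq_shift_op _ _ e3 z)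
  (shift_op_comp p (fun j => upper (a j)) _ _ f z).
have e5 := fun z => etrans (eq_shift_op _ _ e4 z)
  (shift_op_comp q (fun j => lower (- e j)) _ _ f z).
apply: etrans (e5 z) _; apply: eq_bigr => k _ /=; congr (_ * f _).
by rewrite /word lowerD upperD addrC [_ + a _]addrC.
Qed.

Lemma sixth_moment_pairing f g :
  cabs (\sum_(z | sl2 z) opP f z * opQ g z) ^+ 6 <=
  sqnorm sl2 g ^+ 3 * sqnorm sl2 f ^+ 2 *
  sqnorm sl2 (opQt (opP (opPs (opQs (opQt (opP f)))))).
Proof.
have -> : \sum_(z | sl2 z) opP f z * opQ g z = \sum_(z | sl2 z) opQt (opP f) z * g z.
  rewrite (@shift_op_transpose _ _ _ _ _ _ (fun j => lower (e j))) // => j.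
  - exact: lowerK.
  - exact: lowerNK.
  - by move=> z; rewrite sl2_lower.
apply: (@schatten6 R G sl2 (fun f => opQt (opP f)) (fun f => opPs (opQs f))) => u v.
rewrite (@shift_op_adjoint _ _ _ _ _ _ (fun j => lower (e j))) //.
- rewrite (@shift_op_adjoint _ _ _ _ _ _ (fun j => upper (- a j))) // => i.
  + exact: upperNK.
  + exact: upperK.
  + by move=> z; rewrite sl2_upper.
- by move=> j; exact: lowerK.
- by move=> j; exact: lowerNK.
- by move=> j z; rewrite sl2_lower.
Qed.

Let sum6 (F : index -> R) : \sum_k F k = \sum_k1 \sum_h1 \sum_h2 \sum_k2 \sum_k3 \sum_h3
  F (k1, (h1, (h2, (k2, (k3, h3))))).
Proof.
have split2 (I1 I2 : finType) (H : I1 * I2 -> R) : \sum_k H k = \sum_i \sum_j H (i, j).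
  by rewrite pair_bigA; apply: eq_bigr => -[].
rewrite split2; apply: eq_bigr => k1 _; rewrite split2; apply: eq_bigr => h1 _.
rewrite split2; apply: eq_bigr => h2 _; rewrite split2; apply: eq_bigr => k2 _.
by rewrite split2.
Qed.

(** Two words of four letters are compared modulo the subgroup. A substitution in z moves one lower
    unipotent across, and left multiplication, which commutes with the subgroup action, merges the
    two leading upper ones; three letters remain on each side, all of them differences. *)
Lemma sixfold_moment_bound (X : finType) (phi : X -> G -> R[i]) (rho : R) :
  0 <= rho -> (forall i j, i != j -> dotp sl2 (phi i) (phi j) = 0) ->
  (forall i, sqnorm sl2 (phi i) <= rho) ->
  (forall i g z, borel g -> phi i (borel_act g z) = phi i z) ->
  #|borel|%:R * \sum_x sqnorm sl2 (opQt (opP (opPs (opQs (opQt (opP (phi x))))))) <=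
  rho * \sum_k1 \sum_h1 \sum_h2 \sum_k2 \sum_k3 \sum_h3
    \sum_k1' \sum_h1' \sum_h2' \sum_k2' \sum_k3' \sum_h3'
    (word_count (a h3 - a h3') (e k2 - e k3) (a h1 - a h2)
      (e k2' - e k3') (a h1' - a h2') (e k1 - e k1'))%:R.
Proof.
move=> rho0 orth le_rho inv.
under eq_bigr => x _ do (rewrite /sqnorm; under eq_bigr => z _ do rewrite sixfoldE).
have coef1 k : cabs (coef k) <= 1.
  rewrite /coef !cabsM !cabs_conj.
  by do ![apply: mulr_ile1; rewrite ?cabs_ge0 ?mulr_ge0 ?cabs_ge0 //].
have slw k z : sl2 (word k z) = sl2 z.
  by rewrite /word sl2_upper sl2_lower sl2_upper sl2_lower.
apply: le_trans (invariant_family_bound rho0 orth le_rho inv coef1 slw) _.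
apply: ler_wpM2l => //.
have cntE k k' : \sum_(z | sl2 z) (borel_count (word k z) (word k' z))%:R =
  (word_count (a k.2.2.2.2.2 - a k'.2.2.2.2.2) (e k.2.2.2.1 - e k.2.2.2.2.1)
   (a k.2.1 - a k.2.2.1) (e k'.2.2.2.1 - e k'.2.2.2.2.1) (a k'.2.1 - a k'.2.2.1)
   (e k.1 - e k'.1))%:R :> R.
  rewrite /word_count natr_sum (reindex_inj (can_inj (lowerK (e k.1)))) /=.
  apply: eq_big => [z|z _]; first by rewrite sl2_lower.
  rewrite /word -[in LHS](borel_count_upper (- a k'.2.2.2.2.2)) !upperD !lowerD.
  by rewrite !addNr upper0 lower0 [- a _ + _]addrC [- e _ + _]addrC.
under eq_bigr => k _ do under eq_bigr => k' _ do rewrite cntE.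
rewrite le_eqVlt; apply/orP; left; apply/eqP.
rewrite sum6; do 6 (apply: eq_bigr => ? _).
by rewrite sum6.
Qed.

End Sixfold.

(** * Invariance, orthogonality and norms of the twists *)

Section TwistNorms.
Variable psi : A -> R[i].
Hypothesis psiD : forall x y, psi (x + y) = psi x * psi y.
Hypothesis psi0 : psi 0 = 1.
Hypothesis psi_prim : forall q, q != 0 -> \sum_k psi (q * k) = 0.
Hypothesis psi_conj : forall x, conj (psi x) = psi (- x).

Local Notation unit := (GRing.unit : {pred A}).
Local Notation fch := (fchar psi).
Local Notation gch := (gchar psi).

Lemma parseval (T : finType) (v : T -> A) (c : T -> R[i]) : injective v ->
  \sum_x cabs (\sum_t psi (v t * x) * c t) ^+ 2 = #|A|%:R * \sum_t cabs (c t) ^+ 2.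
Proof.
move=> vinj; apply: complexI; rewrite rmorphM rmorph_nat !rmorph_sum /=.
under eq_bigr => x _ do rewrite -mul_conjc rmorph_sum mulr_suml.
under [in RHS]eq_bigr => t _ do rewrite -mul_conjc.
rewrite exchange_big mulr_sumr /=; apply: eq_bigr => t _.
under eq_bigr => x _ do rewrite mulr_sumr.
rewrite exchange_big (bigD1 t) //= [X in _ + X]big1 ?addr0 => [|s st].
  rewrite mulr_natl -sumr_const; apply: eq_bigr => x _.
  by rewrite rmorphM /= mulrACA psi_conj -psiD addNr psi0 mul1r.
have H x : conj (psi (v t * x) * c t) * (psi (v s * x) * c s) =
  psi ((v s - v t) * x) * (conj (c t) * c s).
  by rewrite rmorphM /= mulrACA psi_conj -psiD; congr (psi _ * _); ring.
under eq_bigr => x _ do rewrite H.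
rewrite -mulr_suml psi_prim ?mul0r // subr_eq0.
by apply: contraNneq st => /vinj ->.
Qed.

Let tw (xi : A) (F : A * A -> R[i]) (z : G) := twist psi b xi F z.1 z.2.
Definition scale_invariant (F : A * A -> R[i]) :=
  forall t x, t \is a GRing.unit -> F (t * x.1, t * x.2) = F x.

(** In t x + b k (s x + u / t) the term with b s vanishes and b / t = b = b t, so this vector is t
    (x + b k u), and F ignores unit scalings. *)
Lemma twist_borel F : scale_invariant F -> forall xi g z,
  borel g -> tw xi F (borel_act g z) = tw xi F z.
Proof.
move=> Finv xi g z /and3P[ug /eqP bt /eqP bs]; apply: eq_bigr => k _; congr (_ * _).
rewrite -[RHS](Finv g.1 _ ug); congr (F _); rewrite /axpy /=.
have btV : b * g.1^-1 = b by rewrite -{1}bt mulrK.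
have E c c' : b * k * (g.2 * c + g.1^-1 * c') = g.1 * (b * k * c').
  transitivity (k * (b * g.2) * c + k * (b * g.1^-1) * c'); first by ring.
  by rewrite bs btV -{1}bt; ring.
by congr pair; rewrite [RHS]mulrDr E.
Qed.

(** Acting by the diagonal matrix with entries t and 1/t and replacing k by t^2 k trades the twist
    xi t^2 for xi. *)
Lemma sqnorm_twist_square F : scale_invariant F -> forall xi t, t \is a GRing.unit ->
  sqnorm sl2 (tw (xi * t ^+ 2) F) = sqnorm sl2 (tw xi F).
Proof.
move=> Finv xi t ut.
have inj : injective (borel_act (t, 0)).
  apply: (can_inj (g := borel_act (t^-1, 0))) => z.
  rewrite borel_actM /= ?unitrV // /borel_mul /= mulr0 mul0r addr0 divrr //.
  exact: borel_id.
rewrite [RHS]/sqnorm (reindex_inj inj) /=.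
apply: eq_big => [z|z _]; first by rewrite sl2_borel.
congr (cabs _ ^+ 2); rewrite /tw /twist.
have ut2 : t ^+ 2 \is a GRing.unit by rewrite unitrX.
rewrite [RHS](reindex_inj (mulrI ut2)) /=; apply: eq_bigr => k _.
congr (_ * _); first by congr psi; ring.
rewrite -[LHS](Finv t _ ut); congr (F _); rewrite /axpy /=.
have E c c' : b * (t ^+ 2 * k) * (0 * c + t^-1 * c') = t * (b * k * c').
  transitivity ((t * t^-1) * (t * (b * k * c'))); first by ring.
  by rewrite divrr // mul1r.
by congr pair; rewrite E [LHS]mulrDr.
Qed.

(** The translation of x by b j u preserves SL_2 and multiplies the twist xi by psi(- xi j);
    distinct characters of j are orthogonal. *)
Lemma twist_orth F xi xi' : xi != xi' -> dotp sl2 (tw xi F) (tw xi' F) = 0.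
Proof.
move=> ne; set D := dotp _ _ _.
have tw_shift j (z : G) x : tw x F (axpy (b * j) z.1 z.2, z.2) = psi (- (x * j)) * tw x F z.
  rewrite /tw /twist /= mulr_sumr [RHS](reindex_inj (addIr j)) /=.
  apply: eq_bigr => k _; rewrite axpyA mulrA -psiD.
  by congr (psi _ * F (axpy _ _ _)); ring.
have shift j : D = psi ((xi - xi') * j) * D.
  rewrite {1}/D /dotp.
  have inj : injective (fun z : G => (axpy (b * j) z.1 z.2, z.2)).
    by apply: (can_inj (g := fun z : G => (axpy (- (b * j)) z.1 z.2, z.2))) => -[x u];
      rewrite /= axpyK.
  rewrite (reindex_inj inj) /= mulr_sumr; apply: eq_big => [z|z _].
    by rewrite /sl2 /= cross_axpyl.
  rewrite !tw_shift rmorphM /= psi_conj opprK mulrACA -psiD.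
  by congr (psi _ * _); ring.
have : #|A|%:R * D = 0.
  rewrite mulr_natl -sumr_const (eq_bigr _ (fun j _ => shift j)) -mulr_suml.
  by rewrite psi_prim ?mul0r // subr_eq0.
move/eqP; rewrite mulf_eq0 pnatr_eq0 => /orP[|/eqP//].
by rewrite -leqn0 leqNgt; case/negP; apply/card_gt0P; exists 0.
Qed.

(** For fixed (x, u) the twist is the Fourier transform in k of F(x + b k u), so this is Parseval in
    xi. *)
Lemma sum_sqnorm_twist F :
  \sum_xi sqnorm sl2 (tw xi F) = #|A|%:R ^+ 2 * \sum_(z | sl2 z) cabs (F z.1) ^+ 2.
Proof.
rewrite exchange_big /=.
have E (z : G) : \sum_xi cabs (tw xi F z) ^+ 2 =
    #|A|%:R * \sum_k cabs (F (axpy (b * k) z.1 z.2)) ^+ 2.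
  rewrite -(@parseval _ id) //; apply: eq_bigr => xi _; congr (cabs _ ^+ 2).
  by apply: eq_bigr => k _; rewrite [xi * k]mulrC.
under eq_bigr do rewrite E.
rewrite -mulr_sumr exchange_big /= expr2 -mulrA; congr (_ * _).
rewrite mulr_natl -sumr_const; apply: eq_bigr => k _.
have inj : injective (fun z : G => (axpy (b * k) z.1 z.2, z.2)).
  by apply: (can_inj (g := fun z : G => (axpy (- (b * k)) z.1 z.2, z.2))) => -[x u];
    rewrite /= axpyK.
rewrite [RHS](reindex_inj inj) /=; apply: eq_bigl => z.
by rewrite /sl2 /= cross_axpyl.
Qed.

Definition square_stab := #|[pred t in unit | b * t ^+ 2 == b]|.

Lemma card_unit_fiber (n : A) (xi : A) : n \is a GRing.unit ->
  (#|[pred t in unit | (n * b * t ^+ 2 == xi)%R]| <= square_stab)%N.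
Proof.
move=> un; have [t0|none] := pickP [pred t in unit | n * b * t ^+ 2 == xi]; last first.
  by rewrite eq_card0.
rewrite inE => /andP[ut0 /eqP Et0].
have inj : {in [pred t in unit | n * b * t ^+ 2 == xi] &, injective (fun t => t / t0)}.
  by move=> t t' _ _ /(mulIr _); apply; rewrite unitrV.
rewrite -(card_in_image inj); apply: subset_leq_card; apply/subsetP => s.
case/imageP => t; rewrite inE => /andP[ut /eqP Et] ->.
rewrite inE unitrMl ?unitrV // ut /=; apply/eqP; apply: (mulrI un).
have ut02 : t0 ^+ 2 \is a GRing.unit by rewrite unitrX.
apply: (mulIr ut02).
have -> : n * (b * (t / t0) ^+ 2) * t0 ^+ 2 = n * b * t ^+ 2 * (t0^-1 * t0) ^+ 2 by ring.
by rewrite mulVr // expr1n mulr1 Et Et0.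
Qed.

(** The twists n b t^2, for t a unit, all have the same norm, and each value is repeated at most
    [square_stab] times; so one of them accounts for at most its share of the total over xi. *)
Lemma sqnorm_twist_le F (n : A) : scale_invariant F -> n \is a GRing.unit ->
  #|unit|%:R * sqnorm sl2 (tw (n * b) F) <=
  square_stab%:R * #|A|%:R ^+ 2 * \sum_(z | sl2 z) cabs (F z.1) ^+ 2.
Proof.
move=> Finv un; rewrite -mulrA -sum_sqnorm_twist mulr_natl -sumr_const.
under eq_bigr => t ut do rewrite -(sqnorm_twist_square Finv _ ut).
rewrite (partition_big (fun t => n * b * t ^+ 2) xpredT) //= mulr_sumr.
apply: ler_sum => xi _.
rewrite (eq_bigr (fun=> sqnorm sl2 (tw xi F))); last by move=> t /andP[_ /eqP ->].
rewrite sumr_const -[leLHS]mulr_natl ler_wpM2r ?sqnorm_ge0 // ler_nat.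
exact: card_unit_fiber.
Qed.

Lemma sum_sl2_le (F : A * A -> R[i]) :
  \sum_(z | sl2 z) cabs (F z.1) ^+ 2 <= #|A|%:R * \sum_x cabs (F x) ^+ 2.
Proof.
rewrite -(pair_big_dep xpredT (fun x u => cross x u == 1) (fun x _ => cabs (F x) ^+ 2)) /=.
rewrite mulr_sumr; apply: ler_sum => x _; rewrite sumr_const -[leLHS]mulr_natl.
by rewrite ler_wpM2r ?sqr_ge0 // ler_nat card_cross_le.
Qed.

Section Combination.
Variables (T : finType) (v : T -> A) (c : T -> R[i]).
Hypothesis v_inj : injective v.

Lemma sum_fchar_sq :
  \sum_x cabs (\sum_t c t * fch (v t) x) ^+ 2 =
  #|unit|%:R * #|A|%:R * \sum_t cabs (c t) ^+ 2.
Proof.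
rewrite -(pair_bigA _ (fun x1 x2 => cabs (\sum_t c t * fch (v t) (x1, x2)) ^+ 2)) /=.
rewrite exchange_big /= (bigID (fun x2 => x2 \is a GRing.unit)) /= [X in _ + X]big1 ?addr0; last first.
  move=> x2 nu; apply: big1 => x1 _; rewrite big1 ?cabs0 ?expr0n // => t _.
  by rewrite /fchar ifN // mulr0.
rewrite -mulrA mulr_natl -sumr_const; apply: eq_bigr => x2 ux.
rewrite -(parseval _ v_inj) (reindex_inj (mulIr ux)) /=; apply: eq_bigr => x1 _.
congr (cabs _ ^+ 2); apply: eq_bigr => t _.
by rewrite /fchar /= ux mulrC mulrA mulrK.
Qed.

Lemma sum_gchar_sq :
  \sum_x cabs (\sum_t c t * gch (v t) x) ^+ 2 =
  #|unit|%:R * #|A|%:R * \sum_t cabs (c t) ^+ 2.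
Proof.
rewrite -sum_fchar_sq (reindex_inj (inv_inj (f := fun x : A * A => (x.2, x.1)) _)) /=;
  last by case.
by apply: eq_bigr => -[x1 x2] _.
Qed.

Lemma fchar_scale : scale_invariant (fun x => \sum_t c t * fch (v t) x).
Proof.
move=> s x us; apply: eq_bigr => t _; congr (_ * _).
rewrite /fchar /= unitrMr //; case: ifP => // ux; congr psi.
rewrite invrM //.
transitivity (s * s^-1 * (v t * x.1 / x.2)); first by ring.
by rewrite divrr // mul1r.
Qed.

Lemma gchar_scale : scale_invariant (fun x => \sum_t c t * gch (v t) x).
Proof.
move=> s x us; apply: eq_bigr => t _; congr (_ * _).
rewrite /gchar /fchar /= unitrMr //; case: ifP => // ux; congr psi.
rewrite invrM //.
transitivity (s * s^-1 * (v t * x.2 / x.1)); first by ring.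
by rewrite divrr // mul1r.
Qed.

End Combination.

(** Upper unipotents act on [fchar mu] by a character, as lower ones do on [gchar l], so weighted
    averages of unipotents merely rescale these functions. *)
Lemma fchar_upper mu h x : fch mu (upper_vec h x) = psi (mu * h) * fch mu x.
Proof.
rewrite /fchar /=; case: ifP => ux; last by rewrite mulr0.
rewrite -psiD; congr psi; rewrite mulrDr mulrDl addrC; congr (_ + _).
by rewrite mulrA mulrK.
Qed.

Lemma gchar_lower l k x : gch l (lower_vec k x) = psi (l * k) * gch l x.
Proof. by rewrite /gchar -fchar_upper. Qed.

Lemma axpy_upper h a x u : upper_vec h (axpy a x u) = axpy a (upper_vec h x) (upper_vec h u).
Proof. by rewrite /axpy /upper_vec /=; congr pair; ring. Qed.

Lemma axpy_lower h a x u : lower_vec h (axpy a x u) = axpy a (lower_vec h x) (lower_vec h u).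
Proof. by rewrite /axpy /lower_vec /=; congr pair; ring. Qed.

Lemma shift_op_twist (I : finType) (p : I -> R[i]) (w : I -> G -> G)
    (wv : I -> A * A -> A * A) (xi : A) F z :
  (forall i z, w i z = (wv i z.1, wv i z.2)) ->
  (forall i a x u, wv i (axpy a x u) = axpy a (wv i x) (wv i u)) ->
  shift_op p w (tw xi F) z = tw xi (fun x => \sum_i p i * F (wv i x)) z.
Proof.
move=> wE wlin; rewrite /shift_op /tw /twist.
under eq_bigr => i _ do rewrite mulr_sumr.
rewrite exchange_big /=; apply: eq_bigr => k _; rewrite mulr_sumr.
by apply: eq_bigr => i _; rewrite wE wlin mulrCA.
Qed.

(** The change n -> - n shows that the sum is real. Its square is therefore nonnegative, which rules
    out cancellation in the correlation constant. *)
Lemma unit_sum_sq z : unit_sum psi z ^+ 2 = (cabs (unit_sum psi z) ^+ 2)%:C%C.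
Proof.
rewrite -mul_conjc expr2; congr (_ * _).
rewrite /unit_sum rmorph_sum /= [RHS](reindex_inj (@oppr_inj A)) /=.
by apply: eq_big => [n|n _]; rewrite ?unitrN // psi_conj mulNr opprK.
Qed.

Definition kloosterman_ring (mu l : A) : R[i] := \sum_(x in unit) psi (mu * x + l / x).

(** Only pairs of units contribute, and the summand depends on the ratio x1 / x2 alone. *)
Lemma sum_fchar_gchar mu l :
  \sum_(x : A * A) fch mu x * gch l x = #|unit|%:R * kloosterman_ring mu l.
Proof.
rewrite -(pair_bigA _ (fun x1 x2 => fch mu (x1, x2) * gch l (x1, x2))) /= exchange_big /=.
rewrite (bigID (fun x2 => x2 \is a GRing.unit)) /= [X in _ + X]big1 ?addr0; last first.
  by move=> x2 nu; apply: big1 => x1 _; rewrite /fchar ifN // mul0r.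
rewrite mulr_natl -sumr_const; apply: eq_bigr => x2 ux.
rewrite (reindex_inj (mulIr ux)) /= /kloosterman_ring [RHS]big_mkcond /=.
apply: eq_bigr => x1 _; rewrite /gchar /fchar /= ux unitrMl //.
case: ifP => ux1; last by rewrite mulr0.
rewrite -psiD; congr psi; rewrite mulrA mulrK // invrM //; congr (_ + _).
transitivity (x2 * x2^-1 * (l * x1^-1)); first by ring.
by rewrite divrr // mul1r.
Qed.

Lemma twist_sum (T : finType) (c : T -> R[i]) (f : T -> A * A -> R[i]) xi z :
  tw xi (fun x => \sum_t c t * f t x) z = \sum_t c t * tw xi (f t) z.
Proof.
rewrite /tw /twist; under eq_bigr do rewrite mulr_sumr.
rewrite exchange_big /=; apply: eq_bigr => t _; rewrite mulr_sumr.
by apply: eq_bigr => k _; rewrite mulrCA.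
Qed.

Let cardU0 : 0 < #|unit|%:R :> R.
Proof. by rewrite ltr0n; apply/card_gt0P; exists 1; apply: unitr1. Qed.

Let cardA0 : 0 < #|A|%:R :> R.
Proof. by rewrite ltr0n; apply/card_gt0P; exists 0. Qed.

Definition annihilator_card := #|[pred s : A | b * s == 0]|.

Lemma card_borel : #|borel| = (#|[pred t in unit | (b * t == b)%R]| * annihilator_card)%N.
Proof.
rewrite /annihilator_card -cardX; apply: eq_card => -[t s].
transitivity (borel (t, s)); first by [].
by rewrite /borel !inE /= andbA.
Qed.

Let pairing_const : R :=
  #|A|%:R * \sum_k (unit_count (b * k))%:R * cabs (unit_sum psi (b * k)) ^+ 2.

(** Only the terms with b k = 0 are kept; there [unit_count] is #|A| and [unit_sum] is #|unit|. *)
Lemma pairing_const_ge :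
  #|A|%:R ^+ 2 * annihilator_card%:R * #|unit|%:R ^+ 2 <= pairing_const.
Proof.
rewrite /pairing_const expr2 -!mulrA ler_wpM2l ?ler0n //.
rewrite [leRHS](bigID (fun s => b * s == 0)) /= -[leLHS]addr0 lerD //; last first.
  by apply: sumr_ge0 => k _; rewrite mulr_ge0 ?sqr_ge0.
rewrite (eq_bigr (fun=> #|A|%:R * #|unit|%:R ^+ 2)); last first.
  move=> k /eqP ->; congr (_ * _).
    congr _%:R; apply: eq_card => x; rewrite !inE mul0r subr0.
    exact: unitr1.
  rewrite /unit_sum; under eq_bigr do rewrite mulr0 psi0.
  by rewrite sumr_const cabs_nat.
by rewrite sumr_const -[leRHS]mulr_natl mulrCA.
Qed.

(** * The amplified bilinear inequality over a finite ring *)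

Section Core.
Variables (TM TN I J : finType) (mu : TM -> A) (l : TN -> A).
Variables (al : TM -> R[i]) (be : TN -> R[i]) (d : A).
Variables (p : I -> R[i]) (q : J -> R[i]) (a : I -> A) (e : J -> A) (rP rQ : R).
Hypotheses (mu_inj : injective mu) (l_inj : injective l) (bd : b * d = 0).
Hypothesis cop : forall m n, al m != 0 -> be n != 0 ->
  exists x y z, mu m * x + l n * y + d * z = 1.
Hypotheses (p1 : forall i, cabs (p i) <= 1) (q1 : forall j, cabs (q j) <= 1).
Hypotheses (rP0 : 0 < rP) (rQ0 : 0 < rQ).
Hypothesis eigP : forall m, rP <= cabs (\sum_i p i * psi (mu m * a i)).
Hypothesis eigQ : forall n, rQ <= cabs (\sum_j q j * psi (l n * e j)).

(** The eigenvalue of [opP] on [fchar (mu m)]; likewise [ew] for [opQ]. The coefficients of F and H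
    are divided by them in advance so that [opP] and [opQ] restore al and be, at a loss governed by
    rP and rQ. *)
Let ev m := \sum_i p i * psi (mu m * a i).
Let ew n := \sum_j q j * psi (l n * e j).
Let F x := \sum_m (al m / ev m) * fch (mu m) x.
Let H x := \sum_n (be n / ew n) * gch (l n) x.
Let opP := shift_op p (fun i => upper (a i)).
Let opPs := shift_op (fun i => conj (p i)) (fun i => upper (- a i)).
Let opQ := shift_op q (fun j => lower (e j)).
Let opQt := shift_op q (fun j => lower (- e j)).
Let opQs := shift_op (fun j => conj (q j)) (fun j => lower (e j)).

Let ev0 m : ev m != 0.
Proof. by apply: contraTneq (eigP m) => E; rewrite -/(ev m) E cabs0 -ltNge. Qed.

Let ew0 n : ew n != 0.
Proof. by apply: contraTneq (eigQ n) => E; rewrite -/(ew n) E cabs0 -ltNge. Qed.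

Let opPF xi z : opP (tw xi F) z = \sum_m al m * tw xi (fch (mu m)) z.
Proof.
rewrite /opP (shift_op_twist _ (wv := fun i => upper_vec (a i))) //; last first.
  by move=> *; exact: axpy_upper.
rewrite -twist_sum; apply: eq_bigr => k _; congr (_ * _).
rewrite /F; under eq_bigr do rewrite mulr_sumr.
rewrite exchange_big /=; apply: eq_bigr => m _.
rewrite -[in RHS](divfK (ev0 m) (al m)) /ev mulr_sumr mulr_suml.
by apply: eq_bigr => i _; rewrite fchar_upper; ring.
Qed.

Let opQH xi z : opQ (tw xi H) z = \sum_n be n * tw xi (gch (l n)) z.
Proof.
rewrite /opQ (shift_op_twist _ (wv := fun j => lower_vec (e j))) //; last first.
  by move=> *; exact: axpy_lower.
rewrite -twist_sum; apply: eq_bigr => k _; congr (_ * _).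
rewrite /H; under eq_bigr do rewrite mulr_sumr.
rewrite exchange_big /=; apply: eq_bigr => n _.
rewrite -[in RHS](divfK (ew0 n) (be n)) /ew mulr_sumr mulr_suml.
by apply: eq_bigr => j _; rewrite gchar_lower; ring.
Qed.

Let form := \sum_m \sum_n al m * be n * kloosterman_ring (mu m) (l n).

Let formE : pairing_const%:C%C * form = \sum_(n0 in unit) \sum_(z | sl2 z)
  opP (tw (- (n0 * b)) F) z * opQ (tw (n0 * b) H) z.
Proof.
transitivity (\sum_m \sum_n al m * be n * \sum_(n0 in unit) \sum_(z | sl2 z)
    tw (- (n0 * b)) (fch (mu m)) z * tw (n0 * b) (gch (l n)) z).
  rewrite mulr_sumr; apply: eq_bigr => m _; rewrite mulr_sumr; apply: eq_bigr => n _.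
  have [->|am] := eqVneq (al m) 0; first by rewrite !mul0r mulr0.
  have [->|bn] := eqVneq (be n) 0; first by rewrite mulr0 !mul0r mulr0.
  have [x [y [z bez]]] := cop am bn.
  rewrite mulrCA; congr (_ * _).
  have U0 : #|unit|%:R != 0 :> R[i].
    by rewrite pnatr_eq0 -lt0n; apply/card_gt0P; exists 1; apply: unitr1.
  apply: (mulfI U0); have := twist_pairing psiD psi_prim bd bez.
  rewrite sum_fchar_gchar.
  have -> : #|A|%:R * (\sum_k (unit_count (b * k))%:R * unit_sum psi (b * k) ^+ 2) =
      pairing_const%:C%C.
    rewrite rmorphM rmorph_nat rmorph_sum; congr (_ * _); apply: eq_bigr => k _.
    by rewrite rmorphM rmorph_nat /= unit_sum_sq.
  rewrite [in RHS]mulrCA => <-; congr (_ * _); apply: eq_bigr => n0 _.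
  by rewrite pair_big_dep.
under eq_bigr => m _ do under eq_bigr => n _ do rewrite mulr_sumr.
under eq_bigr => m _ do rewrite exchange_big /=.
rewrite exchange_big /=; apply: eq_bigr => n0 _.
under eq_bigr => m _ do under eq_bigr => n _ do rewrite mulr_sumr.
under eq_bigr => m _ do rewrite exchange_big /=.
rewrite exchange_big /=; apply: eq_bigr => z _.
rewrite opPF opQH big_distrl /=; apply: eq_bigr => m _.
by rewrite mulr_sumr; apply: eq_bigr => n _; rewrite mulrACA.
Qed.

Let coefP m : cabs (al m / ev m) ^+ 2 <= cabs (al m) ^+ 2 / rP ^+ 2.
Proof.
rewrite cabsM exprMn ler_wpM2l ?sqr_ge0 // /cabs ComplexField.Normc.normcV exprVn.
rewrite lef_pV2 ?posrE ?exprn_gt0 //; last exact: lt_le_trans (eigP m).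
by rewrite ler_sqr ?nnegrE ?(ltW rP0) ?cabs_ge0 //; exact: eigP.
Qed.

Let coefQ n : cabs (be n / ew n) ^+ 2 <= cabs (be n) ^+ 2 / rQ ^+ 2.
Proof.
rewrite cabsM exprMn ler_wpM2l ?sqr_ge0 // /cabs ComplexField.Normc.normcV exprVn.
rewrite lef_pV2 ?posrE ?exprn_gt0 //; last exact: lt_le_trans (eigQ n).
by rewrite ler_sqr ?nnegrE ?(ltW rQ0) ?cabs_ge0 //; exact: eigQ.
Qed.

Let nu : R := square_stab%:R.
Let N1 := \sum_m cabs (al m) ^+ 2.
Let N2 := \sum_n cabs (be n) ^+ 2.
Let rhoF := nu * #|A|%:R ^+ 4 * (N1 / rP ^+ 2).
Let rhoH := nu * #|A|%:R ^+ 4 * (N2 / rQ ^+ 2).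

Let rhoF0 : 0 <= rhoF.
Proof.
by rewrite /rhoF !mulr_ge0 ?ler0n ?exprn_ge0 ?invr_ge0 ?exprn_ge0 ?(ltW rP0) // sumr_ge0 // => *; apply: sqr_ge0.
Qed.

Let rho_gen (f : A * A -> R[i]) (N : R) n : scale_invariant f -> n \is a GRing.unit ->
  \sum_x cabs (f x) ^+ 2 <= #|unit|%:R * #|A|%:R * N ->
  sqnorm sl2 (tw (n * b) f) <= nu * #|A|%:R ^+ 4 * N.
Proof.
move=> finv un le; rewrite -(ler_pM2l cardU0).
apply: le_trans (sqnorm_twist_le finv un) _.
apply: (le_trans (y := nu * #|A|%:R ^+ 2 * (#|A|%:R * (#|unit|%:R * #|A|%:R * N)))).
  rewrite ler_wpM2l ?mulr_ge0 ?ler0n ?sqr_ge0 //.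
  by apply: le_trans (sum_sl2_le f) _; rewrite ler_wpM2l.
by rewrite le_eqVlt; apply/orP; left; apply/eqP; ring.
Qed.

Let rhoF_le n : n \is a GRing.unit -> sqnorm sl2 (tw (n * b) F) <= rhoF.
Proof.
move=> un; apply: rho_gen un _; first exact: fchar_scale.
rewrite sum_fchar_sq // ler_wpM2l ?mulr_ge0 // /N1 mulr_suml.
by apply: ler_sum => m _; apply: coefP.
Qed.

Let rhoH_le n : n \is a GRing.unit -> sqnorm sl2 (tw (n * b) H) <= rhoH.
Proof.
move=> un; apply: rho_gen un _; first exact: gchar_scale.
rewrite sum_gchar_sq // ler_wpM2l ?mulr_ge0 // /N2 mulr_suml.
by apply: ler_sum => m _; apply: coefQ.
Qed.

Let words := \sum_k1 \sum_h1 \sum_h2 \sum_k2 \sum_k3 \sum_h3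
    \sum_k1' \sum_h1' \sum_h2' \sum_k2' \sum_k3' \sum_h3'
    (word_count (a h3 - a h3') (e k2 - e k3) (a h1 - a h2)
      (e k2' - e k3') (a h1' - a h2') (e k1 - e k1'))%:R : R.
Let opY f := opQt (opP (opPs (opQs (opQt (opP f))))).

(** The map n -> - (n b) takes each value at most #{t unit : b t = b} times. That number is one of
    the two factors of #|borel|, so the other, [annihilator_card], is what survives. The family is
    extended by zero to the remaining xi. *)
Let moment_bound :
  annihilator_card%:R * \sum_(n in unit) sqnorm sl2 (opY (tw (- (n * b)) F)) <= rhoF * words.
Proof.
pose S := [pred xi | [exists n, (n \is a GRing.unit) && (xi == - (n * b))]].
pose phi xi := if S xi then tw xi F else (fun=> 0).
have z0 f : dotp sl2 (fun=> 0) f = 0.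
  by rewrite /dotp big1 // => z _; rewrite rmorph0 mul0r.
have phi_orth i j : i != j -> dotp sl2 (phi i) (phi j) = 0.
  move=> ij; rewrite /phi; case: ifP => _; last by rewrite z0.
  case: ifP => _; first exact: twist_orth.
  by rewrite /dotp big1 // => z _; rewrite mulr0.
have phi_le i : sqnorm sl2 (phi i) <= rhoF.
  rewrite /phi; case: ifP => [/existsP[n /andP[un /eqP ->]]|_].
    by rewrite -mulNr; apply: rhoF_le; rewrite unitrN.
  by rewrite /sqnorm big1 // => z _; rewrite cabs0 expr0n.
have phi_inv i g z : borel g -> phi i (borel_act g z) = phi i z.
  rewrite /phi; case: ifP => // _ bg; apply: twist_borel bg.
  exact: fchar_scale.
have := sixfold_moment_bound a e p1 q1 rhoF0 phi_orth phi_le phi_inv.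
apply: le_trans; rewrite card_borel natrM -mulrA mulrCA ler_wpM2l ?ler0n // mulr_sumr.
rewrite (partition_big (fun n => - (n * b)) xpredT) //=.
apply: ler_sum => xi _.
rewrite (eq_bigr (fun=> sqnorm sl2 (opY (phi xi)))); last first.
  move=> n /andP[un /eqP <-]; rewrite /phi ifT //.
  by apply/existsP; exists n; rewrite un eqxx.
rewrite sumr_const -[leLHS]mulr_natl ler_wpM2r ?sqnorm_ge0 // ler_nat.
have [n0|none] := pickP [pred n in unit | - (n * b) == xi]; last by rewrite eq_card0.
rewrite inE => /andP[un0 /eqP En0].
have inj : {in [pred n in unit | - (n * b) == xi] &, injective (fun n => n / n0)}.
  by move=> t t' _ _ /(mulIr _); apply; rewrite unitrV.
rewrite -(card_in_image inj); apply: subset_leq_card; apply/subsetP => s.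
case/imageP => n; rewrite inE => /andP[un /eqP En] ->.
rewrite inE unitrMl ?unitrV //; apply/andP; split; first exact: un.
have E : n * b = n0 * b by apply: oppr_inj; rewrite En En0.
apply/eqP; transitivity (n * b / n0); first by ring.
by rewrite E mulrAC divrr // mul1r.
Qed.

(** The sixth power of the lower bound for [pairing_const] supplies annihilator^6, #|A|^12 and
    #|unit|^12; the moment bound adds one annihilator factor; the power mean over units costs
    #|unit|^5; and rhoF^3 rhoH^3 brings in #|A|^24 and nu^6. *)
Theorem amplified_bilinear_bound :
  annihilator_card%:R ^+ 7 * #|unit|%:R ^+ 7 * (rP * rQ) ^+ 6 * cabs form ^+ 6 <=
  nu ^+ 6 * #|A|%:R ^+ 12 * (N1 * N2) ^+ 3 * words.
Proof.
set x := fun n0 => cabs (\sum_(z | sl2 z) opP (tw (- (n0 * b)) F) z * opQ (tw (n0 * b) H) z).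
have le1 : pairing_const * cabs form <= \sum_(n in unit) x n.
  have c0 : 0 <= pairing_const.
    by rewrite mulr_ge0 // sumr_ge0 // => k _; rewrite mulr_ge0 ?sqr_ge0.
  rewrite -{1}(ger0_norm c0) -cabs_real -cabsM formE; exact: cabs_sum.
have le2 : (pairing_const * cabs form) ^+ 6 <= #|unit|%:R ^+ 5 * \sum_(n in unit) x n ^+ 6.
  apply: le_trans (power_mean6 _); last by move=> n _; apply: cabs_ge0.
  have c0 : 0 <= pairing_const.
    by rewrite mulr_ge0 // sumr_ge0 // => k _; rewrite mulr_ge0 ?sqr_ge0.
  have s0 : 0 <= \sum_(n in unit) x n by apply: sumr_ge0 => n _; apply: cabs_ge0.
  apply: lerXn2r; last exact: le1.
    by rewrite nnegrE mulr_ge0 ?cabs_ge0.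
  by rewrite nnegrE; exact: s0.
have le3 : \sum_(n in unit) x n ^+ 6 <=
    rhoH ^+ 3 * rhoF ^+ 2 * \sum_(n in unit) sqnorm sl2 (opY (tw (- (n * b)) F)).
  rewrite mulr_sumr; apply: ler_sum => n un.
  apply: le_trans (sixth_moment_pairing p q a e _ _) _.
  rewrite ler_wpM2r ?sqnorm_ge0 //.
  have rH0 : 0 <= rhoH := le_trans (sqnorm_ge0 _ _) (rhoH_le un).
  apply: ler_pM; rewrite ?exprn_ge0 ?sqnorm_ge0 // lerXn2r ?nnegrE ?sqnorm_ge0 //.
    exact: rhoH_le.
  by rewrite -mulNr rhoF_le // unitrN.
have rH0 : 0 <= rhoH := le_trans (sqnorm_ge0 _ _) (rhoH_le (unitr1 A)).
have c0 : 0 <= annihilator_card%:R :> R by [].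
have le4 : annihilator_card%:R * (pairing_const * cabs form) ^+ 6 <=
    #|unit|%:R ^+ 5 * rhoH ^+ 3 * rhoF ^+ 3 * words.
  have -> : #|unit|%:R ^+ 5 * rhoH ^+ 3 * rhoF ^+ 3 * words =
    #|unit|%:R ^+ 5 * (rhoH ^+ 3 * rhoF ^+ 2 * (rhoF * words)) by ring.
  apply: (le_trans (ler_wpM2l c0 le2)); rewrite [leLHS]mulrCA ler_wpM2l ?exprn_ge0 //.
  apply: (le_trans (ler_wpM2l c0 le3)); rewrite [leLHS]mulrCA.
  by rewrite ler_wpM2l ?moment_bound // mulr_ge0 ?exprn_ge0.
have le5 : annihilator_card%:R * (#|A|%:R ^+ 2 * annihilator_card%:R * #|unit|%:R ^+ 2 *
    cabs form) ^+ 6 <= annihilator_card%:R * (pairing_const * cabs form) ^+ 6.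
  have le0 := pairing_const_ge.
  have lo : 0 <= #|A|%:R ^+ 2 * annihilator_card%:R * #|unit|%:R ^+ 2 :> R.
    by rewrite !mulr_ge0 ?exprn_ge0.
  apply: ler_wpM2l => //; apply: lerXn2r; rewrite ?nnegrE.
  - exact: mulr_ge0 lo (cabs_ge0 _).
  - exact: mulr_ge0 (le_trans lo le0) (cabs_ge0 _).
  - exact: ler_wpM2r (cabs_ge0 _) _ _ le0.
have K0 : 0 < #|A|%:R ^+ 12 * #|unit|%:R ^+ 5 :> R by rewrite mulr_gt0 ?exprn_gt0.
rewrite -(ler_pM2l K0).
have r0 : 0 <= (rP * rQ) ^+ 6 by rewrite exprn_ge0 // mulr_ge0 // ltW.
have := ler_wpM2l r0 (le_trans le5 le4).
rewrite /rhoF /rhoH; move: words (cabs form) => W B.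
have [rP1 rQ1] : rP != 0 /\ rQ != 0 by split; apply: lt0r_neq0.
move=> le; apply: le_trans (le_trans _ le) _; rewrite le_eqVlt; apply/orP; left; apply/eqP.
  by ring.
by field; rewrite rP1.
Qed.

End Core.

End TwistNorms.

End SL2Action.

(** * Divisor bounds and counting in residue classes *)

Section Divisors.
Local Open Scope nat_scope.

(** A divisor d is recovered from p^i = gcd(d, p^v) and the cofactor d / p^i, which is prime to p^v
    / p^i and hence divides m. *)
Lemma size_divisors_pfactor p v m : prime p -> 0 < m ->
  size (divisors (p ^ v * m)) <= v.+1 * size (divisors m).
Proof.
move=> pp m0; have n0 : 0 < p ^ v * m by rewrite muln_gt0 expn_gt0 prime_gt0.
rewrite -[v.+1](size_iota 0) -(size_allpairs (fun i d => p ^ i * d)).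
apply: uniq_leq_size; first exact: divisors_uniq.
move=> d; rewrite -dvdn_divisors // => dn.
have [i iv gE] : exists2 i, i <= v & gcdn d (p ^ v) = p ^ i.
  by apply/dvdn_pfactor; rewrite ?dvdn_gcdr.
have ddE : p ^ i * (d %/ p ^ i) = d by rewrite mulnC divnK // -gE dvdn_gcdl.
apply/allpairsP; exists (i, d %/ p ^ i); split; last by rewrite ddE.
  by rewrite (mem_iota 0 v.+1).
rewrite -dvdn_divisors //.
have cop : coprime (d %/ p ^ i) (p ^ v %/ p ^ i).
  rewrite /coprime -gE -(eqn_pmul2r (m := gcdn d (p ^ v))); last first.
    by rewrite gE expn_gt0 prime_gt0.
  by rewrite muln_gcdl !divnK ?dvdn_gcdl ?dvdn_gcdr // mul1n.
rewrite -(Gauss_dvdr _ cop) -(dvdn_pmul2l (p := p ^ i)) ?expn_gt0 ?prime_gt0 //.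
by rewrite ddE mulnA [p ^ i * _]mulnC divnK // -gE dvdn_gcdr.
Qed.

(* Primes [p >= 2 ^ k] contribute at most [(v + 1) ^ k <= p ^ v], and each of the
   finitely many smaller ones at most a factor [k ^ k]. *)
Lemma divisor_bound k : exists C, forall n, 0 < n -> size (divisors n) ^ k <= C * n.
Proof.
pose B := 2 ^ k; pose C0 := k ^ k.
have C00 : 0 < C0 by rewrite /C0; case: k {B C0} => // k; rewrite expn_gt0.
(* From v + 1 <= k 2^(v / k), with integer division, raised to the power k. *)
have C0P v : v.+1 ^ k <= C0 * 2 ^ v.
  rewrite /C0; case: k {B C0 C00} => [|k]; first by rewrite mul1n expn_gt0.
  apply: (@leq_trans ((k.+1 * 2 ^ (v %/ k.+1)) ^ k.+1)).
    rewrite leq_exp2r //; apply: (leq_trans (ltn_ceil v (ltn0Sn k))).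
    by rewrite mulnC leq_mul2l ltn_expl.
  by rewrite expnMn leq_mul2l -expnM leq_exp2l ?leq_trunc_div ?orbT.
have mono a b : a <= b -> a ^ k <= b ^ k.
  by case: (k) => // k' ab; rewrite leq_exp2r.
have split_p p n : prime p -> 0 < n -> exists v m, [/\ n = p ^ v * m, 0 < m, ~~ (p %| m),
    m %| n & size (divisors n) ^ k <= v.+1 ^ k * size (divisors m) ^ k].
  move=> pp n0; have [m cop nE] := pfactor_coprime pp n0.
  have m0 : 0 < m by move: n0; rewrite nE; case: (m).
  exists (logn p n), m; split=> //.
  - by rewrite mulnC.
  - by rewrite -prime_coprime.
  - by rewrite nE dvdn_mulr.
  - rewrite -expnMn; apply: mono; rewrite {1}nE [m * _]mulnC.
    exact: size_divisors_pfactor.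
have base n : 0 < n -> (forall p, prime p -> p %| n -> B <= p) -> size (divisors n) ^ k <= n.
  elim/ltn_ind: n => n IH n0 big.
  have [n1|n1] := leqP n 1.
    have -> : n = 1 by lia.
    by rewrite (_ : size (divisors 1) = 1) ?exp1n.
  have pp := pdiv_prime n1; set p := pdiv n in pp.
  have [v [m [nE m0 pm mn le]]] := split_p p n pp n0.
  have v0 : 0 < v by case: v nE {le} => // nE; move: pm; rewrite -[m]mul1n -nE pdiv_dvd.
  have ltmn : m < n by rewrite nE ltn_Pmull // -(exp1n v) ltn_exp2r // prime_gt1.
  apply: leq_trans le _; rewrite nE; apply: leq_mul; last first.
    by apply: IH => // r pr rm; apply: big => //; apply: dvdn_trans mn.
  apply: (@leq_trans (B ^ v)); last by rewrite leq_exp2r // big // pdiv_dvd.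
  by rewrite -expnM mulnC expnM mono // ltn_expl.
(* Each induction step lowers by one the bound B - j on the prime factors and costs a factor C0. *)
have small j n : 0 < n -> (forall p, prime p -> p %| n -> B - j <= p) ->
    size (divisors n) ^ k <= C0 ^ j * n.
  elim: j n => [|j IH] n n0 big.
    by rewrite expn0 mul1n; apply: base => // p; rewrite -(subn0 B); apply: big.
  have [Bj|jB] := leqP B j.
    apply: (leq_trans (IH n n0 _)) => [p _ _|]; first by rewrite (eqP Bj).
    by rewrite leq_mul2r expnS leq_pmull ?orbT.
  set i := B - j.+1; have iE : B - j = i.+1 by rewrite /i; lia.
  have [pi|npi] := boolP (prime i); last first.
    apply: (leq_trans (IH n n0 _)) => [p pp pn|].
      rewrite iE ltn_neqAle big // andbT; apply: contraNneq npi => ->.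
      exact: pp.
    by rewrite leq_mul2r expnS leq_pmull ?orbT.
  have [v [m [nE m0 pm mn le]]] := split_p i n pi n0.
  apply: leq_trans le _; rewrite nE expnS.
  apply: (@leq_trans (C0 * 2 ^ v * (C0 ^ j * m))).
    apply: leq_mul (C0P v) _; apply: IH => // r pr rm.
    rewrite iE ltn_neqAle big ?(dvdn_trans rm) // andbT.
    by apply: contraNneq pm => ->.
  have le2 : 2 ^ v <= i ^ v by case: (v) => // v'; rewrite leq_exp2r // prime_gt1.
  rewrite -mulnA [X in C0 * X]mulnCA -mulnA !leq_mul2l; apply/orP; right; apply/orP; right.
  by rewrite leq_mul2r le2 orbT.
exists (C0 ^ B) => n n0; apply: small => // p _ _; by rewrite subnn.
Qed.

Lemma totient_dvd_le d n : 0 < n -> d %| n -> totient d <= totient n.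
Proof.
move=> n0 dn; have d0 := dvdn_gt0 n0 dn.
rewrite !totientE // [X in _ <= X](bigID (fun p => p \in primes d)) /=.
have pos (r : seq nat) (P : pred nat) : {subset r <= primes n} ->
    0 < \prod_(p <- r | P p) (p.-1 * p ^ (logn p n).-1).
  move=> sub; rewrite big_seq_cond prodn_cond_gt0 // => p /andP[/sub].
  rewrite mem_primes => /and3P[pp _ _] _; have := prime_gt1 pp.
  by rewrite muln_gt0 expn_gt0 (prime_gt0 pp) andbT; case: p {pp} => [|[]].
apply: leq_trans (leq_pmulr _ (pos _ _ _)) => //.
rewrite -[X in _ <= X]big_filter.
have -> : \prod_(p <- [seq p <- primes n | p \in primes d]) (p.-1 * p ^ (logn p n).-1) =
   \prod_(p <- primes d) (p.-1 * p ^ (logn p n).-1).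
  apply: perm_big; apply: uniq_perm; rewrite ?filter_uniq ?primes_uniq //.
  move=> p; rewrite mem_filter; apply: andb_idr.
  by rewrite !mem_primes n0 => /and3P[-> _ /dvdn_trans ->].
rewrite !big_seq; apply: leq_prod => p; rewrite mem_primes => /and3P[pp _ _].
rewrite leq_mul2l leq_exp2l ?prime_gt1 //; apply/orP; right.
by rewrite -!subn1 leq_sub2r // dvdn_leq_log.
Qed.

(** Since n is the sum of phi(d) over d | n, and phi(d) <= phi(n). *)
Lemma leq_divisors_totient n : 0 < n -> n <= size (divisors n) * totient n.
Proof.
move=> n0; rewrite -{1}(sum_totient_dvd n).
apply: (@leq_trans (\sum_(d < n.+1 | d %| n) totient n)).
  by apply: leq_sum => d; apply: totient_dvd_le.
rewrite sum_nat_const leq_mul2r; apply/orP; right.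
rewrite cardE -(size_map val); apply: uniq_leq_size.
  by rewrite map_inj_uniq ?enum_uniq //; apply: val_inj.
move=> d /mapP[j]; rewrite mem_enum => dj ->.
by rewrite -dvdn_divisors.
Qed.

Lemma card_congr_le (n q : nat) (S : pred 'I_n) : 0 < q ->
  (forall i j : 'I_n, S i -> S j -> i = j %[mod q]) -> #|S| <= n.-1 %/ q + 1.
Proof.
case: n S => [|n] S q0 cong; first by rewrite addn1 ltnW // (leq_ltn_trans (max_card _)) ?card_ord.
have bnd (i : 'I_n.+1) : i %/ q < n %/ q + 1.
  by rewrite addn1 ltnS leq_div2r // -ltnS.
pose f i : 'I_(n %/ q + 1) := Ordinal (bnd i).
have inj : {in S &, injective f}.
  move=> i j Si Sj [eq]; apply: val_inj; rewrite /= (divn_eq i q) (divn_eq j q) eq.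
  by rewrite (cong i j).
by rewrite -(card_in_image inj) (leq_trans (max_card _)) ?card_ord.
Qed.

Lemma card_le_fibers (T : finType) (S : pred T) (f : T -> nat) (s : seq nat) (B : nat) :
  (forall x, S x -> f x \in s) ->
  (forall r, r \in s -> #|[pred x | S x && (f x == r)]| <= B) -> #|S| <= size s * B.
Proof.
move=> fS le; apply: (@leq_trans (\sum_(r <- s) #|[pred x | S x && (f x == r)]|)).
  under eq_bigr do rewrite -sum1_card big_mkcond /=.
  rewrite exchange_big /= -sum1_card [X in X <= _]big_mkcond /=; apply: leq_sum => x _.
  case: ifP => // Sx; have fx := fS x Sx.
  rewrite (big_rem _ fx) /= ifT // inE eqxx andbT; exact: Sx.
rewrite -sum1_size big_distrl /= big_seq [X in _ <= X]big_seq; apply: leq_sum => r rs.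
by rewrite mul1n le.
Qed.

Lemma card_congr_dvd (n q : nat) (S : pred 'I_n) : 0 < n -> q %| n ->
  (forall i j : 'I_n, S i -> S j -> i = j %[mod q]) -> #|S| <= n %/ q.
Proof.
move=> n0 qn cong; have q0 := dvdn_gt0 n0 qn.
apply: leq_trans (card_congr_le q0 cong) _.
have [m mE] := dvdnP qn; rewrite mE mulnK // addn1.
have m0 : 0 < m by move: n0; rewrite mE; case: (m).
rewrite -(prednK m0) ltnS -ltnS prednK // ltn_divLR // -mE.
by rewrite prednK.
Qed.

End Divisors.

Lemma eqn_mod_int (i j q : nat) : (q%:Z %| i%:Z - j%:Z)%Z -> i = j %[mod q].
Proof. by rewrite -eqz_mod_dvd !modz_nat => /eqP[]. Qed.

(** For r = gcd(x - 1, q) one has r | x - 1 and q/r | x + 1, which fixes x modulo L = lcm(r, q/r).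
    The gcd of r and q/r divides the difference 2, so q | 2 L. *)
Lemma card_sqrt1 (n q : nat) : (0 < n)%N -> (q %| n)%N ->
  (#|[pred x : 'I_n | (q%:Z %| (x%:Z ^+ 2 - 1)%R)%Z]| <= size (divisors q) * (2 * (n %/ q)))%N.
Proof.
move=> n0 qn; have q0 := dvdn_gt0 n0 qn.
apply: (card_le_fibers (f := fun x : 'I_n => gcdn `|x%:Z - 1|%N q)) => [x _|r rq].
  by rewrite -dvdn_divisors // dvdn_gcdr.
rewrite -dvdn_divisors // in rq; have r0 := dvdn_gt0 q0 rq.
set S := [pred x | _]; have [x0 Sx0|none] := pickP S; last by rewrite eq_card0.
set L := lcmn r (q %/ r)%N.
have key (x : 'I_n) : S x -> (r%:Z %| x%:Z - 1)%Z /\ ((q %/ r)%N%:Z %| x%:Z + 1)%Z.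
  rewrite inE => /andP[sx /eqP gE]; split.
    by rewrite dvdzE /= -gE dvdn_gcdl.
  have rx : (r %| `|x%:Z - 1|%N)%N by rewrite -gE dvdn_gcdl.
  have cop : coprime (q %/ r)%N (`|x%:Z - 1|%N %/ r)%N.
    rewrite /coprime -(eqn_pmul2r r0) muln_gcdl !divnK // mul1n gcdnC.
    exact/eqP.
  rewrite dvdzE /= -(Gauss_dvdr _ cop) -(dvdn_pmul2r (p := r)) // divnK //.
  rewrite mulnAC divnK //.
  rewrite -[(x + 1)%N]/`|(x%:Z + 1)%R|%N -abszM; move: sx => /=; congr (_ %| `|_|)%N; ring.
have Lq : (q %| 2 * L)%N.
  have [d1 d2] := key _ Sx0.
  have d3 : (gcdn r (q %/ r) %| 2)%N.
    have : ((gcdn r (q %/ r)%N)%:Z %| (x0%:Z + 1) - (x0%:Z - 1))%Z.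
      apply: rpredB.
        by apply: dvdz_trans d2; rewrite dvdzE /= dvdn_gcdr.
      by apply: dvdz_trans d1; rewrite dvdzE /= dvdn_gcdl.
    have -> : (x0%:Z + 1) - (x0%:Z - 1) = 2 by ring.
    by rewrite dvdzE.
  have gL : (L * gcdn r (q %/ r) = q)%N by rewrite muln_lcm_gcd mulnC divnK.
  by rewrite -{1}gL mulnC dvdn_mul.
have Ldq : (L %| q)%N by rewrite dvdn_lcm rq dvdn_div.
have L0 := dvdn_gt0 q0 Ldq.
apply: leq_trans (card_congr_dvd n0 (dvdn_trans Ldq qn) _) _ => [i j Si Sj|].
  have [di di'] := key _ Si; have [dj dj'] := key _ Sj.
  apply: eqn_mod_int; rewrite dvdzE /= dvdn_lcm; apply/andP; split.
    have -> : i%:Z - j%:Z = (i%:Z - 1) - (j%:Z - 1) by ring.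
    by rewrite -[(_ %| _)%N]/(r%:Z %| _)%Z rpredB.
  have -> : i%:Z - j%:Z = (i%:Z + 1) - (j%:Z + 1) by ring.
  by rewrite -[(_ %| _)%N]/((q %/ r)%N%:Z %| _)%Z rpredB.
have [w wE] := dvdnP qn.
rewrite {2}wE mulnK // leq_divLR ?(dvdn_trans Ldq) // wE -mulnA mulnCA leq_mul2l.
by rewrite dvdn_leq ?orbT // muln_gt0.
Qed.

(* For fixed [r = gcd(s, q)], [q / r] must divide [a beta + s alpha]; since
   [gcd(alpha, beta, q) = 1] this forces [s] into a class and then [a] into a class,
   and the total is [c g gcd(r, gcd(beta, q / r))], where that gcd has square dividing [q]. *)
Lemma card_linear_pairs (c g al be S0 : nat) : (0 < c)%N -> (g %| c)%N ->
  coprime (gcdn al be) (c %/ g) ->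
  (forall t, (t ^ 2 %| c %/ g)%N -> (t <= S0)%N) ->
  (#|[pred x : 'I_c * 'I_c | (c %/ g %| x.2 * (x.1 * be + x.2 * al))%N]| <=
   size (divisors (c %/ g)) * (c * g * S0))%N.
Proof.
move=> c0 gc cop sqS; set q := (c %/ g)%N.
have g0 := dvdn_gt0 c0 gc; have qc : (q %| c)%N by rewrite dvdn_div.
have q0 := dvdn_gt0 c0 qc.
apply: (card_le_fibers (f := fun x : 'I_c * 'I_c => gcdn x.2 q)) => [x _|r rq].
  by rewrite -dvdn_divisors // dvdn_gcdr.
rewrite -dvdn_divisors // in rq; have r0 := dvdn_gt0 q0 rq.
set q2 := (q %/ r)%N; set h := gcdn be q2.
have qE : (q = r * q2)%N by rewrite /q2 mulnC divnK.
have q20 : (0 < q2)%N by move: q0; rewrite qE muln_gt0 => /andP[].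
have h0 : (0 < h)%N by rewrite gcdn_gt0 q20 orbT.
have hq2 : (h %| q2)%N by rewrite dvdn_gcdr.
set L := lcmn r h.
have key (x : 'I_c * 'I_c) : (q %| x.2 * (x.1 * be + x.2 * al))%N -> gcdn x.2 q = r ->
   (L %| x.2)%N /\ (q2 %| x.1 * be + x.2 * al)%N.
  move=> dq gE; have rx : (r %| x.2)%N by rewrite -gE dvdn_gcdl.
  have d2 : (q2 %| x.1 * be + x.2 * al)%N.
    have cop2 : coprime q2 (x.2 %/ r)%N.
      rewrite /coprime -(eqn_pmul2r r0) muln_gcdl !divnK // mul1n gcdnC.
      by rewrite gE.
    rewrite -(Gauss_dvdr _ cop2) -(dvdn_pmul2l r0) -qE mulnA.
    by rewrite [(r * _)%N]mulnC divnK.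
  split=> //; rewrite dvdn_lcm rx /=.
  (* As h divides both be and q, coprimality of al, be and q makes it prime to al. *)
  have cop3 : coprime h al.
    rewrite /coprime -dvdn1 -(eqP cop) !dvdn_gcd dvdn_gcdr /=.
    rewrite (dvdn_trans (dvdn_gcdl _ _)) ?dvdn_gcdl //=.
    rewrite (dvdn_trans (dvdn_gcdl _ _)) // (dvdn_trans hq2) //.
    by rewrite -/q qE dvdn_mull.
  rewrite -(Gauss_dvdl _ cop3) -(dvdn_addr (m := (x.1 * be)%N)).
    exact: dvdn_trans hq2 d2.
  by rewrite dvdn_mull // dvdn_gcdl.
have Lq : (L %| c)%N.
  by apply: dvdn_trans qc; rewrite dvdn_lcm rq (dvdn_trans hq2) // qE dvdn_mull.
have wc : (q2 %/ h %| c)%N.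
  by apply: dvdn_trans qc; rewrite (dvdn_trans (dvdn_div hq2)) // qE dvdn_mull.
apply: (@leq_trans (\sum_(s : 'I_c | (L %| s)%N) (c %/ (q2 %/ h)))%N).
  rewrite -sum1_card big_mkcond /=.
  rewrite -(pair_bigA _ (fun a s => if (a, s) \in [pred x : 'I_c * 'I_c |
    (q %| x.2 * (x.1 * be + x.2 * al))%N && (gcdn x.2 q == r)] then 1%N else 0%N)) /=.
  rewrite exchange_big /= [leqRHS]big_mkcond /=; apply: leq_sum => s _.
  have [Ls|nLs] := boolP (L %| s)%N; last first.
    rewrite big1 // => a _; case: ifP => //; rewrite inE => /andP[dq /eqP gE].
    by have [] := key (a, s) dq gE => /= Ls; rewrite Ls in nLs.
  rewrite -big_mkcond sum1_card /=.
  apply: (@leq_trans #|[pred a : 'I_c | (q2 %| a * be + s * al)%N]|).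
    apply: subset_leq_card; apply/subsetP => a; rewrite !inE => /andP[dq /eqP gE].
    by have [] := key (a, s) dq gE.
  apply: card_congr_dvd => // i j; rewrite !inE => di dj.
  have cop4 : coprime (q2 %/ h)%N (be %/ h)%N.
    rewrite /coprime -(eqn_pmul2r h0) muln_gcdl !divnK ?dvdn_gcdl // mul1n.
    by rewrite gcdnC.
  have step (i' j' : nat) : (j' <= i')%N -> (q2 %| i' * be + s * al)%N ->
      (q2 %| j' * be + s * al)%N -> i' = j' %[mod q2 %/ h].
    move=> ji di' dj'; apply/eqP; rewrite eqn_mod_dvd //.
    rewrite -(Gauss_dvdl _ cop4) -(dvdn_pmul2r h0) divnK // -mulnA divnK ?dvdn_gcdl //.
    have -> : ((i' - j') * be = (i' * be + s * al) - (j' * be + s * al))%N.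
      by rewrite subnDr mulnBl.
    by rewrite dvdn_sub.
  have [ij|ji] := leqP i j; last exact: step (ltnW ji) di dj.
  by apply/esym/step.
rewrite sum_nat_const.
have le : (#|[pred s : 'I_c | (L %| s)%N]| <= c %/ L)%N.
  apply: card_congr_dvd => // i j; rewrite !inE => /eqP di /eqP dj.
  by rewrite di dj.
apply: leq_trans (leq_mul le (leqnn _)) _.
set t := gcdn r h; have tE : (L * t = r * h)%N by rewrite muln_lcm_gcd.
have t0 : (0 < t)%N by rewrite gcdn_gt0 r0.
have tS : (t <= S0)%N.
  apply: sqS; rewrite -/q qE expnS expn1 dvdn_mul ?dvdn_gcdl //.
  by apply: dvdn_trans hq2; rewrite dvdn_gcdr.
set w := (q2 %/ h)%N; have wE : (q2 = w * h)%N by rewrite divnK.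
have L0 : (0 < L)%N by rewrite lcmn_gt0 r0.
have -> : (c %/ L = g * t * w)%N.
  apply/esym/eqP; rewrite eqn_div //; apply/eqP.
  have -> : (c = g * q)%N by rewrite /q mulnC divnK.
  rewrite qE wE; transitivity (g * w * (L * t))%N; first by ring.
  by rewrite tE; ring.
have -> : (g * t * w * (c %/ w) = c * g * t)%N.
  have cE : (c %/ w * w = c)%N by rewrite divnK.
  by rewrite -{2}cE; ring.
by rewrite leq_mul2l tS orbT.
Qed.

(** * Solutions of the word congruences in short intervals *)

Definition centered (n : nat) (i : 'I_(2 * n)) : int := i%:Z - n%:Z.

Lemma centered_inj n : injective (@centered n).
Proof. by move=> i j /addIr [] /val_inj. Qed.

Lemma centered_bound n (i : 'I_(2 * n)) : (`|centered i| <= n)%N.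
Proof. by rewrite /centered; have := ltn_ord i; lia. Qed.

Lemma sum_bool_card (T : finType) (b : T -> bool) : (\sum_x b x = #|[pred x | b x]|)%N.
Proof. by rewrite -sum1_card [RHS]big_mkcond; apply: eq_bigr => x _; rewrite inE; case: (b x). Qed.

Lemma dvdn_div_gcd (q A D : nat) : (0 < q)%N -> (q %| A * D)%N -> (q %/ gcdn A q %| D)%N.
Proof.
move=> q0 dq; have g0 : (0 < gcdn A q)%N by rewrite gcdn_gt0 q0 orbT.
have cop : coprime (q %/ gcdn A q) (A %/ gcdn A q).
  by rewrite /coprime -(eqn_pmul2r g0) muln_gcdl !divnK ?dvdn_gcdl ?dvdn_gcdr // mul1n gcdnC.
rewrite -(Gauss_dvdr _ cop) -(dvdn_pmul2r g0) divnK ?dvdn_gcdr //.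
by rewrite mulnAC divnK ?dvdn_gcdl.
Qed.

Section WordEquations.
Variables (q H K T : nat) (a lam : int).
Hypotheses (q0 : (0 < q)%N) (H0 : (0 < H)%N) (K0 : (0 < K)%N).
Hypotheses (acop : coprimez q%:Z a) (lamcop : coprimez q%:Z lam).
Hypothesis divT : forall m, (0 < m <= H * K)%N -> (size (divisors m) <= T)%N.
Hypothesis divqT : (size (divisors q) <= T)%N.

Local Notation IH := 'I_(2 * H).
Local Notation IK := 'I_(2 * K).
Let cprod (x : IH * IK) : int := centered x.1 * centered x.2.

Let cprod_bound x : (`|cprod x| <= H * K)%N.
Proof. by rewrite /cprod abszM leq_mul ?centered_bound. Qed.

(** The first factor is a divisor of n up to sign, and it determines the second because n is
    nonzero. *)
Lemma card_product_fiber (n : int) : n != 0 -> (#|[pred x | cprod x == n]| <= T * 2)%N.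
Proof.
move=> n0; have [x0|none] := pickP [pred x | cprod x == n]; last by rewrite eq_card0.
rewrite inE => /eqP x0n.
have nb : (0 < `|n| <= H * K)%N by rewrite absz_gt0 n0 -x0n cprod_bound.
apply: leq_trans (leq_mul (divT nb) (leqnn 2)).
apply: (card_le_fibers (f := fun x : IH * IK => `|centered x.1|%N)) => [x|r rn].
  rewrite inE => /eqP xn; rewrite -dvdn_divisors; first by rewrite -xn abszM dvdn_mulr.
  by rewrite absz_gt0.
pose f (x : IH * IK) := (centered x.1 < 0).
have inj : {in [pred x : IH * IK | (x \in [pred x | cprod x == n]) &&
    (`|centered x.1|%N == r)] &, injective f}.
  move=> [i j] [i' j']; rewrite !inE /cprod /= => /andP[/eqP e1 /eqP e2] /andP[/eqP e3 /eqP e4].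
  rewrite /f /= => e5.
  have ii : centered i = centered i' by move: e2 e4 e5; case: ltP; case: ltP; lia.
  have i0 : centered i != 0 by apply: contraNneq n0 => ie; rewrite -e1 ie mul0r.
  have jj : centered j = centered j' by apply: (mulfI i0); rewrite e1 {1}ii.
  by rewrite (centered_inj ii) (centered_inj jj).
by rewrite -(card_in_image inj) (leq_trans (max_card _)) ?card_bool.
Qed.

(** The products lie in [- H K, H K], an interval of 2 H K + 1 integers, which contains at most 2 H
    K / q' + 1 members of a class modulo q'. *)
Lemma card_product_class (P : pred int) (q' : nat) : (0 < q')%N ->
  (forall n n', P n -> P n' -> (q'%:Z %| n - n')%Z) ->
  (#|[pred x | (cprod x != 0) && P (cprod x)]| <= (2 * H * K %/ q' + 1) * (T * 2))%N.
Proof.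
move=> q'0 cong; pose m := (H * K)%N.
pose S := [pred t : 'I_(2 * m).+1 | P (t%:Z - m%:Z)].
have leS : (#|S| <= 2 * H * K %/ q' + 1)%N.
  rewrite -mulnA -/m; apply: (card_congr_le (n := (2 * m).+1)) => //.
  move=> i j Pi Pj; apply: eqn_mod_int.
  by have := cong _ _ Pi Pj; congr (_ %| _)%Z; ring.
apply: leq_trans (leq_mul leS (leqnn _)).
rewrite [#|S|]cardE -(size_map val).
have shift x : `|(cprod x + m%:Z)%R|%N%:Z = cprod x + m%:Z.
  by have := cprod_bound x; rewrite -/m; lia.
apply: (card_le_fibers (f := fun x => `|(cprod x + m%:Z)%R|%N)) => [x|r rs].
  rewrite inE => /andP[x0 Px].
  have lt : (`|(cprod x + m%:Z)%R|%N < (2 * m).+1)%N by have := cprod_bound x; rewrite -/m; lia.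
  apply/mapP; exists (Ordinal lt) => //; rewrite mem_enum inE /=.
  by rewrite shift addrK.
have [x0|none] := pickP [pred x | (x \in [pred x | (cprod x != 0) && P (cprod x)]) &&
  (`|(cprod x + m%:Z)%R|%N == r)]; last by rewrite eq_card0.
rewrite !inE => /andP[/andP[n0 _] /eqP r0].
apply: leq_trans (card_product_fiber n0); apply: subset_leq_card; apply/subsetP => x.
rewrite !inE => /andP[_ /eqP rx]; apply/eqP; apply: (addIr m%:Z).
by rewrite -(shift x) -(shift x0) rx r0.
Qed.

Lemma card_product_zero : (#|[pred x | cprod x == 0%R]| <= 2 * K + 2 * H)%N.
Proof.
apply: (@leq_trans (#|[pred x : IH * IK | centered x.1 == 0]| +
   #|[pred x : IH * IK | centered x.2 == 0]|)).
  rewrite -cardUI; apply: leq_trans (leq_addr _ _); apply: subset_leq_card.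
  by apply/subsetP => x; rewrite !inE mulf_eq0.
apply: leq_add.
  have inj : {in [pred x : IH * IK | centered x.1 == 0] &, injective snd}.
    move=> [i j] [i' j']; rewrite !inE /= => /eqP e1 /eqP e2 ->.
    by rewrite (centered_inj (etrans e1 (esym e2))).
  by rewrite -(card_in_image inj) (leq_trans (max_card _)) ?card_ord.
have inj : {in [pred x : IH * IK | centered x.2 == 0] &, injective fst}.
  move=> [i j] [i' j']; rewrite !inE /= => /eqP e1 /eqP e2 ->.
  by rewrite (centered_inj (etrans e1 (esym e2))).
by rewrite -(card_in_image inj) (leq_trans (max_card _)) ?card_ord.
Qed.

(* Entrywise congruence modulo q of [U h1 L k1 U h2] and [lam L k2 U h3 L k3],
   where [U h = [[1, a h], [0, 1]]] and [L k = [[1, 0], [k, 1]]]. *)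
Definition word_congr (h1 k1 h2 k2 h3 k3 : int) : bool :=
  [&& (q%:Z %| (1 + a * h1 * k1) - lam * (1 + a * h3 * k3))%Z,
      (q%:Z %| a * (h2 * (1 + a * h1 * k1) + h1) - lam * (a * h3))%Z,
      (q%:Z %| k1 - lam * (k2 * (1 + a * h3 * k3) + k3))%Z &
      (q%:Z %| (1 + a * h2 * k1) - lam * (1 + a * h3 * k2))%Z].

(** The congruence of the upper left entries, which involves only the products n = h1 k1 and n' = h3
    k3. *)
Let E1 (n n' : int) := (q%:Z %| (1 + a * n) - lam * (1 + a * n'))%Z.
Let s (n : int) : nat := gcdn `|(1 + a * n)%R|%N q.
(** With h1, k1, h3, k3 fixed, [kap] will bound the choices of k2 and [eta] those of h2. *)
Let kap (r : nat) : nat := (2 * K %/ (q %/ r) + 1)%N.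
Let eta : nat := (2 * H %/ q + 1)%N.

Let s_dvd n : (s n %| q)%N. Proof. exact: dvdn_gcdr. Qed.

(** Since lam (1 + a h3 k3) = 1 + a h1 k1 modulo q, the lower left entry fixes k2 modulo q / s. With
    k2 given, subtracting a h1 times the lower right congruence from the upper right one isolates a
    h2, so h2 is fixed modulo q. *)
Let sum_last (x y : IH * IK) :
  (\sum_(k2 : IK) \sum_(h2 : IH) word_congr (centered x.1) (centered x.2) (centered h2)
     (centered k2) (centered y.1) (centered y.2) <= E1 (cprod x) (cprod y) * (kap (s (cprod x)) * eta))%N.
Proof.
set h1 := centered x.1; set k1 := centered x.2; set h3 := centered y.1; set k3 := centered y.2.
have hx : 1 + a * cprod x = 1 + a * h1 * k1 by rewrite mulrA.
have hy : 1 + a * cprod y = 1 + a * h3 * k3 by rewrite mulrA.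
have [e1|ne1] := boolP (E1 (cprod x) (cprod y)); last first.
  rewrite mul0n leqn0 big1 // => k2 _; rewrite big1 // => h2 _.
  by rewrite /word_congr -hx -hy -/(E1 _ _) (negPf ne1).
rewrite mul1n.
pose S := [pred k2 : IK | (q%:Z %| k1 - lam * (centered k2 * (1 + a * h3 * k3) + k3))%Z].
apply: (@leq_trans (\sum_(k2 | S k2) eta)); last first.
  rewrite sum_nat_const leq_mul2r; apply/orP; right.
  have qs0 : (0 < q %/ s (cprod x))%N.
    rewrite divn_gt0; first exact: dvdn_leq q0 (s_dvd _).
    exact: dvdn_gt0 q0 (s_dvd _).
  apply: leq_trans (card_congr_le qs0 _) _.
    move=> i j Si Sj; apply: eqn_mod_int.
    have Si' : (q%:Z %| k1 - lam * (centered i * (1 + a * h3 * k3) + k3))%Z by exact: Si.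
    have Sj' : (q%:Z %| k1 - lam * (centered j * (1 + a * h3 * k3) + k3))%Z by exact: Sj.
    apply: dvdn_div_gcd => //; rewrite -abszM -[(_ %| _)%N]/(q%:Z %| _)%Z.
    have := rpredB (rpredB Sj' Si') (dvdz_mulr (centered j - centered i) e1).
    by congr (_ %| _)%Z; rewrite hx hy /centered; ring.
  by rewrite leq_add2r leq_div2r // leq_pred.
rewrite [leqRHS]big_mkcond /=; apply: leq_sum => k2 _.
case: ifP => Sk; last first.
  rewrite big1 // => h2 _; apply/eqP; rewrite eqb0 /word_congr.
  by move: Sk; rewrite /S /= -/h1 => ->; rewrite !andbF.
rewrite sum_bool_card.
apply: leq_trans (card_congr_le q0 _) _; last by rewrite leq_add2r leq_div2r // leq_pred.
move=> i j Wi Wj; apply: eqn_mod_int.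
have /and4P[_ i2 _ i4] : word_congr h1 k1 (centered i) (centered k2) h3 k3 by exact: Wi.
have /and4P[_ j2 _ j4] : word_congr h1 k1 (centered j) (centered k2) h3 k3 by exact: Wj.
rewrite -(Gauss_dvdzr _ acop).
have := rpredB (rpredB i2 j2) (dvdz_mull (a * h1) (rpredB i4 j4)).
by congr (_ %| _)%Z; rewrite /centered; ring.
Qed.

Let R' : nat := ((2 * H * K %/ q + 1) * (T * 2))%N.
Let Z : nat := (2 * K + 2 * H)%N.

Let row_count (n : int) : (#|[pred y | (cprod y != 0%R) && E1 n (cprod y)]| <= R')%N.
Proof.
apply: card_product_class => // m m' e e'.
rewrite -(Gauss_dvdzr _ acop) -(Gauss_dvdzr _ lamcop).
by have := rpredB e' e; congr (_ %| _)%Z; ring.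
Qed.

Let col_count (n : int) : (#|[pred x | (cprod x != 0%R) && E1 (cprod x) n]| <= R')%N.
Proof.
apply: (card_product_class (P := fun m => E1 m n)) => // m m' e e'.
rewrite -(Gauss_dvdzr _ acop).
by have := rpredB e e'; congr (_ %| _)%Z; ring.
Qed.

Let s0 : s 0 = 1%N. Proof. by rewrite /s mulr0 addr0 gcd1n. Qed.

Let s_unit n : E1 n 0 -> s n = 1%N.
Proof.
rewrite /E1 mulr0 addr0 mulr1 /s => e; apply/eqP; rewrite -dvdn1.
rewrite -(eqP (lamcop : gcdn q `|lam| == 1%N)) dvdn_gcd dvdn_gcdr /=.
have -> : lam = (1 + a * n) - ((1 + a * n) - lam) by ring.
rewrite -[(_ %| _)%N]/((gcdn `|(1 + a * n)%R| q)%:Z %| _)%Z rpredB //.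
  by rewrite dvdzE /= dvdn_gcdl.
by apply: dvdz_trans e; rewrite dvdzE /= dvdn_gcdr.
Qed.

(** Pairs are split according to whether h1 k1 or h3 k3 vanishes, since the divisor bound says
    nothing about the fibre over 0; in those cases s = 1. When both are nonzero, h1 k1 is sorted by
    r = s: the relation r | 1 + a h1 k1 fixes it modulo r, which offsets the growth of [kap r]. *)
Let quad_sum : (\sum_(x : IH * IK) \sum_(y : IH * IK) E1 (cprod x) (cprod y) * kap (s (cprod x))
  <= (\sum_(r <- divisors q) kap r * ((2 * H * K %/ r + 1) * (T * 2))) * R'
     + Z * (R' + Z) * kap 1 + Z * R' * kap 1)%N.
Proof.
have part (b : bool) (x y : IH * IK) := b.
pose t1 x y : nat := ((cprod x != 0) && (cprod y != 0) && E1 (cprod x) (cprod y) : bool).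
pose t2 x y : nat := ((cprod x == 0) && E1 (cprod x) (cprod y) : bool).
pose t3 x y : nat := ((cprod x != 0) && (cprod y == 0) && E1 (cprod x) (cprod y) : bool).
apply: (@leq_trans (\sum_x \sum_y (t1 x y * kap (s (cprod x)) + t2 x y * kap 1 + t3 x y * kap 1))).
  apply: leq_sum => x _; apply: leq_sum => y _; rewrite /t1 /t2 /t3.
  have [e|_] := boolP (E1 _ _); last by rewrite mul0n.
  have [x0|x0] := eqVneq (cprod x) 0; first by rewrite x0 s0 /= !mul0n !addn0.
  have [y0|y0] := eqVneq (cprod y) 0; last by rewrite /= !mul0n !addn0.
  by rewrite y0 in e *; rewrite (s_unit e).
under eq_bigr do rewrite !big_split /=.
rewrite !big_split /=; apply: leq_add; first apply: leq_add.
- under eq_bigr do rewrite -big_distrl /=.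
  apply: (@leq_trans (\sum_(x | cprod x != 0) kap (s (cprod x)) * R')).
    rewrite [leqRHS]big_mkcond /=; apply: leq_sum => x _; rewrite /t1.
    case: ifP => [x0|]; last by move=> /negbFE/eqP x0; rewrite x0 big1 // mul0n.
    rewrite mulnC leq_mul2l; apply/orP; right.
    rewrite sum_bool_card; apply: leq_trans (row_count (cprod x)).
    by apply: subset_leq_card; apply/subsetP => y; rewrite !inE => /andP[/andP[_ ->] ->].
  rewrite -big_distrl leq_mul2r /=; apply/orP; right.
  apply: (@leq_trans (\sum_(x : IH * IK) \sum_(r <- divisors q)
      ((cprod x != 0) && (s (cprod x) == r) : bool) * kap r)).
    rewrite [leqLHS]big_mkcond /=; apply: leq_sum => x _; case: ifP => // x0.
    have sd : s (cprod x) \in divisors q by rewrite -dvdn_divisors.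
    by rewrite (big_rem _ sd) /= eqxx mul1n leq_addr.
  rewrite exchange_big /= big_seq [leqRHS]big_seq; apply: leq_sum => r.
  rewrite -dvdn_divisors // => rq; rewrite -big_distrl /= mulnC leq_mul2l; apply/orP; right.
  rewrite sum_bool_card; have r0 := dvdn_gt0 q0 rq.
  apply: leq_trans (card_product_class (P := fun n => (r%:Z %| 1 + a * n)%Z) r0 _).
    apply: subset_leq_card; apply/subsetP => x; rewrite !inE => /andP[-> /eqP <-] /=.
    by rewrite dvdzE /= dvdn_gcdl.
  move=> n n' dn dn'; have racop : coprimez r%:Z a.
    by rewrite coprimezE; apply: coprime_dvdl rq acop.
  rewrite -(Gauss_dvdzr _ racop).
  by have := rpredB dn dn'; congr (_ %| _)%Z; ring.
- under eq_bigr do rewrite -big_distrl /=.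
  rewrite -big_distrl leq_mul2r /=; apply/orP; right.
  apply: (@leq_trans (\sum_(x | cprod x == 0) (R' + Z))).
    rewrite [leqRHS]big_mkcond /=; apply: leq_sum => x _; rewrite /t2.
    case: ifP => [x0|x0]; last by rewrite big1.
    rewrite sum_bool_card.
    apply: (@leq_trans (#|[pred y | (cprod y != 0%R) && E1 (cprod x) (cprod y)]| +
       #|[pred y | cprod y == 0%R]|)); last by rewrite leq_add ?row_count ?card_product_zero.
    rewrite -cardUI; apply: leq_trans (leq_addr _ _); apply: subset_leq_card.
    by apply/subsetP => y; rewrite !inE => /andP[_ ->]; rewrite andbT orNb.
  by rewrite sum_nat_const leq_mul2r card_product_zero orbT.
under eq_bigr do rewrite -big_distrl /=.
rewrite -big_distrl leq_mul2r /=; apply/orP; right.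
rewrite exchange_big /=.
apply: (@leq_trans (\sum_(y | cprod y == 0) R')).
  rewrite [leqRHS]big_mkcond /=; apply: leq_sum => y _; rewrite /t3.
  case: ifP => [y0|y0]; last first.
    rewrite big1 // => x _; apply/eqP; rewrite eqb0; apply/negP => /andP[/andP[_ y1] _].
    by case/negP: (negbT y0).
  rewrite sum_bool_card; apply: leq_trans (col_count (cprod y)).
  by apply: subset_leq_card; apply/subsetP => x; rewrite !inE => /andP[/andP[-> _] ->].
by rewrite sum_nat_const leq_mul2r card_product_zero orbT.
Qed.

Lemma word_congr_count_nat :
  (\sum_(x : IH * IK) \sum_(y : IH * IK) \sum_(k2 : IK) \sum_(h2 : IH)
     word_congr (centered x.1) (centered x.2) (centered h2) (centered k2)
       (centered y.1) (centered y.2) <=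
   ((\sum_(r <- divisors q) kap r * ((2 * H * K %/ r + 1) * (T * 2))) * R'
     + Z * (R' + Z) * kap 1 + Z * R' * kap 1) * eta)%N.
Proof.
apply: leq_trans (leq_mul quad_sum (leqnn eta)).
rewrite big_distrl /=; apply: leq_sum => x _; rewrite big_distrl /=; apply: leq_sum => y _.
by rewrite -mulnA; apply: sum_last.
Qed.

(** With h = H/q, k = K/q and y = H K/q the natural-number bound is polynomial, and the three terms
    of the conclusion are K^2, K^2 y and y^3. The inequalities 1 <= H <= K absorb every mixed term
    into these. *)
Lemma word_congr_count (R : realFieldType) : (H <= K)%N -> (0 < T)%N ->
  (\sum_(x : IH * IK) \sum_(y : IH * IK) \sum_(k2 : IK) \sum_(h2 : IH)
     word_congr (centered x.1) (centered x.2) (centered h2) (centered k2)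
       (centered y.1) (centered y.2))%:R <=
  1216 * T%:R ^+ 3 * (K%:R ^+ 2 + H%:R * K%:R ^+ 3 / q%:R + H%:R ^+ 3 * K%:R ^+ 3 / q%:R ^+ 3) :> R.
Proof.
move=> HK T0.
have leN : forall m n : nat, (m <= n)%N -> m%:R <= n%:R :> R by move=> m n; rewrite ler_nat.
apply: le_trans (leN _ _ word_congr_count_nat) _.
set Hr : R := H%:R; set Kr : R := K%:R; set qr : R := q%:R; set Tr : R := T%:R.
have [H1 K1 q1 T1] : [/\ 1 <= Hr, 1 <= Kr, 1 <= qr & 1 <= Tr].
  by split; rewrite ler1n.
have HKr : Hr <= Kr by rewrite ler_nat.
have [h hE] : exists h, h = Hr / qr by exists (Hr / qr).
have [k kE] : exists k, k = Kr / qr by exists (Kr / qr).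
have [y yE] : exists y, y = Hr * Kr / qr by exists (Hr * Kr / qr).
have qn0 : qr != 0 by rewrite gt_eqF // (lt_le_trans ltr01).
have [h0 k0 y0] : [/\ 0 <= h, 0 <= k & 0 <= y].
  by rewrite hE kE yE; split; rewrite ?divr_ge0 ?mulr_ge0 ?ler0n.
have divle (m d : nat) : (m %/ d)%:R <= m%:R / d%:R :> R.
  have [->|d0] := posnP d; first by rewrite divn0 divr_ge0.
  by rewrite ler_pdivlMr ?ltr0n // -natrM ler_nat leq_trunc_div.
have eta_le : eta%:R <= 2 * (h + 1).
  rewrite /eta natrD; have := divle (2 * H)%N q; rewrite natrM -/Hr -/qr => le.
  have -> : 2 * (h + 1) = 2 * Hr / qr + 2 by rewrite hE; ring.
  by move: le; lra.
have kap_le r : (r %| q)%N -> (kap r)%:R <= 2 * Kr * r%:R / qr + 1.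
  move=> rq; have r0 := dvdn_gt0 q0 rq; rewrite /kap natrD lerD2r.
  apply: le_trans (divle _ _) _; rewrite natrM -/Kr.
  have -> : (q %/ r)%:R = qr / r%:R :> R.
    by rewrite /qr -{2}(divnK rq) natrM mulfK // pnatr_eq0 -lt0n.
  by rewrite invf_div mulrA.
have kap1_le : (kap 1)%:R <= 2 * (k + 1).
  have := kap_le 1%N (dvd1n _); rewrite mulr1.
  have -> : 2 * (k + 1) = 2 * Kr / qr + 2 by rewrite kE; ring.
  by lra.
have R'_le : R'%:R <= 4 * Tr * (y + 1).
  rewrite /R' natrM natrD natrM -/Tr; have := divle (2 * H * K)%N q.
  rewrite !natrM -/Hr -/Kr -/qr => le.
  have -> : 4 * Tr * (y + 1) = (2 * Hr * Kr / qr + 2) * (Tr * 2) by rewrite yE; ring.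
  by apply: ler_wpM2r; [lra | move: le; lra].
have Z_le : Z%:R <= 4 * Kr by rewrite /Z natrD !natrM -/Kr -/Hr; lra.
have HK1 : Kr <= Hr * Kr by rewrite ler_peMl //; lra.
have sum_le : (\sum_(r <- divisors q) kap r * ((2 * H * K %/ r + 1) * (T * 2)))%:R <=
    Tr * (5 * (Hr * Kr) * (k + 1) * (Tr * 2)).
  rewrite natr_sum; apply: (@le_trans _ _ (\sum_(r <- divisors q) (5 * (Hr * Kr) * (k + 1) * (Tr * 2)))).
    rewrite big_seq [leRHS]big_seq; apply: ler_sum => r; rewrite -dvdn_divisors // => rq.
    have r0 := dvdn_gt0 q0 rq.
    rewrite mulnA !natrM ler_wpM2r ?mulr_ge0 //.
    have le1 := kap_le r rq; have := divle (2 * H * K)%N r; rewrite !natrM -/Hr -/Kr => le2.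
    set rr : R := r%:R in le1 le2.
    have r1 : 1 <= rr by rewrite ler1n.
    have rq' : rr <= qr by rewrite ler_nat dvdn_leq.
    have rn0 : rr != 0 by rewrite gt_eqF // (lt_le_trans ltr01).
    apply: (le_trans (ler_pM _ _ le1 (_ : _ <= 2 * Hr * Kr / rr + 1))) => //.
      by rewrite natrD lerD2r.
    have -> : (2 * Kr * rr / qr + 1) * (2 * Hr * Kr / rr + 1) =
       4 * (Hr * Kr * k) + 2 * Kr * (rr / qr) + 2 * (Hr * Kr) * rr^-1 + 1.
      by rewrite kE; field; rewrite rn0 qn0.
    have f1 : rr / qr <= 1 by rewrite ler_pdivrMr ?mul1r // (lt_le_trans ltr01).
    have f2 : rr^-1 <= 1 by rewrite invf_le1 // (lt_le_trans ltr01).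
    have g1 : 2 * Kr * (rr / qr) <= 2 * Kr by rewrite ler_piMr //; lra.
    have g2 : 2 * (Hr * Kr) * rr^-1 <= 2 * (Hr * Kr) by rewrite ler_piMr //; lra.
    have g3 : 0 <= Hr * Kr * k by rewrite !mulr_ge0 ?ler0n.
    have -> : 5 * (Hr * Kr) * (k + 1) = 5 * (Hr * Kr * k) + 5 * (Hr * Kr) by ring.
    by move: g1 g2 g3; lra.
  rewrite big_const_seq count_predT iter_addr_0 -[leLHS]mulr_natl ler_wpM2r ?ler_nat //.
  by rewrite !mulr_ge0 ?ler0n ?addr_ge0.
have T0r : 0 <= Tr by lra.
move: R'_le Z_le kap1_le sum_le eta_le.
move: R' Z (kap 1) eta (\sum_(r <- divisors q) _)%N => rn zn kn en sn.
move=> R'_le Z_le kap1_le sum_le eta_le.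
rewrite natrM.
set P1 := (Hr * Kr) * (k + 1) * (y + 1) * (h + 1).
set P3 := Kr ^+ 2 * (k + 1) * (h + 1).
set X := Kr ^+ 2 + Hr * Kr ^+ 3 / qr + Hr ^+ 3 * Kr ^+ 3 / qr ^+ 3.
have XE : X = Kr ^+ 2 + Kr ^+ 2 * y + y ^+ 3 by rewrite /X yE; field.
have hkE : [/\ Hr * k = y, Kr * h = y & Hr * Kr * (h * k) = y ^+ 2].
  by split; rewrite ?hE ?kE yE; field.
case: hkE => e1 e2 e3.
(* For y <= 1 the term K^2 >= 1 dominates; for y > 1 the cube does. *)
have hy : y ^+ 2 <= Kr ^+ 2 + y ^+ 3.
  have [yl|yg] := lerP y 1.
    have : y ^+ 2 <= 1 by rewrite expr_le1.
    have : 1 <= Kr ^+ 2 by rewrite expr_ge1 //; lra.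
    have : 0 <= y ^+ 3 by rewrite exprn_ge0.
    by lra.
  have : y ^+ 2 <= y ^+ 3 by rewrite [y ^+ 3]exprS ler_peMl ?sqr_ge0 // ltW.
  have : 0 <= Kr ^+ 2 by rewrite sqr_ge0.
  by lra.
have P1X : P1 <= 4 * X.
  have -> : P1 = (Hr * Kr + Kr * (Hr * k) + Hr * (Kr * h) + Hr * Kr * (h * k)) * (1 + y).
    by rewrite /P1; ring.
  rewrite e1 e2 e3 XE.
  apply: (@le_trans _ _ ((2 * Kr ^+ 2 + 2 * y ^+ 2) * (1 + y))).
    apply: ler_wpM2r; first by lra.
    have : Hr * Kr <= Kr ^+ 2 by rewrite expr2 ler_wpM2r //; lra.
    have : Hr * y <= Kr * y by rewrite ler_wpM2r.
    have : 0 <= (Kr - y) ^+ 2 by rewrite sqr_ge0.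
    have -> : (Kr - y) ^+ 2 = Kr ^+ 2 - 2 * (Kr * y) + y ^+ 2 by ring.
    by lra.
  have -> : (2 * Kr ^+ 2 + 2 * y ^+ 2) * (1 + y) =
    2 * Kr ^+ 2 + 2 * y ^+ 2 + 2 * (Kr ^+ 2 * y) + 2 * y ^+ 3 by ring.
  have : 0 <= Kr ^+ 2 * y by rewrite mulr_ge0 ?sqr_ge0.
  by move: hy; lra.
have P3X : P3 <= 3 * X.
  have -> : P3 = Kr ^+ 2 + Kr * (Kr * h) + Kr ^+ 2 * k + (Kr * h) * (Kr * k).
    by rewrite /P3; ring.
  rewrite e2 XE.
  have ky : k <= y by rewrite -e1 ler_peMl.
  have a1 : Kr ^+ 2 * k <= Kr ^+ 2 * y by rewrite ler_wpM2l ?sqr_ge0.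
  have a2 : y * (Kr * k) <= y * (Kr * y) by rewrite !ler_wpM2l //; lra.
  have a3 : Kr * y <= Kr ^+ 2 * y.
    by rewrite expr2 -mulrA ler_peMl // mulr_ge0 //; lra.
  have a4 : 0 <= y * (Kr - y) ^+ 2 by rewrite mulr_ge0 ?sqr_ge0.
  have a5 : y * (Kr - y) ^+ 2 = Kr ^+ 2 * y - 2 * (y * (Kr * y)) + y ^+ 3 by ring.
  have a6 : 0 <= Kr ^+ 2 by rewrite sqr_ge0.
  have a7 : 0 <= y ^+ 3 by rewrite exprn_ge0.
  have a8 : 0 <= Kr ^+ 2 * y by rewrite mulr_ge0.
  by move: a1 a2 a3 a4 a6 a7 a8; rewrite a5; lra.
have total : (sn * rn + zn * (rn + zn) * kn + zn * rn * kn)%N%:R <=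
    Tr * (5 * (Hr * Kr) * (k + 1) * (Tr * 2)) * (4 * Tr * (y + 1)) +
    4 * Kr * (4 * Tr * (y + 1) + 4 * Kr) * (2 * (k + 1)) +
    4 * Kr * (4 * Tr * (y + 1)) * (2 * (k + 1)).
  rewrite !natrD !natrM; apply: lerD; first apply: lerD.
  - by apply: ler_pM.
  - apply: ler_pM => //; first by rewrite mulr_ge0 ?addr_ge0.
    by apply: ler_pM; rewrite ?natrD ?addr_ge0 //; apply: lerD.
  - by apply: ler_pM; rewrite ?mulr_ge0 //; apply: ler_pM.
apply: (le_trans (ler_pM _ _ total eta_le)) => //.
have P10 : 0 <= P1 by rewrite /P1 !mulr_ge0 ?addr_ge0 ?ler0n.
have P30 : 0 <= P3 by rewrite /P3 !mulr_ge0 ?addr_ge0 ?sqr_ge0.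
have P2 : Kr * (k + 1) * (y + 1) * (h + 1) <= P1.
  by rewrite /P1 !ler_wpM2r ?addr_ge0.
have T3 : 1 <= Tr ^+ 3 by rewrite expr_ge1.
have TT3 : Tr <= Tr ^+ 3 by rewrite exprS ler_peMr // expr_ge1.
(* With P1 <= 4 X and P3 <= 3 X the total is 80 * 4 + 128 * 4 + 64 * 3 = 1024 times T^3 X, within
   the stated 1216. *)
have -> : (Tr * (5 * (Hr * Kr) * (k + 1) * (Tr * 2)) * (4 * Tr * (y + 1)) +
    4 * Kr * (4 * Tr * (y + 1) + 4 * Kr) * (2 * (k + 1)) +
    4 * Kr * (4 * Tr * (y + 1)) * (2 * (k + 1))) * (2 * (h + 1)) =
  80 * (Tr ^+ 3 * P1) + 128 * (Tr * (Kr * (k + 1) * (y + 1) * (h + 1))) + 64 * P3.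
  by rewrite /P1 /P3; ring.
have b2 : Tr * (Kr * (k + 1) * (y + 1) * (h + 1)) <= Tr ^+ 3 * P1.
  by apply: ler_pM => //; rewrite !mulr_ge0 ?addr_ge0 ?ler0n.
have b3 : P3 <= Tr ^+ 3 * P3 by rewrite ler_peMl.
have b4 : Tr ^+ 3 * P1 <= Tr ^+ 3 * (4 * X) by rewrite ler_wpM2l ?exprn_ge0.
have b5 : Tr ^+ 3 * P3 <= Tr ^+ 3 * (3 * X) by rewrite ler_wpM2l ?exprn_ge0.
have b6 : 0 <= Tr ^+ 3 * X by rewrite mulr_ge0 ?exprn_ge0 // XE !addr_ge0 ?mulr_ge0 ?sqr_ge0 ?exprn_ge0.
have -> : 1216 * Tr ^+ 3 * X = 1216 * (Tr ^+ 3 * X) by ring.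
have c4 : Tr ^+ 3 * (4 * X) = 4 * (Tr ^+ 3 * X) by ring.
have c5 : Tr ^+ 3 * (3 * X) = 3 * (Tr ^+ 3 * X) by ring.
by move: b2 b3 b4 b5 b6; rewrite c4 c5; lra.
Qed.

End WordEquations.

(** * Specialisation to the ring Z/c *)

Section ResidueRing.
Variable c' : nat.
Local Notation c := c'.+2.
Local Notation A := 'Z_c.

Lemma Zc_nat_eq0 (n : nat) : (n%:R == 0 :> A) = (c %| n)%N.
Proof. by rewrite -val_eqE /= val_Zp_nat. Qed.

Lemma Zc_int_eq0 (z : int) : (z%:~R == 0 :> A) = (c%:Z %| z)%Z.
Proof.
case: z => n; first by rewrite -pmulrn Zc_nat_eq0.
by rewrite NegzE mulrNz oppr_eq0 -pmulrn Zc_nat_eq0 dvdzE abszN.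
Qed.

(** The dictionary between ring identities scaled by c/g and congruences modulo g; with g = d it
    interprets the factor b. *)
Lemma Zc_scaled_eq0 (g : nat) (z : int) : (g %| c)%N ->
  ((c %/ g)%N%:R * z%:~R == 0 :> A) = (g%:Z %| z)%Z.
Proof.
move=> gc; rewrite (pmulrn 1 (c %/ g)%N) -intrM Zc_int_eq0.
have cg0 : (0 < c %/ g)%N.
  by rewrite divn_gt0; [apply: dvdn_leq | apply: dvdn_gt0 gc].
have cE : c%:Z = (c %/ g)%N%:Z * g%:Z by rewrite -PoszM divnK.
by rewrite -(@dvdz_mul2l (c %/ g)%N%:Z g%:Z) ?eqz_nat -?lt0n // -cE.
Qed.

Lemma Zc_val (x : A) : x = (val x)%:Z%:~R.
Proof. by rewrite -pmulrn natr_Zp. Qed.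

Lemma card_Zc : #|A| = c. Proof. by rewrite card_ord. Qed.

Lemma card_unit_Zc : #|(GRing.unit : {pred A})| = totient c.
Proof.
rewrite totient_count_coprime big_mkord -sum1_card big_mkcond /=.
by apply: eq_bigr => x _; rewrite -{1}(natr_Zp x) unitZpE //; case: coprime.
Qed.

Variable d : nat.
Hypothesis dc : (d %| c)%N.
Let b : A := (c %/ d)%N%:R.

Let d0 : (0 < d)%N. Proof. exact: dvdn_gt0 dc. Qed.

Lemma annihilator_card_ge : (c %/ d <= annihilator_card b)%N.
Proof.
pose f (j : 'I_(c %/ d)) : A := (d * j)%N%:R.
have bnd (j : 'I_(c %/ d)) : (d * j < c)%N.
  by rewrite mulnC -{2}(divnK dc) ltn_pmul2r.
have inj : injective f.
  move=> i j /(congr1 val); rewrite /= !val_Zp_nat // !modn_small //.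
  by move/eqP; rewrite eqn_pmul2l // => /eqP/val_inj.
rewrite -[X in (X <= _)%N]card_ord -(card_imset _ inj) subset_leq_card //.
apply/subsetP => s /imsetP[j _ ->]; rewrite inE /b /f.
by rewrite -natrM mulnA divnK // natrM -/c pchar_Zp // mul0r.
Qed.

Lemma square_stab_le : (square_stab b <= size (divisors d) * (2 * (c %/ d)))%N.
Proof.
apply: leq_trans (card_sqrt1 (n := c) _ dc) => //; apply: subset_leq_card.
apply/subsetP => t; rewrite !inE => /andP[_ /eqP bt].
rewrite -[(_ %| _)%Z](Zc_scaled_eq0 _ dc) rmorphB rmorphXn /= -Zc_val.
by rewrite mulrBr -/b bt mulr1 subrr.
Qed.

End ResidueRing.

(** * Primitive zeros of a binary quadratic form modulo c *)

Section QuadraticZeros.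
Variable c' : nat.
Local Notation c := c'.+2.
Local Notation A := 'Z_c.
Variables (p1 p2 p3 : int) (S0 : nat).
Let g := gcdn (gcdn (gcdn `|p1| `|p2|) `|p3|) c.
Hypothesis sqS : forall t, (t ^ 2 %| c %/ g)%N -> (t <= S0)%N.
Let Q (x : A * A) : A := p1%:~R * x.1 ^+ 2 + p2%:~R * x.1 * x.2 + p3%:~R * x.2 ^+ 2.

(** One primitive zero x0 and a completion u0 serve as a basis. As Q(x0) = 0, the form at a x0 + s
    u0 is s (a be + s al), and after division of al and be by the content g this is the situation of
    [card_linear_pairs]. *)
Lemma card_quadratic_zeros :
  (#|[pred x : A * A | primitive x && (Q x == 0%R)]| <=
   size (divisors (c %/ g)) * (c * g * S0))%N.
Proof.
have gc : (g %| c)%N by rewrite dvdn_gcdr.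
have g0 := dvdn_gt0 (ltn0Sn _) gc.
have [x0|none] := pickP [pred x : A * A | primitive x && (Q x == 0)]; last by rewrite eq_card0.
rewrite inE => /andP[/existsP[u0 /eqP xu0] /eqP Qx0].
pose al := Q u0.
pose be : A := 2 * p1%:~R * x0.1 * u0.1 + p2%:~R * (x0.1 * u0.2 + x0.2 * u0.1) +
  2 * p3%:~R * x0.2 * u0.2.
have Qlin a s : Q (a * x0.1 + s * u0.1, a * x0.2 + s * u0.2) = s * (a * be + s * al).
  transitivity (a ^+ 2 * Q x0 + s * (a * be + s * al)); last by rewrite Qx0 mulr0 add0r.
  by rewrite /Q /be /al /Q /=; ring.
have coord x : x = (cross x u0 * x0.1 + cross x0 x * u0.1,
    cross x u0 * x0.2 + cross x0 x * u0.2).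
  have E : x = (cross x0 u0 * x.1, cross x0 u0 * x.2) by rewrite xu0 !mul1r; case: x.
  by rewrite [LHS]E /cross /=; congr pair; ring.
have inj : injective (fun x => (cross x u0, cross x0 x)).
  move=> x y E; have e1 : cross x u0 = cross y u0 := congr1 fst E.
  have e2 : cross x0 x = cross x0 y := congr1 snd E.
  by rewrite (coord x) (coord y) e1 e2.
have gP (D : nat) : (D %| c)%N -> (D %| g)%N =
    [&& (c %/ D)%N%:R * p1%:~R == 0 :> A, (c %/ D)%N%:R * p2%:~R == 0 :> A &
        (c %/ D)%N%:R * p3%:~R == 0 :> A].
  by move=> Dc; rewrite !Zc_scaled_eq0 // !dvdn_gcd Dc andbT !dvdzE /= -andbA.
have valP (D : nat) (y : A) : (D %| c)%N -> ((c %/ D)%N%:R * y == 0) = (D %| val y)%N.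
  by move=> Dc; rewrite {1}(Zc_val y) Zc_scaled_eq0.
have [g1 g2 g3] : [/\ (c %/ g)%N%:R * p1%:~R = 0 :> A, (c %/ g)%N%:R * p2%:~R = 0 :> A &
    (c %/ g)%N%:R * p3%:~R = 0 :> A].
  by have := gP g gc; rewrite dvdnn => /esym/and3P[/eqP ? /eqP ? /eqP ?].
have gal : (g %| val al)%N.
  rewrite -valP // /al /Q; apply/eqP.
  set cg := (c %/ g)%N%:R in g1 g2 g3 *.
  transitivity (cg * p1%:~R * u0.1 ^+ 2 + cg * p2%:~R * u0.1 * u0.2 + cg * p3%:~R * u0.2 ^+ 2).
    by ring.
  by rewrite g1 g2 g3 !mul0r !addr0.
have gbe : (g %| val be)%N.
  rewrite -valP // /be; apply/eqP.
  set cg := (c %/ g)%N%:R in g1 g2 g3 *.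
  transitivity (2 * (cg * p1%:~R) * x0.1 * u0.1 + (cg * p2%:~R) * (x0.1 * u0.2 + x0.2 * u0.1) +
     2 * (cg * p3%:~R) * x0.2 * u0.2); first by ring.
  by rewrite g1 g2 g3 !(mulr0, mul0r) !addr0.
pose al1 := (val al %/ g)%N; pose be1 := (val be %/ g)%N.
(* A common divisor e of al1, be1 and c/g makes e g divide every value of Q, hence p1, p3 and, by
   polarisation at (1, 1), p2; so e g divides g. *)
have cop : coprime (gcdn al1 be1) (c %/ g).
  set e := gcdn (gcdn al1 be1) (c %/ g); rewrite /coprime -/e.
  have e_cg : (e %| c %/ g)%N by rewrite dvdn_gcdr.
  have Dc : (e * g %| c)%N by rewrite -(divnK gc) dvdn_pmul2r.
  have Dal : (c %/ (e * g))%N%:R * al = 0.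
    apply/eqP; rewrite valP // -(divnK gal) dvdn_pmul2r //.
    by rewrite (dvdn_trans (dvdn_gcdl _ _)) // dvdn_gcdl.
  have Dbe : (c %/ (e * g))%N%:R * be = 0.
    apply/eqP; rewrite valP // -(divnK gbe) dvdn_pmul2r //.
    by rewrite (dvdn_trans (dvdn_gcdl _ _)) // dvdn_gcdr.
  set cD := (c %/ (e * g))%N%:R in Dal Dbe.
  have DQ x : cD * Q x = 0.
    rewrite (coord x) Qlin.
    transitivity (cross x0 x * (cross x u0 * (cD * be) + cross x0 x * (cD * al))); first by ring.
    by rewrite Dal Dbe !mulr0 addr0 mulr0.
  have : (e * g %| g)%N.
    rewrite gP // -/cD.
    have q1 : cD * p1%:~R = 0 by rewrite -(DQ (1, 0)) /Q /=; ring.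
    have q3 : cD * p3%:~R = 0 by rewrite -(DQ (0, 1)) /Q /=; ring.
    have q2 : cD * p2%:~R = 0.
      transitivity (cD * Q (1, 1) - cD * p1%:~R - cD * p3%:~R); first by rewrite /Q /=; ring.
      by rewrite DQ q1 q3 !subr0.
    by rewrite q1 q2 q3 !eqxx.
  by rewrite -{2}[g]mul1n dvdn_pmul2r // dvdn1.
apply: leq_trans (card_linear_pairs (ltn0Sn _) gc cop sqS).
rewrite -(card_image inj); apply: subset_leq_card; apply/subsetP => y /imageP[x].
rewrite !inE => /andP[_ /eqP Qx] -> /=.
have : cross x0 x * (cross x u0 * be + cross x0 x * al) = 0 by rewrite -Qlin -coord.
set a := cross x u0; set s := cross x0 x => E.
have : (c %| val s * (val a * val be + val s * val al))%N.
  by rewrite -Zc_nat_eq0 natrM natrD !natrM !natr_Zp E.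
rewrite -{1}(divnK gc) -(divnK gal) -(divnK gbe) -/al1 -/be1.
have -> : (val s * (val a * (be1 * g) + val s * (al1 * g)) = val s * (val a * be1 + val s * al1) * g)%N.
  by ring.
by rewrite dvdn_pmul2r.
Qed.

End QuadraticZeros.

(** * From coincidences of words to matrix congruences *)

Section WordBridge.
Variables (c' d : nat).
Local Notation c := c'.+2.
Local Notation A := 'Z_c.
Hypothesis dc : (d %| c)%N.
Variables (a : int) (T : nat) (S : nat -> nat).
Hypothesis divT : forall g, (g %| c)%N -> (size (divisors g) <= T)%N.
Hypothesis sqS : forall g t, (g %| c)%N -> (t ^ 2 %| c %/ g)%N -> (t <= S g)%N.

(** The determinant of M2 x and M1 x is a quadratic form in x whose coefficients p1, p2, p3 measure
    the failure of M2^-1 M1 to be scalar. For g their gcd with c, M1 = lam M2 modulo g with lam^2 =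
    1, and d | g because M1 = M2 modulo d. The weight is c for the completions times the bound for
    the zeros of the form. *)
Lemma word_count_le_congr (h1 k1 h2 k2 h3 k3 : int) :
  (word_count ((c %/ d)%N%:R : A) (a * h1)%:~R k1%:~R (a * h2)%:~R k2%:~R (a * h3)%:~R k3%:~R <=
   \sum_(g <- divisors c | d %| g) \sum_(lam : 'I_g | (g%:Z %| (lam%:Z ^+ 2 - 1)%R)%Z)
     word_congr g a lam h1 k1 h2 k2 h3 k3 * (c * (T * (c * g * S g))))%N.
Proof.
pose A1 := 1 + a * h1 * k1; pose B1 := a * (h2 * (1 + a * h1 * k1) + h1).
pose C1 := k1; pose D1 := 1 + a * h2 * k1.
pose A2 := 1 + a * h3 * k3; pose B2 := a * h3.
pose C2 := k2 * (1 + a * h3 * k3) + k3; pose D2 := 1 + a * h3 * k2.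
have M1E (x : A * A) : word_left (a * h1)%:~R k1%:~R (a * h2)%:~R x =
    (A1%:~R * x.1 + B1%:~R * x.2, C1%:~R * x.1 + D1%:~R * x.2).
  by rewrite /word_left /upper_vec /lower_vec /= /A1 /B1 /C1 /D1 !(intrD, intrM); congr pair; ring.
have M2E (x : A * A) : word_right k2%:~R (a * h3)%:~R k3%:~R x =
    (A2%:~R * x.1 + B2%:~R * x.2, C2%:~R * x.1 + D2%:~R * x.2).
  by rewrite /word_right /upper_vec /lower_vec /= /A2 /B2 /C2 /D2 !(intrD, intrM); congr pair; ring.
apply: leq_trans (word_count_le _ _ _ _ _ _ _) _.
set M1 := word_left _ _ _; set M2 := word_right _ _ _.
have [/and4P[b1 b2 b3 b4]|_] := boolP (congr_mod_b _ M1 M2); last by rewrite mul0n.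
rewrite mul1n card_Zc.
pose p1 := A2 * C1 - C2 * A1; pose p2 := A2 * D1 + B2 * C1 - C2 * B1 - D2 * A1.
pose p3 := B2 * D1 - D2 * B1.
pose g := gcdn (gcdn (gcdn `|p1| `|p2|) `|p3|) c.
have gc : (g %| c)%N by rewrite dvdn_gcdr.
have g0 := dvdn_gt0 (ltn0Sn _) gc.
have [dA dC dB dD] : [/\ (d%:Z %| A1 - A2)%Z, (d%:Z %| C1 - C2)%Z, (d%:Z %| B1 - B2)%Z &
    (d%:Z %| D1 - D2)%Z].
  have cvt (x y : int) : (c %/ d)%N%:R * x%:~R == (c %/ d)%N%:R * y%:~R :> A -> (d%:Z %| x - y)%Z.
    by rewrite -subr_eq0 -mulrBr -rmorphB /= Zc_scaled_eq0.
  move: b1 b2 b3 b4; rewrite /M1 /M2 !M1E !M2E /= !mulr1 !mulr0 !addr0 !add0r.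
  by do 4 (move/cvt => ?); split.
have dg : (d %| g)%N.
  rewrite !dvdn_gcd dc andbT -!andbA; apply/and3P; split.
  - rewrite -[(_ %| _)%N]/(d%:Z %| _)%Z.
    have -> : p1 = A2 * (C1 - C2) - C2 * (A1 - A2) by rewrite /p1; ring.
    by rewrite rpredB ?dvdz_mull.
  - rewrite -[(_ %| _)%N]/(d%:Z %| _)%Z.
    have -> : p2 = A2 * (D1 - D2) + B2 * (C1 - C2) - C2 * (B1 - B2) - D2 * (A1 - A2).
      by rewrite /p2; ring.
    by rewrite !(rpredB, rpredD) ?dvdz_mull.
  rewrite -[(_ %| _)%N]/(d%:Z %| _)%Z.
  have -> : p3 = B2 * (D1 - D2) - D2 * (B1 - B2) by rewrite /p3; ring.
  by rewrite rpredB ?dvdz_mull.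
have [g1 g2 g3] : [/\ (g%:Z %| p1)%Z, (g%:Z %| p2)%Z & (g%:Z %| p3)%Z].
  have := dvdnn g; rewrite {2}/g !dvdn_gcd -!andbA => /and4P[e1 e2 e3 _].
  by split; rewrite dvdzE.
(* The upper left entry of M2^-1 M1, as det M2 = 1. *)
pose lam0 := D2 * A1 - B2 * C1.
have gz : g%:Z != 0 by rewrite eqz_nat -lt0n.
have lt_lam : (`|(lam0 %% g%:Z)%Z|%N < g)%N.
  by rewrite -ltz_nat gez0_abs ?modz_ge0 // ltz_mod.
pose lam : 'I_g := Ordinal lt_lam.
have lamE : (g%:Z %| lam0 - lam%:Z)%Z.
  rewrite /lam /= gez0_abs ?modz_ge0 //.
  by rewrite {1}(divz_eq lam0 g%:Z) addrK dvdz_mull.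
have reduce (x y : int) : (g%:Z %| x - lam0 * y)%Z -> (g%:Z %| x - lam%:Z * y)%Z.
  move=> e; have -> : x - lam%:Z * y = (x - lam0 * y) + (lam0 - lam%:Z) * y by ring.
  by rewrite rpredD // dvdz_mulr.
have sq : (g%:Z %| lam%:Z ^+ 2 - 1)%Z.
  have -> : lam%:Z ^+ 2 - 1 = - (p1 * p3) - lam0 * p2 - (lam0 - lam%:Z) * (lam0 + lam%:Z).
    (* This is the determinant of M2^-1 M1, whose rows are (lam0, - p3) and (p1, lam0 + p2). *)
    have E : lam0 * (lam0 + p2) + p1 * p3 = 1.
      by rewrite /lam0 /p1 /p2 /p3 /A1 /B1 /C1 /D1 /A2 /B2 /C2 /D2; ring.
    by rewrite -E; ring.
  apply: rpredB; last exact: dvdz_mulr.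
  apply: rpredB; last exact: dvdz_mull.
  by rewrite rpredN; apply: dvdz_mulr.
have wc : word_congr g a lam h1 k1 h2 k2 h3 k3.
  apply/and4P; split; apply: reduce.
  - have -> : (1 + a * h1 * k1) - lam0 * (1 + a * h3 * k3) = B2 * p1.
      by rewrite /lam0 /p1 /A1 /B1 /C1 /D1 /A2 /B2 /C2 /D2; ring.
    exact: dvdz_mull.
  - have -> : a * (h2 * (1 + a * h1 * k1) + h1) - lam0 * (a * h3) = B2 * p2 - A2 * p3.
      by rewrite /lam0 /p2 /p3 /A1 /B1 /C1 /D1 /A2 /B2 /C2 /D2; ring.
    by rewrite rpredB ?dvdz_mull.
  - have -> : k1 - lam0 * (k2 * (1 + a * h3 * k3) + k3) = D2 * p1.
      by rewrite /lam0 /p1 /A1 /B1 /C1 /D1 /A2 /B2 /C2 /D2; ring.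
    exact: dvdz_mull.
  - have -> : (1 + a * h2 * k1) - lam0 * (1 + a * h3 * k2) = D2 * p2 - C2 * p3.
      by rewrite /lam0 /p2 /p3 /A1 /B1 /C1 /D1 /A2 /B2 /C2 /D2; ring.
    by rewrite rpredB ?dvdz_mull.
have gin : g \in divisors c by rewrite -dvdn_divisors.
apply: (@leq_trans (c * (T * (c * g * S g)))%N); last first.
  rewrite (big_rem _ gin) /= dg (bigD1 lam) //= wc mul1n -addnA; exact: leq_addr.
rewrite leq_mul2l /=.
apply: (@leq_trans (size (divisors (c %/ g)) * (c * g * S g))%N); last first.
  by rewrite leq_mul2r divT ?orbT // dvdn_div.
have := @card_quadratic_zeros c' p1 p2 p3 (S g); rewrite -/g => /(_ (fun t => sqS gc)).
apply: leq_trans; apply: subset_leq_card; apply/subsetP => x; rewrite !inE.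
move=> /andP[-> /eqP cr] /=; apply/eqP; rewrite -cr /M1 /M2 M1E M2E /cross /=.
by rewrite /p1 /p2 /p3 !(intrB, intrD, intrM); ring.
Qed.

End WordBridge.

(** * Sums that depend on differences of indices *)

Section DifferenceSums.
Variables (R : realFieldType) (H K : nat).

Lemma sum_difference_le (f : int -> R) (i : nat) : (forall z, 0 <= f z) -> (i < H)%N ->
  \sum_(j < H) f (i%:Z - j%:Z) <= \sum_(t : 'I_(2 * H)) f (centered t).
Proof.
move=> f0 iH.
have lt (j : 'I_H) : (i + H - j < 2 * H)%N by have := ltn_ord j; lia.
pose s j : 'I_(2 * H) := Ordinal (lt j).
have inj : injective s.
  by move=> j j' /(congr1 val) /= e; apply: val_inj; have := ltn_ord j; have := ltn_ord j'; move: e => /=; lia.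
have -> : \sum_(j < H) f (i%:Z - j%:Z) = \sum_(t in [set s j | j : 'I_H]) f (centered t).
  rewrite big_imset /=; last by move=> j j' _ _; apply: inj.
  apply: eq_big => [//|j _]; rewrite /centered /=.
  by congr f; have := ltn_ord j; lia.
by rewrite [leRHS](bigID (mem [set s j | j : 'I_H])) /= lerDl sumr_ge0.
Qed.

End DifferenceSums.

(* Each sum over a pair of variables depending only on their difference is bounded
   by fixing one of them. *)
Lemma sum_six_differences_le (R : realFieldType) (H K : nat)
    (F : int -> int -> int -> int -> int -> int -> R) :
  (forall t1 t2 t3 t4 t5 t6, 0 <= F t1 t2 t3 t4 t5 t6) ->
  \sum_(k1 < K) \sum_(h1 < H) \sum_(h2 < H) \sum_(k2 < K) \sum_(k3 < K) \sum_(h3 < H)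
    \sum_(k1' < K) \sum_(h1' < H) \sum_(h2' < H) \sum_(k2' < K) \sum_(k3' < K) \sum_(h3' < H)
    F (h3%:Z - h3'%:Z) (k2%:Z - k3%:Z) (h1%:Z - h2%:Z) (k2'%:Z - k3'%:Z) (h1'%:Z - h2'%:Z)
      (k1%:Z - k1'%:Z) <=
  H%:R ^+ 3 * K%:R ^+ 3 * \sum_(t3 : 'I_(2 * H)) \sum_(t2 : 'I_(2 * K)) \sum_(t6 : 'I_(2 * K))
    \sum_(t5 : 'I_(2 * H)) \sum_(t4 : 'I_(2 * K)) \sum_(t1 : 'I_(2 * H))
    F (centered t1) (centered t2) (centered t3) (centered t4) (centered t5) (centered t6).
Proof.
move=> F0; have cst (n : nat) (B : R) (G : 'I_n -> R) : (forall i, G i <= B) ->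
    \sum_(i < n) G i <= n%:R * B.
  move=> GB; apply: (le_trans (ler_sum _ (fun i _ => GB i))).
  by rewrite sumr_const card_ord mulr_natl.
pose G2 x2 x3 := \sum_(t6 : 'I_(2 * K)) \sum_(t5 : 'I_(2 * H)) \sum_(t4 : 'I_(2 * K))
   \sum_(t1 : 'I_(2 * H)) F (centered t1) x2 x3 (centered t4) (centered t5) (centered t6).
have inner (h3 k1 : nat) x2 x3 : (h3 < H)%N -> (k1 < K)%N ->
    \sum_(k1' < K) \sum_(h1' < H) \sum_(h2' < H) \sum_(k2' < K) \sum_(k3' < K) \sum_(h3' < H)
    F (h3%:Z - h3'%:Z) x2 x3 (k2'%:Z - k3'%:Z) (h1'%:Z - h2'%:Z) (k1%:Z - k1'%:Z) <=
    H%:R * K%:R * G2 x2 x3.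
  move=> lth3 ltk1; rewrite /G2 -mulrA mulr_sumr.
  pose f6 z := H%:R * (K%:R * \sum_(t5 : 'I_(2 * H)) \sum_(t4 : 'I_(2 * K))
   \sum_(t1 : 'I_(2 * H)) F (centered t1) x2 x3 (centered t4) (centered t5) z).
  have f60 z : 0 <= f6 z.
    by rewrite /f6 !mulr_ge0 // !sumr_ge0 // => *; rewrite !sumr_ge0 // => *; rewrite sumr_ge0.
  rewrite [leRHS]mulr_sumr; apply: le_trans (sum_difference_le f60 ltk1).
  apply: ler_sum => k1' _; rewrite /f6; set z6 := _ - _; apply: (cst) => h1'.
  pose f5 z := K%:R * \sum_(t4 : 'I_(2 * K)) \sum_(t1 : 'I_(2 * H)) F (centered t1) x2 x3 (centered t4) z z6.
  have f50 z : 0 <= f5 z by rewrite /f5 mulr_ge0 // !sumr_ge0 // => *; rewrite sumr_ge0.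
  rewrite mulr_sumr; apply: le_trans (sum_difference_le f50 (ltn_ord h1')).
  apply: ler_sum => h2' _; rewrite /f5; set z5 := _ - _; apply: (cst) => k2'.
  pose f4 z := \sum_(t1 : 'I_(2 * H)) F (centered t1) x2 x3 z z5 z6.
  have f40 z : 0 <= f4 z by rewrite /f4 sumr_ge0.
  apply: le_trans (sum_difference_le f40 (ltn_ord k2')); apply: ler_sum => k3' _.
  exact: (sum_difference_le (f := fun z => F z x2 x3 _ z5 z6) _ lth3).
have G20 x2 x3 : 0 <= G2 x2 x3.
  by rewrite /G2 !sumr_ge0 // => *; rewrite !sumr_ge0 // => *; rewrite !sumr_ge0 // => *; rewrite sumr_ge0.
have -> : H%:R ^+ 3 * K%:R ^+ 3 * (\sum_(t3 : 'I_(2 * H)) \sum_(t2 : 'I_(2 * K)) \sum_(t6 : 'I_(2 * K))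
    \sum_(t5 : 'I_(2 * H)) \sum_(t4 : 'I_(2 * K)) \sum_(t1 : 'I_(2 * H))
    F (centered t1) (centered t2) (centered t3) (centered t4) (centered t5) (centered t6)) =
  K%:R * (H%:R * \sum_(t3 : 'I_(2 * H)) (K%:R * \sum_(t2 : 'I_(2 * K))
    (H%:R * (H%:R * K%:R * G2 (centered t2) (centered t3))))).
  rewrite /G2; under [in RHS]eq_bigr => t3 _ do under eq_bigr => t2 _ do rewrite mulrA.
  under [in RHS]eq_bigr => t3 _ do rewrite -mulr_sumr mulrA.
  by rewrite -mulr_sumr; ring.
apply: (cst) => k1; apply: (cst) => h1.
pose f3 z := K%:R * \sum_(t2 : 'I_(2 * K)) (H%:R * (H%:R * K%:R * G2 (centered t2) z)).
have f30 z : 0 <= f3 z by rewrite /f3 mulr_ge0 // sumr_ge0 // => *; rewrite !mulr_ge0.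
apply: le_trans (sum_difference_le f30 (ltn_ord h1)); apply: ler_sum => h2 _.
rewrite /f3; apply: (cst) => k2; set z3 := _ - _.
pose f2 z := H%:R * (H%:R * K%:R * G2 z z3).
have f20 z : 0 <= f2 z by rewrite /f2 !mulr_ge0.
apply: le_trans (sum_difference_le f20 (ltn_ord k2)); apply: ler_sum => k3 _.
rewrite /f2; apply: (cst) => h3; exact: inner.
Qed.

(** * The additive character of Z/c *)

Lemma expi2piD (R : realType) (s t : R) : expi2pi (s + t) = expi2pi s * expi2pi t.
Proof.
by rewrite /expi2pi mulrDr cosD sinD; apply/eqP; rewrite eq_complex /= eqxx addrC /=; 
  apply/eqP; ring.
Qed.

Lemma expi2pi_conj (R : realType) (t : R) : conjc (expi2pi t) = expi2pi (- t).
Proof. by rewrite /expi2pi mulrN cosN sinN. Qed.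

Lemma cabs_expi2pi (R : realType) (t : R) : cabs (expi2pi t) = 1.
Proof. by rewrite /cabs /= cos2Dsin2 sqrtr1. Qed.

Lemma expi2pi_int (R : realType) (z : int) : expi2pi (z%:~R : R) = 1.
Proof.
have nat_case n : expi2pi (n%:R : R) = 1.
  elim: n => [|n IH].
    by rewrite /expi2pi mulr0 cos0 sin0.
  rewrite -natr1 expi2piD IH mul1r /expi2pi mulr1 mulr_natl cos2pi.
  by rewrite mulr2n sinD sinpi !(mul0r, mulr0) addr0.
case: z => n; first exact: nat_case.
by rewrite NegzE mulrNz -expi2pi_conj nat_case; apply/eqP; rewrite eq_complex /= oppr0 !eqxx.
Qed.

(** The value cos(2 pi t) = 1 would force sin(pi t) = 0, but pi t lies strictly between 0 and pi. *)
Lemma expi2pi_eq1 (R : realType) (t : R) : 0 < t < 1 -> expi2pi t <> 1.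
Proof.
move=> /andP[t0 t1] E; have : cos (2 * pi * t) = 1 :> R by move: E => [].
have -> : 2 * pi * t = (pi * t) *+ 2 :> R by rewrite -mulrA mulr_natl.
rewrite cos_mulr2n => E2.
have s0 : 0 < sin (pi * t) :> R.
  apply: sin_gt0_pi; rewrite mulr_gt0 ?pi_gt0 //=.
  by rewrite -[ltRHS]mulr1 ltr_pM2l ?pi_gt0.
have := cos2Dsin2 (pi * t : R); nra.
Qed.

Section ZcCharacter.
Variables (R : realType) (c' : nat).
Local Notation c := c'.+2.

Definition Zc_char (x : 'Z_c) : R[i] := expi2pi ((val x)%:R / c%:R).

Lemma Zc_char_int (z : int) : Zc_char z%:~R = expi2pi (z%:~R / c%:R).
Proof.
have : (c%:Z %| z - (val (z%:~R : 'Z_c))%:Z)%Z.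
  by rewrite -Zc_int_eq0 rmorphB /= -Zc_val subrr.
case/dvdzP => k hk.
have {2}-> : z = (val (z%:~R : 'Z_c))%:Z + k * c%:Z by rewrite -hk; ring.
rewrite rmorphD rmorphM /= mulrDl mulfK ?pnatr_eq0 // expi2piD expi2pi_int mulr1.
by [].
Qed.

Lemma Zc_charD x y : Zc_char (x + y) = Zc_char x * Zc_char y.
Proof.
rewrite [in LHS](Zc_val x) [in LHS](Zc_val y) -rmorphD Zc_char_int rmorphD mulrDl.
by rewrite expi2piD.
Qed.

Lemma Zc_char0 : Zc_char 0 = 1.
Proof. by have := Zc_char_int 0; rewrite /= mul0r => ->; exact: (expi2pi_int R 0). Qed.

Lemma Zc_char_conj x : conjc (Zc_char x) = Zc_char (- x).
Proof.
by rewrite [in RHS](Zc_val x) -rmorphN Zc_char_int rmorphN mulNr -expi2pi_conj.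
Qed.

Lemma cabs_Zc_char x : cabs (Zc_char x) = 1.
Proof. exact: cabs_expi2pi. Qed.

(** Shifting k by 1 multiplies the sum by e(q / c), which is not 1 because 0 < q < c. *)
Lemma Zc_char_prim (q : 'Z_c) : q != 0 -> \sum_k Zc_char (q * k) = 0.
Proof.
move=> q0; have N1 : Zc_char q != 1.
  apply/eqP; apply: expi2pi_eq1; rewrite divr_gt0 ?ltr0n //=.
    by rewrite ltr_pdivrMr ?ltr0n // mul1r ltr_nat; exact: ltn_ord.
  by rewrite lt0n.
have E : \sum_k Zc_char (q * k) = Zc_char q * \sum_k Zc_char (q * k).
  rewrite mulr_sumr (reindex_inj (addIr (1 : 'Z_c))) /=.
  by apply: eq_bigr => k _; rewrite mulrDr mulr1 Zc_charD mulrC.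
have : (1 - Zc_char q) * \sum_k Zc_char (q * k) = 0.
  by rewrite mulrBl mul1r -E subrr.
move/eqP; rewrite mulf_eq0 subr_eq0 eq_sym (negPf N1) /=.
by move/eqP.
Qed.

Lemma kloosterman_Zc (m n : int) :
  kloosterman R m n c = kloosterman_ring Zc_char m%:~R n%:~R.
Proof.
rewrite /kloosterman /kloosterman_ring.
apply: eq_big => [x|x cx].
  by rewrite -[x in RHS]natr_Zp unitZpE // coprime_sym.
rewrite -Zc_char_int; congr Zc_char.
have vx : (x : 'Z_c) = x%:R by rewrite natr_Zp.
rewrite rmorphD !rmorphM /=; congr (_ * _ + _ * _); first exact: (esym vx).
have ux : (x : 'Z_c) \is a GRing.unit by rewrite vx unitZpE // coprime_sym.
apply: (mulrI ux); rewrite divrr // [X in X * _]vx -natrM.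
apply/eqP; rewrite -subr_eq0 -[X in X - _]/((x * _)%N%:Z%:~R) -[1]/(1%:Z%:~R) -rmorphB.
rewrite Zc_int_eq0.
by rewrite -eqz_mod_dvd !modz_nat invmodP.
Qed.

End ZcCharacter.

Lemma cos_ge_half (R : realType) (t : R) : 0 <= t <= 4^-1 -> 2^-1 <= cos (pi * t).
Proof.
move=> /andP[t0 t1].
have pi0 := pi_gt0 R.
have pit : 0 <= pi * (4^-1 - t) by rewrite mulr_ge0 ?subr_ge0 // ltW.
have pit0 : 0 <= pi * t by rewrite mulr_ge0 // ltW.
have c0 : 0 <= cos (pi * t) by apply: cos_ge0_pihalf; apply/andP; split; lra.
have : 0 <= cos (pi * (2 * t)) by apply: cos_ge0_pihalf; apply/andP; split; lra.
have -> : pi * (2 * t) = (pi * t) *+ 2 :> R by ring.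
by rewrite cos_mulr2n; nra.
Qed.

(** For i <= H - 1 the angle 2 pi j i / c is at most pi / 4, so every term has real part at least
    1/2. The slack 8 j in the hypothesis reflects H - 1 in place of H. *)
Lemma eigenvalue_ge (R : realType) (c' H j : nat) : (8 * (j * H) <= c'.+2 + 8 * j)%N ->
  H%:R / 2 <= cabs (\sum_(i < H) Zc_char R (j%:R * i%:R : 'Z_(c'.+2))).
Proof.
move=> jH; apply: le_trans (cabs_Re _).
rewrite raddf_sum.
have -> : H%:R / 2 = \sum_(i < H) (2^-1 : R) by rewrite sumr_const card_ord mulr_natl.
apply: ler_sum => i _.
rewrite -natrM; have -> : (j * i)%N%:R = (j * i)%N%:Z%:~R :> 'Z_c'.+2 by [].
rewrite Zc_char_int /expi2pi /=.
have -> : 2 * pi * ((j * i)%N%:Z%:~R / c'.+2%:R) = pi * (2 * (j * i)%N%:R / c'.+2%:R) :> R.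
  by rewrite -[_%:~R]pmulrn; ring.
apply: cos_ge_half; rewrite !(divr_ge0, mulr_ge0) //=.
rewrite ler_pdivrMr ?ltr0n // ler_pdivlMl //.
rewrite -!natrM ler_nat.
have := ltn_ord i; nia.
Qed.

Lemma word_sum_reorder (m n : nat) (G : 'I_m -> 'I_n -> 'I_m -> 'I_n -> 'I_m -> 'I_n -> nat) :
  (\sum_t3 \sum_t2 \sum_t6 \sum_t5 \sum_t4 \sum_t1 G t1 t2 t3 t4 t5 t6 =
   \sum_(x : 'I_m * 'I_n) \sum_(y : 'I_m * 'I_n) \sum_k2 \sum_h2
      G x.1 x.2 h2 k2 y.1 y.2)%N.
Proof.
rewrite !pair_bigA /=.
rewrite (reindex (fun p : ('I_m * 'I_n) * ('I_m * 'I_n) * 'I_n * 'I_m =>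
  (p.2, p.1.1.1.2, p.1.1.2.2, p.1.1.2.1, p.1.2, p.1.1.1.1))) //=.
exists (fun p : 'I_m * 'I_n * 'I_n * 'I_m * 'I_n * 'I_m =>
  (((p.2, p.1.1.1.1.2), (p.1.1.2, p.1.1.1.2)), p.1.2, p.1.1.1.1.1)).
  by move=> [[[[? ?] [? ?]] ?] ?] _.
by move=> [[[[[? ?] ?] ?] ?] ?] _.
Qed.

(** * The total number of words, summed over the moduli g *)

Section WordSum.
Variables (R : realType) (c' d f H K T : nat) (a : int) (S : nat -> nat).
Local Notation c := c'.+2.
Hypothesis dc : (d %| c)%N.
Hypothesis H0 : (0 < H)%N.
Hypothesis HK : (H <= K)%N.
Hypothesis HKc : (H * K <= c ^ 2)%N.
Hypothesis acop : coprimez a c%:Z.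
Hypothesis divT : forall m, (0 < m <= c ^ 2)%N -> (size (divisors m) <= T)%N.
Hypothesis sqS : forall g t, (g %| c)%N -> (t ^ 2 %| c %/ g)%N -> (t <= S g)%N.
Hypothesis dS : forall g, (g %| c)%N -> (d %| g)%N -> (d * S g <= f)%N.
Hypothesis gS : forall g, (g %| c)%N -> (g * S g <= c)%N.

Let divTc g : (g %| c)%N -> (size (divisors g) <= T)%N.
Proof.
move=> gc; apply: divT; rewrite (dvdn_gt0 _ gc) //=.
by apply: leq_trans (dvdn_leq _ gc) _ => //; rewrite -mulnn leq_pmulr.
Qed.

Definition word_sum : R :=
  \sum_(k1 < K) \sum_(h1 < H) \sum_(h2 < H) \sum_(k2 < K) \sum_(k3 < K) \sum_(h3 < H)
  \sum_(k1' < K) \sum_(h1' < H) \sum_(h2' < H) \sum_(k2' < K) \sum_(k3' < K) \sum_(h3' < H)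
    (word_count ((c %/ d)%:R : 'Z_c)
      ((a * h3%:Z)%:~R - (a * h3'%:Z)%:~R) (k2%:Z%:~R - k3%:Z%:~R)
      ((a * h1%:Z)%:~R - (a * h2%:Z)%:~R) (k2'%:Z%:~R - k3'%:Z%:~R)
      ((a * h1'%:Z)%:~R - (a * h2'%:Z)%:~R) (k1%:Z%:~R - k1'%:Z%:~R))%:R.

Let F (t1 t2 t3 t4 t5 t6 : int) : R :=
  (\sum_(g <- divisors c | (d %| g)%N)
    \sum_(lam : 'I_g | (g%:Z %| (lam%:Z ^+ 2 - 1)%R)%Z)
      word_congr g a lam%:Z t1 t2 t3 t4 t5 t6 * (c * (T * (c * g * S g))))%N%:R.

Lemma word_sum_le_centered : word_sum <= H%:R ^+ 3 * K%:R ^+ 3 *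
  \sum_(t3 < 2 * H) \sum_(t2 < 2 * K) \sum_(t6 < 2 * K) \sum_(t5 < 2 * H)
  \sum_(t4 < 2 * K) \sum_(t1 < 2 * H)
   F (centered t1) (centered t2) (centered t3) (centered t4) (centered t5) (centered t6).
Proof.
apply: le_trans (sum_six_differences_le H K _); last by move=> *; exact: ler0n.
do 12 (apply: ler_sum => ? _).
rewrite -!rmorphB -!mulrBr ler_nat.
by apply: word_count_le_congr => // g gc; exact: divTc.
Qed.

Lemma word_sum_le_divisors : word_sum <= H%:R ^+ 3 * K%:R ^+ 3 *
  \sum_(g <- divisors c | (d %| g)%N)
    \sum_(lam : 'I_g | (g%:Z %| (lam%:Z ^+ 2 - 1)%R)%Z)
     (c * (T * (c * g * S g)))%N%:R *
     (1216 * T%:R ^+ 3 * (K%:R ^+ 2 + H%:R * K%:R ^+ 3 / g%:R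
        + H%:R ^+ 3 * K%:R ^+ 3 / g%:R ^+ 3)).
Proof.
have K0 : (0 < K)%N := leq_trans H0 HK.
apply: le_trans word_sum_le_centered _; rewrite ler_wpM2l ?mulr_ge0 ?exprn_ge0 ?ler0n //.
pose W g (lam : 'I_g) t3 t2 t6 t5 t4 t1 := (word_congr g a lam%:Z (@centered H t1)
  (@centered K t2) (@centered H t3) (@centered K t4) (@centered H t5) (@centered K t6) : nat).
have -> : \sum_(t3 < 2 * H) \sum_(t2 < 2 * K) \sum_(t6 < 2 * K) \sum_(t5 < 2 * H)
  \sum_(t4 < 2 * K) \sum_(t1 < 2 * H)
   F (centered t1) (centered t2) (centered t3) (centered t4) (centered t5) (centered t6) =
  \sum_(g <- divisors c | (d %| g)%N)
    \sum_(lam : 'I_g | (g%:Z %| (lam%:Z ^+ 2 - 1)%R)%Z)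
   (c * (T * (c * g * S g)))%N%:R *
   (\sum_t3 \sum_t2 \sum_t6 \sum_t5 \sum_t4 \sum_t1 W g lam t3 t2 t6 t5 t4 t1)%N%:R.
  transitivity ((\sum_(t3 < 2 * H) \sum_(t2 < 2 * K) \sum_(t6 < 2 * K) \sum_(t5 < 2 * H)
    \sum_(t4 < 2 * K) \sum_(t1 < 2 * H)
    \sum_(g <- divisors c | (d %| g)%N)
    \sum_(lam : 'I_g | (g%:Z %| (lam%:Z ^+ 2 - 1)%R)%Z)
      W g lam t3 t2 t6 t5 t4 t1 * (c * (T * (c * g * S g))))%N%:R : R).
    by do 6 (rewrite natr_sum; apply: eq_bigr => ? _).
  transitivity ((\sum_(g <- divisors c | (d %| g)%N)
    \sum_(lam : 'I_g | (g%:Z %| (lam%:Z ^+ 2 - 1)%R)%Z)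
    (c * (T * (c * g * S g))) *
      \sum_t3 \sum_t2 \sum_t6 \sum_t5 \sum_t4 \sum_t1 W g lam t3 t2 t6 t5 t4 t1)%N%:R : R).
    congr _%:R; rewrite !pair_bigA /= exchange_big; apply: eq_bigr => g _.
    rewrite exchange_big; apply: eq_bigr => lam _.
    by rewrite !pair_bigA /= big_distrr; apply: eq_bigr => p _; rewrite mulnC.
  by do 2 (rewrite natr_sum; apply: eq_bigr => ? _); rewrite natrM.
rewrite [X in X <= _]big_seq_cond [X in _ <= X]big_seq_cond.
apply: ler_sum => g /andP[]; rewrite -dvdn_divisors // => gc dg.
apply: ler_sum => lam hlam.
rewrite ler_wpM2l ?ler0n // /W.
rewrite (word_sum_reorder (fun t1 t2 t3 t4 t5 t6 => word_congr g a lam%:Z (@centered H t1)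
  (@centered K t2) (@centered H t3) (@centered K t4) (@centered H t5) (@centered K t6))).
have g0 : (0 < g)%N by exact: dvdn_gt0 gc.
apply: word_congr_count => //.
- by rewrite coprimez_sym; apply: coprimez_dvdr acop; exact: gc.
- apply/coprimezP; case/dvdzP: hlam => q hq; exists (- q, lam%:Z) => /=.
  by rewrite mulNr -hq; ring.
- by move=> m /andP[m0 mHK]; apply: divT; rewrite m0 (leq_trans mHK HKc).
- exact: divTc.
- by apply: leq_trans (divTc (dvd1n _)).
Qed.

(** For each pair (g, lam) the bounds d S(g) <= f, g S(g) <= c and g >= d give the three terms with
    a factor 1216 T^4. There are at most T moduli g and at most 2 T roots lam of 1 modulo each,
    hence 2432 T^6. *)
Lemma word_sum_le : d%:R * word_sum <= 2432 * T%:R ^+ 6 * c%:R ^+ 2 * H%:R ^+ 3 * K%:R ^+ 3 *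
  (d%:R * c%:R * K%:R ^+ 2 + f%:R * H%:R * K%:R ^+ 3 + f%:R * H%:R ^+ 3 * K%:R ^+ 3 / d%:R ^+ 2).
Proof.
have d0 : (0 < d)%N := dvdn_gt0 (ltn0Sn _) dc.
set E := (_ + _ + _).
have E0 : 0 <= E by rewrite !addr_ge0 ?divr_ge0 ?mulr_ge0 ?exprn_ge0 ?ler0n.
have term g : (g %| c)%N -> (d %| g)%N ->
   d%:R * ((c * (T * (c * g * S g)))%N%:R *
     (1216 * T%:R ^+ 3 * (K%:R ^+ 2 + H%:R * K%:R ^+ 3 / g%:R
        + H%:R ^+ 3 * K%:R ^+ 3 / g%:R ^+ 3))) <= 1216 * T%:R ^+ 4 * c%:R ^+ 2 * E.
  move=> gc dg; have g0 : (0 < g)%N := dvdn_gt0 (ltn0Sn _) gc.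
  have gR : g%:R != 0 :> R by rewrite pnatr_eq0 -lt0n.
  have dR : d%:R != 0 :> R by rewrite pnatr_eq0 -lt0n.
  have -> : d%:R * ((c * (T * (c * g * S g)))%N%:R *
     (1216 * T%:R ^+ 3 * (K%:R ^+ 2 + H%:R * K%:R ^+ 3 / g%:R
        + H%:R ^+ 3 * K%:R ^+ 3 / g%:R ^+ 3))) =
     1216 * T%:R ^+ 4 * c%:R ^+ 2 * (d%:R * (g * S g)%N%:R * K%:R ^+ 2
       + (d * S g)%N%:R * H%:R * K%:R ^+ 3
       + (d * S g)%N%:R * H%:R ^+ 3 * K%:R ^+ 3 / g%:R ^+ 2) :> R.
    by rewrite !natrM; field.
  have P (n : nat) : 0 <= n%:R :> R by [].
  rewrite ler_wpM2l ?mulr_ge0 ?exprn_ge0 // !lerD //.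
  - by rewrite ler_wpM2r ?exprn_ge0 // ler_wpM2l // ler_nat gS.
  - by rewrite !ler_wpM2r ?exprn_ge0 // ler_nat dS.
  rewrite ler_pM ?invr_ge0 ?mulr_ge0 ?exprn_ge0 //.
    by rewrite !ler_wpM2r ?exprn_ge0 // ler_nat dS.
  by rewrite lef_pV2 ?posrE ?exprn_gt0 ?ltr0n // ler_pXn2r ?nnegrE // ler_nat dvdn_leq.
have := ler_wpM2l (ler0n R d) word_sum_le_divisors.
move/le_trans; apply; rewrite mulrCA.
have -> : 2432 * T%:R ^+ 6 * c%:R ^+ 2 * H%:R ^+ 3 * K%:R ^+ 3 * E =
  H%:R ^+ 3 * K%:R ^+ 3 * (T%:R * ((2 * T)%N%:R * (1216 * T%:R ^+ 4 * c%:R ^+ 2 * E))).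
  by rewrite natrM; ring.
rewrite ler_wpM2l ?mulr_ge0 ?exprn_ge0 ?ler0n // mulr_sumr.
have B0 : 0 <= 1216 * T%:R ^+ 4 * c%:R ^+ 2 * E by rewrite !mulr_ge0 ?exprn_ge0 ?ler0n.
apply: (@le_trans _ _ (\sum_(g <- divisors c) (2 * T)%N%:R * (1216 * T%:R ^+ 4 * c%:R ^+ 2 * E))).
  rewrite big_mkcond /= !big_seq; apply: ler_sum => g; rewrite -dvdn_divisors // => gc.
  case: ifP => dg; last by rewrite mulr_ge0.
  rewrite mulr_sumr.
  apply: (@le_trans _ _ (\sum_(lam : 'I_g | (g%:Z %| (lam%:Z ^+ 2 - 1)%R)%Z)
     (1216 * T%:R ^+ 4 * c%:R ^+ 2 * E))).
    by apply: ler_sum => lam _; exact: term.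
  rewrite sumr_const -[leLHS]mulr_natl ler_wpM2r // ler_nat.
  have g0 : (0 < g)%N := dvdn_gt0 (ltn0Sn _) gc.
  apply: leq_trans (card_sqrt1 g0 (dvdnn g)) _.
  by rewrite divnn g0 muln1 mulnC leq_mul2l divTc.
rewrite big_const_seq count_predT iter_addr_0 -[leLHS]mulr_natl.
by rewrite ler_wpM2r ?mulr_ge0 // ler_nat divTc.
Qed.
End WordSum.

(** * Choice of the lengths H and K, and collection of exponents *)

Lemma amplified_words_le (R : realFieldType) (c d f M N H K : nat) :
  (0 < c)%N -> (0 < M)%N -> (0 < N)%N -> (0 < d)%N ->
  (c <= 8 * M * H)%N -> (c <= 8 * N * K)%N ->
  (d%:R * c%:R * K%:R ^+ 2 + f%:R * H%:R * K%:R ^+ 3 + f%:R * H%:R ^+ 3 * K%:R ^+ 3 / d%:R ^+ 2)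
  <= 8 ^+ 4 * H%:R ^+ 3 * K%:R ^+ 3 *
    (d%:R * M%:R ^+ 3 * N%:R / c%:R ^+ 3 + f%:R * M%:R ^+ 2 / c%:R ^+ 2 + f%:R / d%:R ^+ 2) :> R.
Proof.
move=> c0 M0 N0 d0 cH cK.
have cR : 0 < c%:R :> R by rewrite ltr0n.
have hH : 1 <= 8 * M%:R * H%:R / c%:R :> R.
  by rewrite ler_pdivlMr // mul1r -!natrM ler_nat.
have hK : 1 <= 8 * N%:R * K%:R / c%:R :> R.
  by rewrite ler_pdivlMr // mul1r -!natrM ler_nat.
have P (n : nat) : 0 <= n%:R :> R by [].
have dR : d%:R != 0 :> R by rewrite pnatr_eq0 -lt0n.
have cR0 : c%:R != 0 :> R by rewrite gt_eqF.
(* Both u and v are at least 1, and multiplying the three terms by u^3 v, 64 u^2 and 8^4 produces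
   the right-hand side. *)
set u := 8 * M%:R * H%:R / c%:R in hH; set v := 8 * N%:R * K%:R / c%:R in hK.
have -> : 8 ^+ 4 * H%:R ^+ 3 * K%:R ^+ 3 *
    (d%:R * M%:R ^+ 3 * N%:R / c%:R ^+ 3 + f%:R * M%:R ^+ 2 / c%:R ^+ 2 + f%:R / d%:R ^+ 2) =
  d%:R * c%:R * K%:R ^+ 2 * (u ^+ 3 * v) + f%:R * H%:R * K%:R ^+ 3 * (64 * u ^+ 2) +
  f%:R * H%:R ^+ 3 * K%:R ^+ 3 / d%:R ^+ 2 * 4096 :> R.
  by rewrite /u /v; field; rewrite dR cR0.
have u2 : 1 <= u ^+ 2 by apply: exprn_ege1.
have u3 : 1 <= u ^+ 3 by apply: exprn_ege1.
rewrite !lerD // ler_peMr ?divr_ge0 ?mulr_ge0 ?exprn_ge0 //.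
- by rewrite -[1]mulr1 ler_pM.
- by lra.
by rewrite ler1n.
Qed.

(** The bounds d A >= c and T U >= c are used to the seventh power and d v <= 2 T c to the sixth.
    Thus T^19 is T^(7 + 6 + 6), c^6 is c^(12 + 6 + 2 - 14), and 8^10 = 2^30 gathers 2^12 from the
    halved lengths, 2^6 from d v and 8^4 from the words. *)
Lemma unamplify (R : realFieldType) (c d h k T A U v W B N E : R) :
  0 < c -> 0 < h -> 0 < k -> 0 <= d -> 0 <= T -> 0 <= v -> 0 <= B -> 0 <= N -> 0 <= E ->
  c <= d * A -> c <= T * U -> d * v <= 2 * T * c -> 
  d * W <= 2432 * T ^+ 6 * c ^+ 2 * h ^+ 3 * k ^+ 3 * (8 ^+ 4 * h ^+ 3 * k ^+ 3 * E) ->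
  A ^+ 7 * U ^+ 7 * (h / 2 * (k / 2)) ^+ 6 * B <= v ^+ 6 * c ^+ 12 * N * W ->
  B <= 8 ^+ 10 * 2432 * T ^+ 19 * c ^+ 6 * E * N.
Proof.
move=> c0 h0 k0 d0 T0 v0 B0 N0 E0 dA TU dv dW core.
have hk : 0 < (h / 2 * (k / 2)) ^+ 6 by rewrite exprn_gt0 // !(mulr_gt0, invr_gt0).
have ch : 0 < c ^+ 14 * (h / 2 * (k / 2)) ^+ 6 by rewrite mulr_gt0 // exprn_gt0.
rewrite -(ler_pM2l ch).
apply: (@le_trans _ _ ((d * A) ^+ 7 * (T * U) ^+ 7 * (h / 2 * (k / 2)) ^+ 6 * B)).
  rewrite !ler_wpM2r ?(ltW hk) // (exprD c 7 7).
  have c1 := ltW c0.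
  have X (x y : R) : 0 <= x -> x <= y -> x ^+ 7 <= y ^+ 7.
    by move=> x0 xy; rewrite lerXn2r // nnegrE (le_trans x0).
  by apply: ler_pM; rewrite ?exprn_ge0 ?X.
have -> : (d * A) ^+ 7 * (T * U) ^+ 7 * (h / 2 * (k / 2)) ^+ 6 * B =
  d ^+ 7 * T ^+ 7 * (A ^+ 7 * U ^+ 7 * (h / 2 * (k / 2)) ^+ 6 * B).
  by rewrite !(exprMn _ d) !(exprMn _ T); move: (_ / _ * _) => z; ring.
have dT : 0 <= d ^+ 7 * T ^+ 7 by rewrite mulr_ge0 ?exprn_ge0.
apply: le_trans (ler_wpM2l dT core) _.
have -> : d ^+ 7 * T ^+ 7 * (v ^+ 6 * c ^+ 12 * N * W) =
  T ^+ 7 * c ^+ 12 * N * ((d * v) ^+ 6 * (d * W)) by ring.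
apply: (@le_trans _ _ (T ^+ 7 * c ^+ 12 * N * ((2 * T * c) ^+ 6 *
  (2432 * T ^+ 6 * c ^+ 2 * h ^+ 3 * k ^+ 3 * (8 ^+ 4 * h ^+ 3 * k ^+ 3 * E))))).
  rewrite ler_wpM2l ?mulr_ge0 ?exprn_ge0 ?(ltW c0) //.
  apply: (@le_trans _ _ ((d * v) ^+ 6 *
  (2432 * T ^+ 6 * c ^+ 2 * h ^+ 3 * k ^+ 3 * (8 ^+ 4 * h ^+ 3 * k ^+ 3 * E)))).
    by rewrite ler_wpM2l // exprn_ge0 // mulr_ge0.
  rewrite ler_wpM2r ?mulr_ge0 ?exprn_ge0 ?(ltW c0) ?(ltW h0) ?(ltW k0) //.
  by rewrite lerXn2r ?nnegrE ?mulr_ge0 ?(ltW c0).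
by rewrite le_eqVlt; apply/orP; left; apply/eqP; field.
Qed.

(** When all pairs in the supports are coprime with c, the amplified inequality applies to mu = a m
    and l = n. H and K are large enough that c <= 8 M H and c <= 8 N K, yet small enough that the
    eigenvalue phases stay within pi / 4. *)
Lemma restricted_bilinear_bound (R : realType) (c' d f M N T : nat) (m0 n0 a : int)
    (S : nat -> nat) (al : 'I_M -> R[i]) (be : 'I_N -> R[i]) :
  let c := c'.+2 in
  (d %| c)%N -> (0 < N)%N -> (N <= M)%N -> (M <= c)%N -> coprimez a c%:Z ->
  (forall m, (0 < m <= c ^ 2)%N -> (size (divisors m) <= T)%N) ->
  (forall g t, (g %| c)%N -> (t ^ 2 %| c %/ g)%N -> (t <= S g)%N) ->
  (forall g, (g %| c)%N -> (d %| g)%N -> (d * S g <= f)%N) ->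
  (forall g, (g %| c)%N -> (g * S g <= c)%N) ->
  (forall k l, al k != 0 -> be l != 0 ->
     gcdz (gcdz (m0 + k%:Z) (n0 + l%:Z)) c%:Z = 1) ->
  cabs (\sum_k \sum_l al k * be l * kloosterman R (a * (m0 + k%:Z)) (n0 + l%:Z) c) ^+ 6 <=
  8 ^+ 10 * 2432 * T%:R ^+ 19 * c%:R ^+ 6 *
    (d%:R * M%:R ^+ 3 * N%:R / c%:R ^+ 3 + f%:R * M%:R ^+ 2 / c%:R ^+ 2 + f%:R / d%:R ^+ 2) *
    ((\sum_k cabs (al k) ^+ 2) * \sum_l cabs (be l) ^+ 2) ^+ 3.
Proof.
move=> c dc N0 NM Mc acop divT sqS dS gS cop.
have c0 : (0 < c)%N by [].
have M0 : (0 < M)%N := leq_trans N0 NM.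
have d0 : (0 < d)%N := dvdn_gt0 c0 dc.
have [a' aa'] : exists a' : int, (c%:Z %| a * a' - 1)%Z.
  case/coprimezP: acop => [[u v]] /= uv; exists u; apply/dvdzP; exists (- v).
  by rewrite mulNr -uv; ring.
have aa1 : (a * a')%:~R = 1 :> 'Z_c.
  by apply/eqP; rewrite -subr_eq0 -[1]/(1%:~R) -rmorphB Zc_int_eq0.
have a'cop : coprimez a' c%:Z.
  apply/coprimezP; case/dvdzP: aa' => q hq; exists (a, - q) => /=.
  by rewrite mulNr -hq; ring.
pose H := (c %/ (8 * M)).+1; pose K := (c %/ (8 * N)).+1.
have cH : (c <= 8 * M * H)%N by rewrite ltnW // mulnC -ltn_divLR ?muln_gt0.
have cK : (c <= 8 * N * K)%N by rewrite ltnW // mulnC -ltn_divLR ?muln_gt0.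
have HK : (H <= K)%N by rewrite ltnS leq_div2l ?muln_gt0 // leq_mul.
have Kc : (K <= c)%N.
  rewrite /K ltn_divLR ?muln_gt0 // -[X in (X < _)%N]muln1 ltn_mul2l /=; lia.
have HKc : (H * K <= c ^ 2)%N by rewrite -mulnn leq_mul // (leq_trans HK).
have W := @word_sum_le R c' d f H K T a' S dc (ltn0Sn _) HK HKc a'cop divT sqS dS gS.
pose mu (k : 'I_M) : 'Z_c := (a * (m0 + k%:Z))%:~R.
pose nu (l : 'I_N) : 'Z_c := (n0 + l%:Z)%:~R.
(* The inverse a' of a cancels the twist: mu k times a' i is (m0 + k) i. *)
pose ah (i : 'I_H) : 'Z_c := (a' * i%:Z)%:~R.
pose ek (j : 'I_K) : 'Z_c := j%:Z%:~R.
(* The weights move the interval to the origin, so the eigenvalues have phases k i / c with 0 <= k <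
   M. *)
pose p (i : 'I_H) := Zc_char R (- (m0 * i%:Z)%:~R : 'Z_c).
pose q (j : 'I_K) := Zc_char R (- (n0 * j%:Z)%:~R : 'Z_c).
have interval_inj n (i j : 'I_n) : (n <= c)%N -> (c%:Z %| i%:Z - j%:Z)%Z -> i = j.
  move=> nc /eqn_mod_int; rewrite !modn_small ?(leq_trans (ltn_ord _) nc) //.
  exact: val_inj.
have mu_inj : injective mu.
  move=> i j /eqP; rewrite -subr_eq0 -rmorphB Zc_int_eq0 -mulrBr Gauss_dvdzr //; last first.
    by rewrite coprimez_sym.
  by rewrite opprD addrACA subrr add0r; apply: interval_inj.
have nu_inj : injective nu.
  move=> i j /eqP; rewrite -subr_eq0 -rmorphB Zc_int_eq0.
  by rewrite opprD addrACA subrr add0r; apply: interval_inj; exact: leq_trans NM Mc.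
have bd : (c %/ d)%:R * d%:R = 0 :> 'Z_c.
  by apply/eqP; rewrite -natrM divnK // Zc_nat_eq0.
have cop' k l : al k != 0 -> be l != 0 ->
    exists x y z : 'Z_c, mu k * x + nu l * y + d%:R * z = 1.
  move=> ak bl; have E1 := cop k l ak bl.
  have [u1 [v1 E2]] := Bezoutz (m0 + k%:Z) (n0 + l%:Z).
  have [u2 [v2 E3]] := Bezoutz (gcdz (m0 + k%:Z) (n0 + l%:Z)) c%:Z.
  exists (a' * (u1 * u2))%:~R, (v1 * u2)%:~R, 0.
  rewrite mulr0 addr0 /mu /nu.
  have -> : (a * (m0 + k%:Z))%:~R * (a' * (u1 * u2))%:~R =
     (a * a')%:~R * ((m0 + k%:Z) * (u1 * u2))%:~R :> 'Z_c by rewrite -!rmorphM; congr _%:~R; ring.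
  rewrite aa1 mul1r -!rmorphM -rmorphD.
  have -> : (m0 + k%:Z) * (u1 * u2) + (n0 + l%:Z) * (v1 * u2) =
    u2 * gcdz (m0 + k%:Z) (n0 + l%:Z) by rewrite -E2; move: (m0 + k%:Z) (n0 + l%:Z) => m n; ring.
  apply/eqP; rewrite -subr_eq0 -[1]/(1%:~R) -rmorphB Zc_int_eq0.
  apply/dvdzP; exists (- v2); rewrite E1 in E3; rewrite mulNr -[X in _ - X]E3.
  by move: (gcdz _ _) => g; rewrite opprD addNKr.
have pairing (n i : nat) (x0 : int) : Zc_char R (- (x0 * i%:Z)%:~R : 'Z_c) *
   Zc_char R ((x0 + n%:Z)%:~R * i%:Z%:~R : 'Z_c) = Zc_char R (n%:R * i%:R : 'Z_c).
  rewrite -Zc_charD; congr Zc_char.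
  by rewrite -rmorphM -rmorphN -rmorphD -natrM /= pmulrn; congr _%:~R; rewrite PoszM; ring.
have eig_bound n (i : nat) : (i < n)%N ->
   (8 * (i * (c %/ (8 * n)).+1) <= c + 8 * i)%N.
  move=> ilt; rewrite mulnS mulnDr addnC leq_add2r (leq_trans _ (leq_divM c (8 * n))) //.
  by rewrite mulnA [leqLHS]mulnC !leq_mul2l (ltnW ilt) !orbT.
have eigP k : H%:R / 2 <= cabs (\sum_i p i * Zc_char R (mu k * ah i)).
  have -> : \sum_i p i * Zc_char R (mu k * ah i) =
    \sum_(i < H) Zc_char R (k%:R * i%:R : 'Z_c).
    apply: eq_bigr => i _; rewrite -(pairing k i m0); congr (_ * Zc_char _ _).
    have -> : mu k * ah i = (a * a')%:~R * ((m0 + k%:Z)%:~R * i%:Z%:~R) :> 'Z_c.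
      by rewrite -!rmorphM; congr _%:~R; ring.
    by rewrite aa1 mul1r.
  by apply: eigenvalue_ge; apply: eig_bound.
have eigQ l : K%:R / 2 <= cabs (\sum_j q j * Zc_char R (nu l * ek j)).
  have -> : \sum_j q j * Zc_char R (nu l * ek j) =
    \sum_(j < K) Zc_char R (l%:R * j%:R : 'Z_c).
    by apply: eq_bigr => j _; rewrite -(pairing l j n0).
  by apply: eigenvalue_ge; apply: eig_bound.
have H2 : 0 < H%:R / 2 :> R by rewrite divr_gt0 ?ltr0n.
have K2 : 0 < K%:R / 2 :> R by rewrite divr_gt0 ?ltr0n.
have p1 i : cabs (p i) <= 1 by rewrite cabs_Zc_char.
have q1 j : cabs (q j) <= 1 by rewrite cabs_Zc_char.
have core := amplified_bilinear_bound (@Zc_charD R c') (Zc_char0 R c') (@Zc_char_prim R c')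
  (@Zc_char_conj R c') mu_inj nu_inj bd cop' p1 q1 H2 K2 eigP eigQ.
have BE : \sum_m \sum_n al m * be n * kloosterman_ring (@Zc_char R c') (mu m) (nu n) =
  \sum_k \sum_l al k * be l * kloosterman R (a * (m0 + k%:Z)) (n0 + l%:Z) c.
  by apply: eq_bigr => k _; apply: eq_bigr => l _; rewrite kloosterman_Zc.
rewrite BE card_Zc card_unit_Zc in core.
have leR (i j : nat) : (i <= j)%N -> i%:R <= j%:R :> R by rewrite ler_nat.
have YE := amplified_words_le R f c0 M0 N0 d0 cH cK.
have W2 := le_trans W (ler_wpM2l _ YE).
have N20 : 0 <= (\sum_k cabs (al k) ^+ 2) * \sum_l cabs (be l) ^+ 2.
  by rewrite mulr_ge0 // sumr_ge0 // => *; rewrite exprn_ge0 // cabs_ge0.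
apply: (unamplify (d := d%:R) (T := T%:R)) core; rewrite ?ltr0n ?ler0n ?exprn_ge0 ?cabs_ge0 //.
- by rewrite !addr_ge0 ?divr_ge0 ?mulr_ge0 ?exprn_ge0 ?ler0n.
- by rewrite -natrM leR // (leq_trans _ (leq_mul (leqnn d) (annihilator_card_ge dc))) // mulnC divnK.
- rewrite -natrM leR // (leq_trans (leq_divisors_totient c0)) // leq_mul2r divT ?orbT //.
  by rewrite c0 -mulnn leq_pmulr.
- rewrite -!natrM leR // (leq_trans (leq_mul (leqnn d) (square_stab_le dc))) //.
  rewrite mulnCA [(d * _)%N]mulnCA [(d * _)%N]mulnC divnK // mulnCA -mulnA leq_mul2l /=.
  rewrite leq_mul2r divT ?orbT // d0 (leq_trans (dvdn_leq c0 dc)) //.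
  by rewrite -mulnn leq_pmulr.
by apply: W2; rewrite !mulr_ge0 ?exprn_ge0 ?ler0n.
Qed.

(** * Removal of the gcd condition, and the final estimate *)

Lemma big_int_interval (V : nmodType) (m0 : int) (M : nat) (P : pred int) (F : int -> V) :
  \sum_(m <- int_interval m0 M | P m) F m =
  \sum_(k < M | P (m0 + k%:Z)) F (m0 + k%:Z).
Proof. by rewrite big_map -[M in iota 0 M]subn0 -/(index_iota 0 M) big_mkord. Qed.

(** From d | g and t^2 | c/g follows d t^2 | c, hence (d t)^2 | c d, and maximality of f applies. *)
Lemma largest_square_root_divisor_ge (c d f g t : nat) : (0 < c)%N ->
  largest_square_root_divisor f (c * d) -> (g %| c)%N -> (d %| g)%N ->
  (t ^ 2 %| c %/ g)%N -> (d * t <= f)%N.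
Proof.
move=> c0 [_ [_ fmax]] gc dg tcg.
have d0 : (0 < d)%N := dvdn_gt0 (dvdn_gt0 c0 gc) dg.
have D : ((d * t) ^ 2 %| c * d)%N.
  rewrite expnMn -(divnK gc) -mulnn [(d * d * _)%N]mulnC mulnA dvdn_mul // dvdn_mul //.
by apply: fmax => //; apply: dvdn_leq => //; rewrite muln_gt0 c0.
Qed.

(** The condition (m, n, c) = 1 does not separate m from n. Sorting m by g = gcd(m, c) turns it into
    coprimality of n with g, a condition on each support. There are at most T values of g, and the
    power mean over them costs T^6, so 19 becomes 25. *)
Lemma bilinear_kloosterman_bound6 (R : realType) (c d f M N T : nat) (m0 n0 a : int)
    (alpha beta : int -> R[i]) :
  let I := int_interval m0 M in
  let J := int_interval n0 N in
  (1 < c)%N -> (d %| c)%N -> (0 < N)%N -> (N <= M)%N -> (M <= c)%N -> coprimez a c%:Z ->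
  largest_square_root_divisor f (c * d) ->
  (forall m, (0 < m <= c ^ 2)%N -> (size (divisors m) <= T)%N) ->
  cabs (bilinear_kloosterman c a I J alpha beta) ^+ 6 <=
  8 ^+ 10 * 2432 * T%:R ^+ 25 * c%:R ^+ 6 *
    (d%:R * M%:R ^+ 3 * N%:R / c%:R ^+ 3 + f%:R * M%:R ^+ 2 / c%:R ^+ 2 + f%:R / d%:R ^+ 2) *
    ((\sum_(m <- I) cabs (alpha m) ^+ 2) * \sum_(n <- J) cabs (beta n) ^+ 2) ^+ 3.
Proof.
case: c => [|[|c']] I J // _; set c := c'.+2 => dc N0 NM Mc acop fP divT.
have c0 : (0 < c)%N by [].
(* Both f/d, for d | g, and c/g bound every t with t^2 | c/g; their minimum satisfies d S(g) <= f
   and g S(g) <= c at once. *)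
pose S g := if (d %| g)%N then minn (f %/ d) (c %/ g) else (c %/ g)%N.
have sqS g t : (g %| c)%N -> (t ^ 2 %| c %/ g)%N -> (t <= S g)%N.
  move=> gc tcg; have g0 := dvdn_gt0 c0 gc.
  have tc : (t <= c %/ g)%N.
    apply: leq_trans (dvdn_leq _ tcg); last by rewrite divn_gt0 // dvdn_leq.
    by rewrite -mulnn; case: (t) => // u; rewrite leq_pmulr.
  rewrite /S; case: ifP => // dg; rewrite leq_min tc andbT leq_divRL ?(dvdn_gt0 g0) // mulnC.
  exact: largest_square_root_divisor_ge fP gc dg tcg.
have dS g : (g %| c)%N -> (d %| g)%N -> (d * S g <= f)%N.
  move=> gc dg; rewrite /S dg; apply: leq_trans (leq_divM f d).
  by rewrite mulnC leq_mul2r geq_minl orbT.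
have gS g : (g %| c)%N -> (g * S g <= c)%N.
  move=> gc; apply: leq_trans (leq_divM c g).
  by rewrite mulnC leq_mul2r /S; case: ifP => _; rewrite ?geq_minr ?leqnn ?orbT.
pose al g (k : 'I_M) := if gcdn `|m0 + k%:Z| c == g then alpha (m0 + k%:Z) else 0.
pose be g (l : 'I_N) := if coprime `|n0 + l%:Z| g then beta (n0 + l%:Z) else 0.
pose E : R := d%:R * M%:R ^+ 3 * N%:R / c%:R ^+ 3 + f%:R * M%:R ^+ 2 / c%:R ^+ 2 + f%:R / d%:R ^+ 2.
pose B g := \sum_k \sum_l al g k * be g l * kloosterman R (a * (m0 + k%:Z)) (n0 + l%:Z) c.
set A1 := \sum_(m <- I) _; set A2 := \sum_(n <- J) _.
have E0 : 0 <= E by rewrite !addr_ge0 ?divr_ge0 ?mulr_ge0 ?exprn_ge0 ?ler0n.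
have bound g : cabs (B g) ^+ 6 <= 8 ^+ 10 * 2432 * T%:R ^+ 19 * c%:R ^+ 6 * E * (A1 * A2) ^+ 3.
  apply: le_trans (restricted_bilinear_bound dc N0 NM Mc acop divT sqS dS gS _) _.
    move=> k l; rewrite /al /be; case: (_ =P g) => [<- _|_]; last by rewrite eqxx.
    case: ifP => [cop _|_]; last by rewrite eqxx.
    by rewrite /gcdz !absz_nat gcdnAC gcdnC (eqP cop).
  rewrite ler_wpM2l ?mulr_ge0 ?exprn_ge0 ?ler0n //.
  have sum_le n (x0 : int) (h : int -> R[i]) (P : pred 'I_n) :
     \sum_(k < n) cabs (if P k then h (x0 + k%:Z) else 0) ^+ 2 <=
     \sum_(m <- int_interval x0 n) cabs (h m) ^+ 2.
    rewrite big_int_interval; apply: ler_sum => k _; case: ifP => // _.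
    by rewrite cabs0 expr0n exprn_ge0 // cabs_ge0.
  have sum_ge0 n (F : 'I_n -> R[i]) : 0 <= \sum_k cabs (F k) ^+ 2.
    by rewrite sumr_ge0 // => *; rewrite exprn_ge0 // cabs_ge0.
  have prod_le := ler_pM (sum_ge0 _ (al g)) (sum_ge0 _ (be g))
    (sum_le _ m0 alpha _) (sum_le _ n0 beta _).
  have prod_ge0 := mulr_ge0 (sum_ge0 _ (al g)) (sum_ge0 _ (be g)).
  by rewrite lerXn2r // nnegrE //; exact: le_trans prod_ge0 prod_le.
have -> : bilinear_kloosterman c a I J alpha beta =
    \sum_(i < size (divisors c)) B (nth 0%N (divisors c) i).
  rewrite -(big_mkord xpredT (fun i => B (nth 0%N (divisors c) i))).
  rewrite -(big_nth 0%N xpredT B).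
  rewrite /bilinear_kloosterman big_int_interval exchange_big; apply: eq_bigr => k _.
  rewrite big_int_interval exchange_big big_mkcond; apply: eq_bigr => l _.
  rewrite (bigD1_seq (gcdn `|m0 + k%:Z| c)) ?divisors_uniq //=; last first.
    by rewrite -dvdn_divisors // dvdn_gcdr.
  rewrite big1 ?addr0 => [|g gk]; last by rewrite /al eq_sym (negPf gk) !mul0r.
  rewrite /al /be eqxx /coprime.
  have -> : (gcdz (gcdz (m0 + k%:Z) (n0 + l%:Z)) c%:Z == 1) =
     (gcdn `|n0 + l%:Z| (gcdn `|m0 + k%:Z| c) == 1%N).
    by rewrite /gcdz !absz_nat gcdnAC gcdnC.
  by case: ifP => _ //; rewrite mulr0 mul0r.
have size_le : (size (divisors c) <= T)%N by apply: divT; rewrite -mulnn leq_pmulr.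
have X0 : 0 <= 8 ^+ 10 * 2432 * T%:R ^+ 19 * c%:R ^+ 6 * E * (A1 * A2) ^+ 3.
  by apply: le_trans (bound 0%N); rewrite exprn_ge0 ?cabs_ge0.
set n := size _ in size_le *; set D := divisors c.
apply: (@le_trans _ _ ((\sum_(i < n) cabs (B (nth 0%N D i))) ^+ 6)).
  by rewrite lerXn2r ?nnegrE ?cabs_ge0 ?cabs_sum ?sumr_ge0 // => *; rewrite cabs_ge0.
apply: le_trans (power_mean6 _) _; first by move=> *; rewrite cabs_ge0.
apply: (@le_trans _ _ (n%:R ^+ 5 * (n%:R * (8 ^+ 10 * 2432 * T%:R ^+ 19 * c%:R ^+ 6 * E * (A1 * A2) ^+ 3)))).
  rewrite card_ord ler_wpM2l ?exprn_ge0 ?ler0n //.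
  rewrite mulr_natl -[n in leRHS]card_ord -sumr_const; apply: ler_sum => i _; exact: bound.
have -> : 8 ^+ 10 * 2432 * T%:R ^+ 25 * c%:R ^+ 6 * E * (A1 * A2) ^+ 3 =
  T%:R ^+ 6 * (8 ^+ 10 * 2432 * T%:R ^+ 19 * c%:R ^+ 6 * E * (A1 * A2) ^+ 3).
  by rewrite (exprD _ 6 19); move: (_ ^+ 6) (_ ^+ 19) => u v; ring.
rewrite mulrA -exprSr ler_wpM2r // lerXn2r ?nnegrE ?ler0n // ler_nat.
exact: size_le.
Qed.

Lemma powR_root6 (R : realType) (x : R) : 0 <= x -> (x `^ (6%:R^-1)) ^+ 6 = x.
Proof.
by move=> x0; rewrite -powR_mulrn ?powR_ge0 // -powRrM mulVf ?pnatr_eq0 // powRr1.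
Qed.

(** A single T serves both the divisors of c and the products h k from the word equations, all at
    most c^2. *)
Lemma divisor_max_bound (k : nat) : (0 < k)%N -> exists C : nat, forall c : nat, (0 < c)%N ->
  exists T : nat, (T ^ k <= C * c ^ 2)%N /\
    forall m, (0 < m <= c ^ 2)%N -> (size (divisors m) <= T)%N.
Proof.
move=> k0; have [C hC] := divisor_bound k; exists C => c c0.
exists (\max_(m < (c ^ 2).+1 | (0 < m)%N) size (divisors m)); split.
  elim/big_ind: _ => [|x y hx hy|m m0]; first by rewrite exp0n.
    by rewrite /maxn; case: ifP.
  by apply: leq_trans (hC m m0) _; rewrite leq_mul2l -ltnS ltn_ord orbT.
move=> m /andP[m0 mc]; have mc' : (m < (c ^ 2).+1)%N by [].
exact: (leq_bigmax_cond (F := fun m : 'I__ => size (divisors m)) (Ordinal mc')).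
Qed.

(** One has T <= (C + 1) c^(2/k), so T^25 carries the exponent 50/k, which the condition on k keeps
    below 6 eps. *)
Lemma divisor_max_le_powR (R : realType) (eps : R) (C k c T : nat) :
  0 < eps -> 50 <= 6 * eps * k%:R -> (0 < k)%N -> (0 < c)%N -> (T ^ k <= C * c ^ 2)%N ->
  T%:R ^+ 25 <= C.+1%:R ^+ 25 * (c%:R `^ eps) ^+ 6.
Proof.
move=> eps0 keps k0 c0 hT.
have kR : 0 < k%:R :> R by rewrite ltr0n.
have c1 : 1 <= c%:R :> R by rewrite ler1n.
have hT' : T%:R <= C.+1%:R * c%:R `^ (2 / k%:R) :> R.
  have -> : T%:R = (T%:R ^+ k) `^ (k%:R^-1) :> R.
    by rewrite -powR_mulrn ?ler0n // -powRrM mulfV ?gt_eqF // powRr1 ?ler0n.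
  apply: (@le_trans _ _ ((C.+1%:R * c%:R ^+ 2) `^ (k%:R^-1))).
    apply: ge0_ler_powR; rewrite ?invr_ge0 ?ler0n ?nnegrE ?mulr_ge0 ?exprn_ge0 ?ler0n //.
    by rewrite -!natrX -natrM ler_nat (leq_trans hT) // leq_mul.
  rewrite powRM ?exprn_ge0 ?ler0n // -powR_mulrn ?ler0n // -powRrM ler_wpM2r ?powR_ge0 //.
  rewrite -[leRHS]powRr1 ?ler0n // ler_powR ?ler1n // invf_le1 // ler1n //.
apply: (@le_trans _ _ ((C.+1%:R * c%:R `^ (2 / k%:R)) ^+ 25)).
  by rewrite lerXn2r ?nnegrE ?mulr_ge0 ?powR_ge0 ?ler0n.
rewrite exprMn ler_wpM2l ?exprn_ge0 ?ler0n //.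
rewrite -!powR_mulrn ?powR_ge0 // -!powRrM ler_powR // mulrAC ler_pdivrMr //.
lra.
Qed.

(** Both sides are nonnegative, and their sixth powers coincide as rational functions. *)
Lemma bounds_agree (R : realType) (c d f M N : nat) :
  (0 < c)%N -> (0 < d)%N -> (0 < M)%N -> (0 < N)%N ->
  c%:R * (d%:R * M%:R ^+ 3 * N%:R / c%:R ^+ 3
       + f%:R * M%:R ^+ 2 / c%:R ^+ 2
       + f%:R / d%:R ^+ 2) `^ (6%:R^-1) =
  Num.sqrt (M%:R * N%:R * c%:R) *
      (d%:R / N%:R ^+ 2
       + f%:R * c%:R / (M%:R * N%:R ^+ 3)
       + f%:R * c%:R ^+ 3 / (d%:R ^+ 2 * M%:R ^+ 3 * N%:R ^+ 3)) `^ (6%:R^-1) :> R.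
Proof.
move=> c0 d0 M0 N0.
have [cR dR MR NR] : [/\ c%:R != 0 :> R, d%:R != 0 :> R, M%:R != 0 :> R & N%:R != 0 :> R].
  by rewrite !pnatr_eq0 -!lt0n.
apply/eqP; rewrite -(@eqrXn2 _ 6) ?mulr_ge0 ?powR_ge0 ?sqrtr_ge0 ?ler0n //.
rewrite !exprMn !powR_root6 ?addr_ge0 ?divr_ge0 ?mulr_ge0 ?exprn_ge0 ?ler0n //.
rewrite (exprM (Num.sqrt _) 2 3) sqr_sqrtr ?mulr_ge0 ?ler0n //.
by apply/eqP; field; rewrite dR MR NR cR.
Qed.

(** The ring ['Z_c] is Z/c only for c >= 2, so c = 1 is treated apart: the Kloosterman sum is then a
    single term of modulus 1. *)
Lemma bilinear_kloosterman_bound_modulus1 (R : realType) (m0 n0 a : int) (alpha beta : int -> R[i]) :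
  cabs (bilinear_kloosterman 1 a (int_interval m0 1) (int_interval n0 1) alpha beta) <=
  l2norm (int_interval m0 1) alpha * l2norm (int_interval n0 1) beta.
Proof.
have l2E x0 h : l2norm (int_interval x0 1) h = cabs (h x0) :> R.
  by rewrite /l2norm /int_interval /= big_seq1 addr0 sqrtr_sqr ger0_norm ?cabs_ge0.
rewrite !l2E /bilinear_kloosterman /int_interval /= big_seq1 big_mkcond big_seq1 !addr0.
case: ifP => _; last by rewrite cabs0 mulr_ge0 ?cabs_ge0.
by rewrite /kloosterman big_mkcond big_ord1 /= !cabsM cabs_expi2pi mulr1.
Qed.

Theorem theorem7p1 (R : realType) :
  forall eps : R, 0 < eps ->
  exists K : R,
  forall (c d d' e f M N : nat) (m0 n0 a : int) (alpha beta : int -> R[i]),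
    (0 < d)%N -> (0 < d')%N -> (0 < e)%N ->
    c = (d * d' * e)%N -> (d' %| d)%N -> coprime d e ->
    largest_square_root_divisor f (c * d) ->
    (1 <= N)%N -> (N <= M)%N -> (M <= c)%N ->
    coprimez a c%:Z ->
    let I := int_interval m0 M in
    let J := int_interval n0 N in
    let bound1 : R :=
      l2norm I alpha * l2norm J beta * c%:R *
      (d%:R * M%:R ^+ 3 * N%:R / c%:R ^+ 3
       + f%:R * M%:R ^+ 2 / c%:R ^+ 2
       + f%:R / d%:R ^+ 2) `^ (6%:R^-1) in
    let bound2 : R :=
      l2norm I alpha * l2norm J beta * Num.sqrt (M%:R * N%:R * c%:R) *
      (d%:R / N%:R ^+ 2
       + f%:R * c%:R / (M%:R * N%:R ^+ 3)
       + f%:R * c%:R ^+ 3 / (d%:R ^+ 2 * M%:R ^+ 3 * N%:R ^+ 3)) `^ (6%:R^-1) in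
    cabs (bilinear_kloosterman c a I J alpha beta) <= K * c%:R `^ eps * bound1
    /\ bound1 = bound2.
Proof.
move=> eps eps0.
have [k k0 keps] : exists2 k : nat, (0 < k)%N & 50 <= 6 * eps * k%:R.
  exists (Num.truncn (50 / (6 * eps))).+1 => //.
  have e6 : 0 < 6 * eps by rewrite mulr_gt0.
  by rewrite -ler_pdivrMl // mulrC ltW // truncnS_gt.
have [C hC] := divisor_max_bound k0.
pose K : R := 8 ^+ 10 * 2432 * C.+1%:R ^+ 25.
(* Sixth powers are compared at the end, and K <= K^6 avoids extracting a root of the constant. *)
have K1 : 1 <= K.
  by rewrite !mulr_ege1 ?exprn_ege1 ?ler1n.
exists K => c d d' e f M N m0 n0 a alpha beta d0 d'0 e0 cE _ _ fP N1 NM Mc acop I J bound1 bound2.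
have c0 : (0 < c)%N by rewrite cE !muln_gt0 d0 d'0.
have M0 : (0 < M)%N := leq_trans N1 NM.
have dc : (d %| c)%N by rewrite cE -mulnA dvdn_mulr.
split; last by rewrite /bound1 /bound2 -[LHS]mulrA -[RHS]mulrA; congr (_ * _); exact: bounds_agree.
rewrite /bound1; set E := (_ + _ + _ : R).
have l2_ge0 X h : 0 <= l2norm X h :> R by exact: sqrtr_ge0.
have E0 : 0 <= E by rewrite !addr_ge0 ?divr_ge0 ?mulr_ge0 ?exprn_ge0 ?ler0n.
(* For c = 1 all of d, M, N are 1 and f >= 1, so the bracket is at least 1 and the trivial bound
   suffices. *)
have [c1|c1] := leqP c 1.
  have [cE1 dE1 ME1 NE1] : [/\ c = 1, d = 1, M = 1 & N = 1]%N.
    by have := dvdn_leq c0 dc; split; lia.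
  have f1 : (1 <= f)%N by case: fP => _ [_]; apply=> //; rewrite muln_gt0 c0.
  rewrite /I /J ME1 NE1 {1}cE1 (le_trans (bilinear_kloosterman_bound_modulus1 _ _ _ _ _)) //.
  rewrite cE1 powR1 mulr1 -[leLHS]mul1r mulr1; apply: ler_pM; rewrite ?mulr_ge0 //.
  rewrite -[leLHS]mulr1 ler_wpM2l ?mulr_ge0 //.
  rewrite -(@ler_pXn2r _ 6) ?nnegrE ?powR_ge0 // expr1n powR_root6 //.
  rewrite /E ME1 NE1 cE1 dE1 !(expr1n, mulr1, invr1, mul1r) -[leLHS]add0r lerD ?addr_ge0 ?ler01 ?ler0n ?ler1n //.
have [T [hT divT]] := hC c c0.
rewrite -(@ler_pXn2r _ 6) ?nnegrE ?cabs_ge0 ?mulr_ge0 ?powR_ge0 ?ler0n ?(le_trans ler01 K1) //.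
have TC := divisor_max_le_powR eps0 keps k0 c0 hT.
apply: le_trans (bilinear_kloosterman_bound6 m0 n0 alpha beta c1 dc N1 NM Mc acop fP divT) _.
have l2E X h : \sum_(m <- X) cabs (h m) ^+ 2 = l2norm X h ^+ 2 :> R.
  by rewrite sqr_sqrtr // sumr_ge0 // => *; rewrite exprn_ge0 ?cabs_ge0.
have rhsE (x y u v w z : R) : (x * y * (u * v * w * z)) ^+ 6 =
  x ^+ 6 * y ^+ 6 * (u ^+ 6 * v ^+ 6 * w ^+ 6 * z ^+ 6) by ring.
have lhsE (p t w z u v : R) : p * t * w * z * (u ^+ 2 * v ^+ 2) ^+ 3 =
  p * t * (u ^+ 6 * v ^+ 6 * w * z) by ring.
rewrite rhsE powR_root6 // !l2E lhsE.
rewrite ler_wpM2r ?mulr_ge0 ?exprn_ge0 ?ler0n //.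
apply: (@le_trans _ _ (K * (c%:R `^ eps) ^+ 6)).
  by rewrite /K -mulrA ler_wpM2l // mulr_ge0 ?exprn_ge0.
rewrite ler_wpM2r ?exprn_ge0 ?powR_ge0 //.
by rewrite exprS ler_peMr ?exprn_ege1 ?(le_trans ler01 K1).
Qed.
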